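(* For every $d\geq 1$, the polynomial $P_d$ is exact. Moreover, for $d\geq 2$ the function $$V(x,y)=\frac{1}{(d+1)(d+2)}\left[D(y^{d+1})-D(x^{d+1})-D\big((y/x)^{d+1}\big)\right]+\frac{1}{d+2}\left[D(x)-D(y)-D(x/y)\right]$$ is a volume function for $P_d$, i.e. $dV=\eta$ on the curve $C_d$ (at the points where $V$ is differentiable).
   Context: For $d\geq 1$ let $P_d(x,y)=\sum_{i,j\geq 0,\ i+j\leq d} x^i y^j$. Let $C_d=\{(x,y)\in(\mathbb{C}^* )^2: P_d(x,y)=0,\ dP_d(x,y)\neq 0\}$. On $(\mathbb{C}^* )^2$ let $\eta$ be the real $1$-form $\eta=\log|y|\,d\arg(x)-\log|x|\,d\arg(y)$; its restriction to $C_d$ is closed. A polynomial $P$ is called exact if $\eta$ restricted to its curve $C$ (smooth zeros in $(\mathbb{C}^* )^2$) is exact, and any primitive of $\eta|_C$ is called a volume function. $D$ denotes the Bloch–Wigner dilogarithm $D(z)=\operatorname{Im}(\mathrm{Li}_2(z))+\arg(1-z)\log|z|$ (with $\arg\in(-\pi,\pi]$, $\mathrm{Li}_2(z)=-\int_0^z\log(1-u)\frac{du}{u}$), a continuous function on $\mathbb{C}$, real analytic away from $0,1$, satisfying $dD(z)=-\eta(z,1-z)$. *)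

(* Defs.v *)
From Stdlib Require Import Reals.
From Coquelicot Require Import Coquelicot.
Open Scope R_scope.

(* Principal argument, with values in (-PI, PI]. The value at 0 is irrelevant:
   it only ever occurs multiplied by ln 1, or at one point of an integral. *)
Definition Carg (z : C) : R :=
  if Rle_dec 0 (Im z) then acos (Re z / Cmod z) else - acos (Re z / Cmod z).

Definition Clog (z : C) : C := (ln (Cmod z), Carg z).

Definition CRInt (f : R -> C) (a b : R) : C :=
  (RInt (fun t => Re (f t)) a b, RInt (fun t => Im (f t)) a b).

(* - \int_0^z log(1-u) du/u along the segment u = t z, t in [0,1].
   The integral is taken componentwise because, for z in [1, +oo), the real part
   of the integrand is unbounded (so that Re (Li2 z) is not meaningful there),
   whereas the imaginary part, the only one used below, is bounded and Riemann
   integrable for every z. *)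
Definition Li2 (z : C) : C :=
  (- CRInt (fun t : R => Clog (1 - RtoC t * z) / (RtoC t * z) * z) 0 1)%C.

(* The Bloch-Wigner dilogarithm. At z = 0 the junk value of ln 0 is multiplied
   by Carg 1 = 0. *)
Definition D (z : C) : R :=
  Im (Li2 z) + Carg (1 - z)%C * ln (Cmod z).

(* eta p w is the value at p = (x,y) of
     log|y| d arg(x) - log|x| d arg(y)
   on the vector w = (u,v); recall that d arg(z) = Im(dz / z). *)
Definition eta (p w : C * C) : R :=
  ln (Cmod (snd p)) * Im (fst w / fst p)%C
  - ln (Cmod (fst p)) * Im (snd w / snd p)%C.

Definition dP (P : C * C -> C) (p w : C * C) : C :=
  (C_derive (fun x => P (x, snd p)) (fst p) * fst w
   + C_derive (fun y => P (fst p, y)) (snd p) * snd w)%C.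

Definition curve (P : C * C -> C) (p : C * C) : Prop :=
  fst p <> RtoC 0 /\ snd p <> RtoC 0 /\ P p = RtoC 0 /\
  exists w : C * C, dP P p w <> RtoC 0.

Definition tangent (P : C * C -> C) (p w : C * C) : Prop := dP P p w = RtoC 0.

(* V is a primitive of eta restricted to the curve S of P: at every point p of S,
   the restriction of V to S is differentiable and its differential is eta on the
   tangent space of S at p. Only the values of V on S matter, and l is determined
   only on the tangent space. Since eta is smooth, so is the restriction of V. *)
Definition volume_function (P : C * C -> C) (V : C * C -> R) : Prop :=
  forall p : C * C, curve P p ->
  exists l : C * C -> R,
    filterdiff
      (U := prod_NormedModule R_AbsRing C_R_NormedModule C_R_NormedModule)
      (V := R_NormedModule)
      V (within (curve P) (locally p)) l /\
    forall w : C * C, tangent P p w -> l w = eta p w.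

Definition exact_polynomial (P : C * C -> C) : Prop :=
  exists V : C * C -> R, volume_function P V.

Definition P_ (d : nat) (p : C * C) : C :=
  sum_n (fun i => sum_n (fun j => (fst p ^ i * snd p ^ j)%C) (d - i)) d.

Definition V_ (d : nat) (p : C * C) : R :=
  let (x, y) := p in
  / ((INR d + 1) * (INR d + 2)) *
    (D (y ^ (d + 1))%C - D (x ^ (d + 1))%C - D ((y / x) ^ (d + 1))%C)
  + / (INR d + 2) * (D x - D y - D (x / y)%C).

(* Main.v *)
From Stdlib Require Import Reals Lra.
From Coquelicot Require Import Coquelicot.
Require Import Defs.
Open Scope R_scope.

(** Put [q(z) = 1 + z + ... + z^d] and [G(z) = D(z) - D(z^(d+1)) / (d+1)].  The
    inversion formula [D(1/z) = - D(z)] gives [(d+2) V = G(x) - G(y) - G(x/y)].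
    The singularities of [D(z)] and [D(z^(d+1))] at [z = 1] cancel in [G], and
    [dG = log|q| d arg z - log|z| d arg q] wherever [q <> 0].  The identities
      [(x - y) P_d = x q(x) - y q(y)] and [(y - 1) P_d = y^(d+1) q(x/y) - q(x)]
    express [q(y)] and [q(x/y)] through [x], [y] and [q(x)] on the curve; as [log|b| d arg a -
    log|a| d arg b] is bilinear in [(a, b)] for multiplication, they give
    [(d+2) dV = (d+2) eta].  Where [q(x)] vanishes, [|x| = |y| = 1] and [eta = 0];
    there [D(1 + e) = Im e - Im e log|e| + o(e)], and the same identities make the
    logarithmic terms of the three summands cancel up to [o].

    The differential of [D] is obtained by differentiating the integral defining
    [Li2] along lines in the open half planes; the mean value theorem on segments
    ending on the real axis carries it over to the real points, including the
    branch cut. *)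

(** * Principal argument *)

(** The shape of [G] comes from [dD = - eta(z, 1 - z)] and [1 - z^(d+1) = (1 - z) q(z)]: dividing
    [D(z^(d+1))] by [d + 1] makes the part [eta(z, 1 - z)] cancel and leaves [dG = eta(z, q(z))].
    Two obstacles shape the rest. Across the cut [z > 1] both [Im (Li2 z)] and
    [Carg (1 - z) * ln (Cmod z)] jump. Their compensation near the cut is never computed: [D]
    vanishes on the real axis and is odd under conjugation and inversion, so continuity at [a > 1]
    is inherited from [1 / a]. Secondly, a volume function must be differentiable at every smooth
    point of the curve, including those where [x], [y] and [x / y] are roots of [q]. At such a point
    no single [G] is differentiable, because its expansion contains [Im (dz / z) ln |q(z)|]. Only
    the combination is, through relations that hold on the curve. This is why the calculus below
    works with negligible functions along an arbitrary filter. *)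

Lemma Cmod_sqr (z : C) : Cmod z * Cmod z = Re z * Re z + Im z * Im z.
Proof. pose proof (Cmod2_alt z). nra. Qed.

Lemma Rsqr_div_Cmod (z : C) :
  z <> RtoC 0 -> 1 - Rsqr (Re z / Cmod z) = Rsqr (Im z / Cmod z).
Proof.
  intros Hz. pose proof (proj1 (Cmod_gt_0 z) Hz).
  pose proof (Cmod_sqr z). unfold Rsqr.
  replace 1 with (Cmod z * Cmod z / (Cmod z * Cmod z)) by (field; lra).
  rewrite H0 at 1. field. lra.
Qed.

Lemma Re_neq_0 (z : C) : Re z <> 0 -> z <> RtoC 0.
Proof. intros H ->. apply H; reflexivity. Qed.

Lemma Im_neq_0 (z : C) : Im z <> 0 -> z <> RtoC 0.
Proof. intros H ->. apply H; reflexivity. Qed.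

(** This chart is valid on the whole open half plane, imaginary axis included. With its mirror image
    under conjugation and [Carg_right] it gives three [atan] charts that cover the plane minus the
    cut [(-oo, 0]]. *)
Lemma Carg_upper (z : C) :
  0 < Im z -> Carg z = PI / 2 - atan (Re z / Im z).
Proof.
  intros H.
  assert (Hz : z <> RtoC 0) by (apply Im_neq_0; lra).
  pose proof (proj1 (Cmod_gt_0 z) Hz) as Hm.
  pose proof (Rsqr_div_Cmod z Hz) as Hs.
  assert (Hp : 0 < Im z / Cmod z) by (apply Rdiv_lt_0_compat; lra).
  assert (Hb : -1 < Re z / Cmod z < 1).
  { unfold Rsqr in Hs. split; nra. }
  unfold Carg. destruct (Rle_dec 0 (Im z)) as [_|]; [|lra].
  rewrite acos_asin by lra. rewrite asin_atan by lra.
  rewrite Hs, sqrt_Rsqr by lra. f_equal. f_equal. field. lra.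
Qed.

Lemma Carg_Cconj (z : C) : Im z <> 0 -> Carg (Cconj z) = - Carg z.
Proof.
  intros H. unfold Carg. rewrite Cmod_conj. destruct z as [a b]. simpl in *.
  destruct (Rle_dec 0 (- b)), (Rle_dec 0 b); lra.
Qed.

Lemma Carg_right (z : C) : 0 < Re z -> Carg z = atan (Im z / Re z).
Proof.
  intros H.
  assert (Hz : z <> RtoC 0) by (apply Re_neq_0; lra).
  pose proof (proj1 (Cmod_gt_0 z) Hz) as Hm.
  pose proof (Rsqr_div_Cmod z Hz) as Hs.
  assert (Hp : 0 < Re z / Cmod z) by (apply Rdiv_lt_0_compat; lra).
  unfold Carg. rewrite acos_atan, Hs by lra. rewrite sqrt_Rsqr_abs.
  rewrite <- atan_opp.
  assert (Ha : Rabs (Im z / Cmod z) = Rabs (Im z) / Cmod z)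
    by (rewrite Rabs_div, (Rabs_pos_eq (Cmod z)); lra).
  rewrite Ha. destruct (Rle_dec 0 (Im z)).
  - rewrite Rabs_pos_eq by lra. f_equal. field. lra.
  - rewrite Rabs_left by lra. f_equal. field. lra.
Qed.

Lemma Carg_bound (z : C) : Rabs (Carg z) <= PI.
Proof.
  unfold Carg. pose proof (acos_bound (Re z / Cmod z)).
  destruct (Rle_dec 0 (Im z)); apply Rabs_le; lra.
Qed.

Lemma Carg_pos_real (a : R) : 0 < a -> Carg (RtoC a) = 0.
Proof.
  intros H. rewrite Carg_right by exact H. simpl.
  unfold Rdiv. rewrite Rmult_0_l. apply atan_0.
Qed.

Lemma Carg_neg_real (a : R) : a < 0 -> Carg (RtoC a) = PI.
Proof.
  intros H. unfold Carg. rewrite Cmod_R, Rabs_left by lra. simpl.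
  destruct (Rle_dec 0 0); [|lra].
  replace (a / - a) with (Ropp 1) by (field; lra).
  rewrite acos_opp, acos_1. lra.
Qed.

Lemma locally_pos (f : R -> R) (s : R) :
  continuous f s -> 0 < f s -> locally s (fun t => 0 < f t).
Proof. intros Hc Hp. exact (Hc (fun y => 0 < y) (open_gt 0 (f s) Hp)). Qed.

(** The value is [Im (dz / z)], and the last hypothesis says that the point is off the cut. The
    upper chart [up] takes an arbitrary second coordinate, so that it also serves the lower half
    plane with [- v]. *)
Lemma is_derive_Carg (u v : R -> R) (s du dv : R) :
  is_derive u s du -> is_derive v s dv -> v s <> 0 \/ 0 < u s ->
  is_derive (fun t => Carg (u t, v t)) s
    ((dv * u s - du * v s) / (u s * u s + v s * v s)).
Proof.
  intros Hu Hv.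
  pose proof (ex_derive_continuous u s (ex_intro _ _ Hu)) as Cu.
  pose proof (ex_derive_continuous v s (ex_intro _ _ Hv)) as Cv.
  assert (up : forall v' dv', is_derive v' s dv' -> 0 < v' s ->
    is_derive (fun t => Carg (u t, v' t)) s
    ((dv' * u s - du * v' s) / (u s * u s + v' s * v' s))).
  { intros v' dv' Hv' Hp.
    pose proof (ex_derive_continuous v' s (ex_intro _ _ Hv')) as Cv'.
    apply is_derive_ext_loc with (fun t => PI / 2 - atan (u t / v' t)).
    - generalize (locally_pos v' s Cv' Hp). apply filter_imp.
      intros t Ht. rewrite Carg_upper by exact Ht. reflexivity.
    - assert (Hd : is_derive (fun t => u t / v' t) s
                ((du * v' s - u s * dv') / (v' s ^ 2))).
      { apply is_derive_div; [exact Hu|exact Hv'|lra]. }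
      evar_last.
      { apply (is_derive_minus (fun _ => PI / 2) (fun t => atan (u t / v' t))).
        - apply is_derive_const.
        - apply (is_derive_comp atan (fun t => u t / v' t)).
          + apply is_derive_Reals, derivable_pt_lim_atan.
          + exact Hd. }
      unfold minus, plus, opp, zero, scal, Rsqr; simpl; unfold mult; simpl.
      field. split; nra. }
  intros [Hn|Hp].
  - destruct (Rlt_dec 0 (v s)) as [Hp|Hp]; [exact (up v dv Hv Hp)|].
    assert (Ho : is_derive (fun t => - v t) s (- dv))
      by (apply is_derive_opp with (f := v); exact Hv).
    pose proof (ex_derive_continuous _ s (ex_intro _ _ Ho)) as Co.
    assert (Hp' : 0 < - v s) by lra.
    apply is_derive_ext_loc with (fun t => - Carg (u t, - v t)).
    + generalize (locally_pos (fun t => - v t) s Co Hp'). apply filter_imp.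
      intros t Ht. change (u t, - v t) with (Cconj (u t, v t)).
      rewrite Carg_Cconj by (simpl; lra). lra.
    + evar_last.
      * apply is_derive_opp with (f := fun t => Carg (u t, - v t)).
        exact (up _ _ Ho Hp').
      * unfold opp; simpl. field. nra.
  - apply is_derive_ext_loc with (fun t => atan (v t / u t)).
    + generalize (locally_pos u s Cu Hp). apply filter_imp.
      intros t Ht. rewrite Carg_right by exact Ht. reflexivity.
    + assert (Hd : is_derive (fun t => v t / u t) s
                ((dv * u s - v s * du) / (u s ^ 2))).
      { apply is_derive_div; [exact Hv|exact Hu|lra]. }
      evar_last.
      { apply (is_derive_comp atan (fun t => v t / u t)).
          + apply is_derive_Reals, derivable_pt_lim_atan.
          + exact Hd. }
      unfold scal, Rsqr; simpl; unfold mult; simpl.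
      field. split; nra.
Qed.

Lemma is_derive_ln_Cmod (u v : R -> R) (s du dv : R) :
  is_derive u s du -> is_derive v s dv -> (u s, v s) <> RtoC 0 ->
  is_derive (fun t => ln (Cmod (u t, v t))) s
    ((du * u s + dv * v s) / (u s * u s + v s * v s)).
Proof.
  intros Hu Hv H.
  assert (Hp : 0 < u s * u s + v s * v s).
  { pose proof (proj1 (Cmod_gt_0 _) H) as Hm.
    pose proof (Cmod_sqr (u s, v s)) as Hq. simpl in Hq. nra. }
  assert (Hsq : 0 < sqrt (u s * u s + v s * v s)) by (apply sqrt_lt_R0; lra).
  apply is_derive_ext with (fun t => ln (sqrt (u t * u t + v t * v t))).
  { intros t. unfold Cmod. simpl. f_equal. f_equal. ring. }
  evar_last.
  { apply (is_derive_comp ln (fun t => sqrt (u t * u t + v t * v t))).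
    - apply is_derive_Reals, derivable_pt_lim_ln; exact Hsq.
    - apply is_derive_sqrt; [|exact Hp].
      apply (is_derive_plus (fun t => u t * u t) (fun t => v t * v t)).
      + exact (is_derive_mult u u s _ _ Hu Hu Rmult_comm).
      + exact (is_derive_mult v v s _ _ Hv Hv Rmult_comm). }
  unfold scal, plus; simpl; unfold mult; simpl.
  (* The third occurrence is the denominator on the right; as a product of square roots it matches
     the left side, with the square root as an atom. *)
  rewrite <- (sqrt_sqrt (u s * u s + v s * v s)) at 3 by lra.
  field. lra.
Qed.

(** * Derivative of the dilogarithm along lines *)

(* The value at [0] makes the integrand of [- Im (Li2 z)] continuous on [0, 1]. *)
Definition arg_quot (z : C) (t : R) : R :=
  if Req_EM_T t 0 then - Im z else Carg (1 - RtoC t * z)%C / t.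

Lemma one_minus_scal (t : R) (z : C) :
  (1 - RtoC t * z)%C = (1 - t * Re z, - (t * Im z)).
Proof. destruct z as [a b]. apply injective_projections; simpl; ring. Qed.

(** The factor [z] cancels and [t] is real, so the imaginary part of the integrand is the argument
    divided by [t]. The endpoints, where the two integrands may differ, do not matter to
    [RInt_ext]. *)
Lemma Im_Li2 (z : C) :
  z <> RtoC 0 -> Im (Li2 z) = - RInt (arg_quot z) 0 1.
Proof.
  intros Hz.
  change (Im (Li2 z)) with
    (- RInt (fun t => Im (Clog (1 - RtoC t * z) / (RtoC t * z) * z)%C) 0 1).
  f_equal. apply RInt_ext.
  intros t Ht. rewrite Rmin_left, Rmax_right in Ht by lra.
  unfold arg_quot. destruct (Req_EM_T t 0) as [|Hn]; [lra|].
  replace (Clog (1 - RtoC t * z) / (RtoC t * z) * z)%C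
    with (Clog (1 - RtoC t * z) * RtoC (/ t))%C.
  - rewrite im_scal_r. reflexivity.
  - rewrite RtoC_inv by exact Hn.
    assert (RtoC t <> RtoC 0) by (intros E; apply Hn; exact (RtoC_inj _ _ E)).
    field. split; assumption.
Qed.

Lemma D_arg_quot (z : C) :
  z <> RtoC 0 ->
  D z = - RInt (arg_quot z) 0 1 + Carg (1 - z)%C * ln (Cmod z).
Proof. intros Hz. unfold D. rewrite Im_Li2 by exact Hz. reflexivity. Qed.

(** For [z = A + i B] this is [|1 - t z|^2], and [t z = 1] is impossible off the real axis. The
    squares are left in the form in which [is_derive_Carg] produces them. *)
Lemma sum_sqr_pos (A B t : R) :
  B <> 0 -> 0 < (1 - t * A) * (1 - t * A) + - (t * B) * - (t * B).
Proof.
  intros HB. destruct (Req_dec t 0) as [->|Ht]; [lra|].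
  assert (0 < t * t) by nra. assert (0 < B * B) by nra.
  assert (0 < (t * t) * (B * B)) by (apply Rmult_lt_0_compat; assumption).
  pose proof (Rle_0_sqr (1 - t * A)) as Hs. unfold Rsqr in Hs.
  replace (- (t * B) * - (t * B)) with ((t * t) * (B * B)) by ring. lra.
Qed.

Lemma is_derive_affine (a c s : R) : is_derive (fun s => a + s * c) s c.
Proof. auto_derive; [exact I|ring]. Qed.

(** The derivative is [Im (- w / (1 - t z))] with [w = (c, e)]. The factor [t] of the chain rule
    cancels the division by [t], so a single formula covers [t = 0] as well. *)
Lemma is_derive_arg_quot (a b c e s t : R) :
  b + s * e <> 0 ->
  is_derive (fun s => arg_quot (a + s * c, b + s * e) t) s
    ((- e * (1 - t * (a + s * c)) - c * (t * (b + s * e))) /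
     ((1 - t * (a + s * c)) * (1 - t * (a + s * c))
      + - (t * (b + s * e)) * - (t * (b + s * e)))).
Proof.
  intros HB. pose proof (sum_sqr_pos (a + s * c) _ t HB) as HN.
  unfold arg_quot. destruct (Req_EM_T t 0) as [->|Ht].
  - simpl. auto_derive; [exact I|].
    match goal with |- _ = _ / ?N => replace N with 1 by ring end. field.
  - apply is_derive_ext with
      (fun s => / t * Carg (1 - t * (a + s * c), - (t * (b + s * e)))).
    { intros s'. rewrite one_minus_scal. simpl. unfold Rdiv. ring. }
    evar_last.
    + apply is_derive_scal. apply is_derive_Carg with (du := - t * c) (dv := - t * e).
      * auto_derive; [exact I|ring].
      * auto_derive; [exact I|ring].
      * left. nra.
    + simpl. field. lra.
Qed.

Lemma is_derive_Carg_one_minus (z : C) (t : R) :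
  Im z <> 0 ->
  is_derive (fun t => Carg (1 - RtoC t * z)%C) t
    (- Im z / ((1 - t * Re z) * (1 - t * Re z) + - (t * Im z) * - (t * Im z))).
Proof.
  intros Hb. pose proof (sum_sqr_pos (Re z) _ t Hb) as HN.
  apply is_derive_ext with (fun t => Carg (1 - t * Re z, - (t * Im z))).
  { intros t'. rewrite one_minus_scal. reflexivity. }
  evar_last.
  - apply is_derive_Carg with (du := - Re z) (dv := - Im z).
    + auto_derive; [exact I|ring].
    + auto_derive; [exact I|ring].
    + destruct (Req_dec t 0) as [->|Ht]; [right; lra|left; nra].
  - simpl. field. lra.
Qed.

(** [Carg (1 - t z)] vanishes at [t = 0], so [arg_quot] is its difference quotient there, and
    continuity at [0] is differentiability of the argument at [1]. *)
Lemma continuous_arg_quot (z : C) (t : R) :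
  Im z <> 0 -> continuous (arg_quot z) t.
Proof.
  intros Hb. destruct (Req_dec t 0) as [->|Ht].
  - pose proof (is_derive_Carg_one_minus z 0 Hb) as H.
    apply is_derive_Reals in H.
    intros Q [eps HQ].
    destruct (H eps (cond_pos eps)) as [del Hd].
    exists del. intros t' Ht'. apply HQ.
    unfold ball in *; simpl in *; unfold AbsRing_ball, abs, minus, plus, opp in *; simpl in *.
    unfold arg_quot at 2. destruct (Req_EM_T 0 0) as [_|]; [|lra].
    unfold arg_quot. destruct (Req_EM_T t' 0) as [|Hn].
    + replace (_ + _) with 0 by ring. rewrite Rabs_R0. apply cond_pos.
    + replace (t' + - 0) with t' in Ht' by ring.
      specialize (Hd t' Hn Ht').
      replace (1 - RtoC 0 * z)%C with (RtoC 1) in Hd by ring.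
      rewrite Carg_pos_real in Hd by lra. rewrite Rplus_0_l in Hd.
      replace (- Im z / _) with (- Im z) in Hd by (field; lra).
      rewrite Rminus_0_r in Hd. exact Hd.
  - apply continuous_ext_loc with (fun t => Carg (1 - RtoC t * z)%C / t).
    + destruct (Rdichotomy _ _ Ht) as [Hl|Hl].
      * generalize (open_lt 0 t Hl). apply filter_imp. intros t' H'.
        unfold arg_quot. destruct (Req_EM_T t' 0); [lra|reflexivity].
      * generalize (open_gt 0 t Hl). apply filter_imp. intros t' H'.
        unfold arg_quot. destruct (Req_EM_T t' 0); [lra|reflexivity].
    + apply (ex_derive_continuous (fun t => Carg (1 - RtoC t * z)%C / t)).
      apply ex_derive_div; [|apply ex_derive_id|exact Ht].
      eexists. apply is_derive_Carg_one_minus. exact Hb.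
Qed.

Lemma ex_RInt_arg_quot (z : C) (a b : R) :
  Im z <> 0 -> ex_RInt (arg_quot z) a b.
Proof.
  intros Hb. apply (ex_RInt_continuous (V := R_CompleteNormedModule)).
  intros t _. apply continuous_arg_quot. exact Hb.
Qed.

Lemma locally_affine_neq_0 (b e s : R) :
  b + s * e <> 0 -> locally s (fun s => b + s * e <> 0).
Proof.
  intros H.
  assert (Hc : forall b e, continuous (fun s => b + s * e) s).
  { intros b' e'. apply (ex_derive_continuous (fun s => b' + s * e')).
    eexists. apply is_derive_affine. }
  destruct (Rdichotomy _ _ H) as [Hl|Hl].
  - assert (Hp : 0 < - b + s * - e) by lra.
    generalize (locally_pos _ s (Hc (- b) (- e)) Hp).
    apply filter_imp. intros x Hx. lra.
  - generalize (locally_pos _ s (Hc b e) Hl).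
    apply filter_imp. intros x Hx. lra.
Qed.

Lemma continuity_2d_pt_Derive_arg_quot (a b c e s t : R) :
  b + s * e <> 0 ->
  continuity_2d_pt
    (fun u v => Derive (fun s => arg_quot (a + s * c, b + s * e) v) u) s t.
Proof.
  intros HB. pose proof (sum_sqr_pos (a + s * c) _ t HB) as HN.
  apply continuity_2d_pt_ext_loc with (fun s t =>
    ((- e * (1 - t * (a + s * c)) - c * (t * (b + s * e))) /
     ((1 - t * (a + s * c)) * (1 - t * (a + s * c))
      + - (t * (b + s * e)) * - (t * (b + s * e))))).
  - destruct (locally_affine_neq_0 _ _ _ HB) as [del Hd].
    exists del. intros u v Hu Hv. symmetry. apply is_derive_unique.
    apply is_derive_arg_quot. apply Hd. exact Hu.
  - unfold Rdiv, Rminus.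
    assert (CA : continuity_2d_pt (fun s _ => a + s * c) s t).
    { apply continuity_2d_pt_plus; [apply continuity_2d_pt_const|].
      apply continuity_2d_pt_mult; [apply continuity_2d_pt_id1|apply continuity_2d_pt_const]. }
    assert (CB : continuity_2d_pt (fun s _ => b + s * e) s t).
    { apply continuity_2d_pt_plus; [apply continuity_2d_pt_const|].
      apply continuity_2d_pt_mult; [apply continuity_2d_pt_id1|apply continuity_2d_pt_const]. }
    assert (Cu : continuity_2d_pt (fun s t => 1 + - (t * (a + s * c))) s t).
    { apply continuity_2d_pt_plus; [apply continuity_2d_pt_const|].
      apply continuity_2d_pt_opp, continuity_2d_pt_mult; [apply continuity_2d_pt_id2|exact CA]. }
    assert (Cv : continuity_2d_pt (fun s t => t * (b + s * e)) s t).
    { apply continuity_2d_pt_mult; [apply continuity_2d_pt_id2|exact CB]. }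
    apply (continuity_2d_pt_mult
      (fun s t => - e * (1 + - (t * (a + s * c))) + - (c * (t * (b + s * e))))
      (fun s t => / ((1 + - (t * (a + s * c))) * (1 + - (t * (a + s * c))) +
      - (t * (b + s * e)) * - (t * (b + s * e))))).
    + apply continuity_2d_pt_plus.
      * apply continuity_2d_pt_mult; [apply continuity_2d_pt_const|exact Cu].
      * apply continuity_2d_pt_opp, continuity_2d_pt_mult; [apply continuity_2d_pt_const|exact Cv].
    + apply continuity_2d_pt_inv.
      * apply continuity_2d_pt_plus.
        -- apply continuity_2d_pt_mult; exact Cu.
        -- apply continuity_2d_pt_mult; apply continuity_2d_pt_opp; exact Cv.
      * unfold Rminus in HN. lra.
Qed.

(* The differential of [D] at [z] is [w |-> Im (dilog_coef z * w)]. *)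
Definition dilog_coef (z : C) : C :=
  (- (RtoC (ln (Cmod z)) / (1 - z)) - RtoC (ln (Cmod (1 - z))) / z)%C.

(** With [z = (a, b)] and [w = (c, e)] the integrand is [Im (- w / (1 - t z))], and [Phi] is its
    primitive [Im ((w / z) Log (1 - t z))] written in real terms. *)
Lemma RInt_arg_quot_derive (a b c e : R) :
  b <> 0 ->
  RInt (fun t => (- e * (1 - t * a) - c * (t * b)) /
     ((1 - t * a) * (1 - t * a) + - (t * b) * - (t * b))) 0 1
  = Im ((c, e) / (a, b))%C * ln (Cmod (1 - (a, b))%C)
    + Re ((c, e) / (a, b))%C * Carg (1 - (a, b))%C.
Proof.
  intros Hb.
  set (p := Im ((c, e) / (a, b))%C). set (q := Re ((c, e) / (a, b))%C).
  set (Phi := fun t => p * ln (Cmod (1 - t * a, - (t * b)))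
                       + q * Carg (1 - t * a, - (t * b))).
  assert (Hab : a * a + b * b <> 0) by nra.
  replace (p * _ + q * _) with (Phi 1 - Phi 0).
  - apply is_RInt_unique.
    apply (is_RInt_derive (V := R_CompleteNormedModule) Phi); intros t _.
    + pose proof (sum_sqr_pos a b t Hb) as HN.
      evar_last.
      * apply (is_derive_plus
          (fun t => p * ln (Cmod (1 - t * a, - (t * b))))
          (fun t => q * Carg (1 - t * a, - (t * b)))).
        -- apply is_derive_scal.
           apply is_derive_ln_Cmod with (u := fun t => 1 - t * a)
             (v := fun t => - (t * b)) (du := - a) (dv := - b).
           ++ auto_derive; [exact I|ring].
           ++ auto_derive; [exact I|ring].
           ++ intros E. injection E as E1 E2. rewrite E1, E2 in HN. lra.
        -- apply is_derive_scal.
           apply is_derive_Carg with (u := fun t => 1 - t * a)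
             (v := fun t => - (t * b)) (du := - a) (dv := - b).
           ++ auto_derive; [exact I|ring].
           ++ auto_derive; [exact I|ring].
           ++ destruct (Req_dec t 0) as [->|Ht]; [right; lra|left; nra].
      * unfold p, q, plus. simpl. field. split; lra.
    + apply (ex_derive_continuous (fun t => (- e * (1 - t * a) - c * (t * b)) /
        ((1 - t * a) * (1 - t * a) + - (t * b) * - (t * b)))).
      auto_derive. pose proof (sum_sqr_pos a b t Hb) as HN. unfold Rminus in HN. lra.
  - unfold Phi.
    assert (E0 : (1 - 0 * a, - (0 * b)) = RtoC 1)
      by (apply injective_projections; simpl; ring).
    assert (E1 : (1 - 1 * a, - (1 * b)) = (1 - (a, b))%C)
      by (apply injective_projections; simpl; ring).
    rewrite E0, E1, Cmod_1, ln_1, Carg_pos_real by lra. ring.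
Qed.

Lemma is_derive_D_line (z w : C) (s : R) :
  Im (z + RtoC s * w)%C <> 0 ->
  is_derive (fun s => D (z + RtoC s * w)%C) s
    (Im (dilog_coef (z + RtoC s * w) * w)%C).
Proof.
  destruct z as [a b], w as [c e].
  assert (Eq : forall s, ((a, b) + RtoC s * (c, e))%C = (a + s * c, b + s * e)).
  { intros s'. apply injective_projections; simpl; ring. }
  rewrite Eq. simpl (Im (a + s * c, b + s * e)). intros HB.
  assert (Hnz : (a + s * c, b + s * e) <> RtoC 0) by (apply Im_neq_0; exact HB).
  apply is_derive_ext_loc with (fun s =>
    - RInt (arg_quot (a + s * c, b + s * e)) 0 1
    + Carg (1 - (a + s * c), - (b + s * e)) * ln (Cmod (a + s * c, b + s * e))).
  { generalize (locally_affine_neq_0 _ _ _ HB). apply filter_imp. intros s' Hs'.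
    rewrite Eq, D_arg_quot by (apply Im_neq_0; exact Hs').
    f_equal. f_equal. f_equal. apply injective_projections; simpl; ring. }
  set (A := a + s * c) in *. set (B := b + s * e) in *.
  assert (HAB : 0 < A * A + B * B) by nra.
  assert (H1AB : 0 < (1 - A) * (1 - A) + B * B).
  { pose proof (Rle_0_sqr (1 - A)) as Hs. unfold Rsqr in Hs.
    assert (0 < B * B) by nra. lra. }
  evar_last.
  - apply (is_derive_plus (fun s => - RInt (arg_quot (a + s * c, b + s * e)) 0 1)).
    + apply is_derive_opp with
        (f := fun s => RInt (arg_quot (a + s * c, b + s * e)) 0 1).
      apply is_derive_RInt_param with
        (f := fun s t => arg_quot (a + s * c, b + s * e) t).
      * generalize (locally_affine_neq_0 _ _ _ HB). apply filter_imp.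
        intros s' Hs' t _. eexists. apply is_derive_arg_quot. exact Hs'.
      * intros t _. apply continuity_2d_pt_Derive_arg_quot. exact HB.
      * generalize (locally_affine_neq_0 _ _ _ HB). apply filter_imp.
        intros s' Hs'. apply ex_RInt_arg_quot. exact Hs'.
    + apply (is_derive_mult (fun s => Carg (1 - (a + s * c), - (b + s * e)))
        (fun s => ln (Cmod (a + s * c, b + s * e)))).
      * apply is_derive_Carg with (u := fun s => 1 - (a + s * c))
          (v := fun s => - (b + s * e)) (du := - c) (dv := - e).
        -- auto_derive; [exact I|ring].
        -- auto_derive; [exact I|ring].
        -- left. change (- B <> 0). intros E0. apply HB. lra.
      * apply is_derive_ln_Cmod with (u := fun s => a + s * c)
          (v := fun s => b + s * e) (du := c) (dv := e).
        -- apply is_derive_affine.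
        -- apply is_derive_affine.
        -- exact Hnz.
      * exact Rmult_comm.
  - rewrite (RInt_ext _ (fun t => (- e * (1 - t * A) - c * (t * B)) /
     ((1 - t * A) * (1 - t * A) + - (t * B) * - (t * B)))).
    2:{ intros t _. apply is_derive_unique, is_derive_arg_quot. exact HB. }
    rewrite RInt_arg_quot_derive by exact HB.
    fold A B. unfold dilog_coef.
    replace (1 - A, - B) with (1 - (A, B))%C
      by (apply injective_projections; simpl; ring).
    (* The argument [g] of [1 - z] occurs twice with the factor [Re (w / z)], once from the integral
       and once from the derivative of [ln (Cmod z)], with opposite signs. Only logarithms of moduli
       survive. *)
    generalize (ln (Cmod (1 - (A, B))%C)) (Carg (1 - (A, B))%C) (ln (Cmod (A, B))).
    intros l1 g l0. unfold opp, plus, mult; simpl. field. split; nra.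
Qed.

(** The balls of the product structure are squares; halving the radius suffices because
    [sqrt 2 < 2]. *)
Lemma locally_Cmod (z : C) (Q : C -> Prop) :
  locally z Q <-> exists del, 0 < del /\ forall z', Cmod (z' - z)%C < del -> Q z'.
Proof.
  split.
  - intros [del H]. exists del. split; [apply cond_pos|].
    intros z' Hz'. apply H. apply (C_NormedModule_mixin_compat1 z z' del). exact Hz'.
  - intros [del [Hd H]].
    assert (Hd2 : 0 < del / 2) by lra.
    exists (mkposreal _ Hd2). intros z' [H1 H2]. apply H.
    eapply Rle_lt_trans; [apply Cmod_2Rmax|].
    change (Rabs (fst z' - fst z) < del / 2) in H1.
    change (Rabs (snd z' - snd z) < del / 2) in H2.
    replace (fst (z' - z)%C) with (fst z' - fst z) by (simpl; ring).
    replace (snd (z' - z)%C) with (snd z' - snd z) by (simpl; ring).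
    assert (Hm : Rmax (Rabs (fst z' - fst z)) (Rabs (snd z' - snd z)) < del / 2)
      by (apply Rmax_lub_lt; assumption).
    pose proof (sqrt_pos 2). pose proof (sqrt_sqrt 2). nra.
Qed.

(** * Limits and negligible functions along a filter *)

Definition Rlim {T : Type} (F : (T -> Prop) -> Prop) (f : T -> R) (l : R) :=
  forall eps, 0 < eps -> F (fun t => Rabs (f t - l) <= eps).

Definition Clim {T : Type} (F : (T -> Prop) -> Prop) (f : T -> C) (l : C) :=
  forall eps, 0 < eps -> F (fun t => Cmod (f t - l)%C <= eps).

(** This is [f = o(m)] without division, since [m] vanishes at the base point. The filter is
    arbitrary so that the same rules serve neighbourhoods in the plane and neighbourhoods restricted
    to the curve. *)
Definition negl {T : Type} (F : (T -> Prop) -> Prop) (m f : T -> R) :=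
  forall eps, 0 < eps -> F (fun t => Rabs (f t) <= eps * m t).

Lemma im_le_Cmod (c : C) : Rabs (Im c) <= Cmod c.
Proof. eapply Rle_trans; [apply Rmax_r|apply Rmax_Cmod]. Qed.

Lemma Cmod_minus_sym (x y : C) : Cmod (x - y)%C = Cmod (y - x)%C.
Proof. replace (x - y)%C with (- (y - x))%C by ring. apply Cmod_opp. Qed.

Lemma Cmod_triangle_rev (x y : C) : Rabs (Cmod x - Cmod y) <= Cmod (x - y)%C.
Proof.
  pose proof (Cmod_triangle (x - y)%C y) as H1.
  pose proof (Cmod_triangle (y - x)%C x) as H2.
  replace (x - y + y)%C with x in H1 by ring.
  replace (y - x + x)%C with y in H2 by ring.
  rewrite (Cmod_minus_sym y x) in H2. apply Rabs_le. lra.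
Qed.

Section Filters.

Context {T : Type} (F : (T -> Prop) -> Prop) {FF : Filter F}.

Lemma Clim_const (c : C) : Clim F (fun _ => c) c.
Proof.
  intros eps He. apply filter_forall. intros t.
  replace (c - c)%C with (RtoC 0) by ring. rewrite Cmod_0. lra.
Qed.

Lemma Clim_plus (f g : T -> C) (l k : C) :
  Clim F f l -> Clim F g k -> Clim F (fun t => f t + g t)%C (l + k)%C.
Proof.
  intros Hf Hg eps He. assert (He2 : 0 < eps / 2) by lra.
  generalize (filter_and _ _ (Hf _ He2) (Hg _ He2)). apply filter_imp.
  intros t [H1 H2].
  replace (f t + g t - (l + k))%C with ((f t - l) + (g t - k))%C by ring.
  eapply Rle_trans; [apply Cmod_triangle|lra].
Qed.

Lemma Clim_opp (f : T -> C) (l : C) :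
  Clim F f l -> Clim F (fun t => - f t)%C (- l)%C.
Proof.
  intros Hf eps He. generalize (Hf eps He). apply filter_imp. intros t H.
  replace (- f t - - l)%C with (- (f t - l))%C by ring. now rewrite Cmod_opp.
Qed.

Lemma Clim_minus (f g : T -> C) (l k : C) :
  Clim F f l -> Clim F g k -> Clim F (fun t => f t - g t)%C (l - k)%C.
Proof. intros Hf Hg. apply Clim_plus; [exact Hf|now apply Clim_opp]. Qed.

Lemma Clim_bounded (f : T -> C) (l : C) :
  Clim F f l -> F (fun t => Cmod (f t) <= Cmod l + 1).
Proof.
  intros Hf. generalize (Hf 1 Rlt_0_1). apply filter_imp. intros t H.
  pose proof (Cmod_triangle_rev (f t) l) as H1.
  apply Rabs_le_between in H1. lra.
Qed.

Lemma Clim_mult (f g : T -> C) (l k : C) :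
  Clim F f l -> Clim F g k -> Clim F (fun t => f t * g t)%C (l * k)%C.
Proof.
  intros Hf Hg eps He.
  pose proof (Cmod_ge_0 l) as Hl. pose proof (Cmod_ge_0 k) as Hk.
  set (e1 := eps / (2 * (Cmod k + 1))). set (e2 := eps / (2 * (Cmod l + 1))).
  assert (H1 : 0 < e1) by (apply Rdiv_lt_0_compat; lra).
  assert (H2 : 0 < e2) by (apply Rdiv_lt_0_compat; lra).
  generalize (filter_and _ _ (filter_and _ _ (Hf e1 H1) (Hg e2 H2)) (Clim_bounded g k Hg)).
  apply filter_imp. intros t [[A1 A2] A3].
  replace (f t * g t - l * k)%C with ((f t - l) * g t + l * (g t - k))%C by ring.
  eapply Rle_trans; [apply Cmod_triangle|]. rewrite !Cmod_mult.
  assert (E1 : e1 * (Cmod k + 1) = eps / 2) by (unfold e1; field; lra).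
  assert (E2 : (Cmod l + 1) * e2 = eps / 2) by (unfold e2; field; lra).
  pose proof (Cmod_ge_0 (f t - l)%C). pose proof (Cmod_ge_0 (g t)).
  pose proof (Cmod_ge_0 (g t - k)%C).
  assert (B1 : Cmod (f t - l)%C * Cmod (g t) <= e1 * (Cmod k + 1))
    by (apply Rmult_le_compat; lra).
  assert (B2 : Cmod l * Cmod (g t - k)%C <= (Cmod l + 1) * e2)
    by (apply Rmult_le_compat; lra).
  lra.
Qed.

Lemma Clim_away_0 (f : T -> C) (l : C) :
  Clim F f l -> l <> RtoC 0 -> F (fun t => Cmod l / 2 <= Cmod (f t)).
Proof.
  intros Hf Hl. pose proof (proj1 (Cmod_gt_0 l) Hl) as Hp.
  assert (H2 : 0 < Cmod l / 2) by lra.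
  generalize (Hf _ H2). apply filter_imp. intros t H.
  pose proof (Cmod_triangle_rev (f t) l) as H1.
  apply Rabs_le_between in H1. lra.
Qed.

Lemma Clim_neq_0 (f : T -> C) (l : C) :
  Clim F f l -> l <> RtoC 0 -> F (fun t => f t <> RtoC 0).
Proof.
  intros Hf Hl. pose proof (proj1 (Cmod_gt_0 l) Hl) as Hp.
  generalize (Clim_away_0 f l Hf Hl). apply filter_imp. intros t H.
  apply Cmod_gt_0. lra.
Qed.

Lemma Clim_inv (f : T -> C) (l : C) :
  Clim F f l -> l <> RtoC 0 -> Clim F (fun t => / f t)%C (/ l)%C.
Proof.
  intros Hf Hl eps He. pose proof (proj1 (Cmod_gt_0 l) Hl) as Hp.
  assert (He1 : 0 < eps * (Cmod l * Cmod l / 2)) by (apply Rmult_lt_0_compat; nra).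
  generalize (filter_and _ _ (Hf _ He1) (Clim_away_0 f l Hf Hl)).
  apply filter_imp. intros t [H1 H2].
  assert (Hn : f t <> RtoC 0) by (apply Cmod_gt_0; lra).
  replace (/ f t - / l)%C with (- (f t - l) / (f t * l))%C by (field; split; assumption).
  rewrite Cmod_div by (apply Cmult_neq_0; assumption).
  rewrite Cmod_opp, Cmod_mult.
  assert (Hpr : 0 < Cmod (f t) * Cmod l) by (apply Rmult_lt_0_compat; lra).
  apply Rle_div_l; [exact Hpr|].
  eapply Rle_trans; [exact H1|]. apply Rmult_le_compat_l; [lra|]. nra.
Qed.

Lemma Clim_div (f g : T -> C) (l k : C) :
  Clim F f l -> Clim F g k -> k <> RtoC 0 ->
  Clim F (fun t => f t / g t)%C (l / k)%C.
Proof. intros Hf Hg Hk. apply Clim_mult; [exact Hf|now apply Clim_inv]. Qed.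

Lemma Clim_pow (f : T -> C) (l : C) (n : nat) :
  Clim F f l -> Clim F (fun t => f t ^ n)%C (l ^ n)%C.
Proof.
  intros Hf. induction n as [|n IH]; [exact (Clim_const 1)|].
  exact (Clim_mult f (fun t => f t ^ n)%C l _ Hf IH).
Qed.

Lemma Clim_RtoC (f : T -> R) (l : R) :
  Rlim F f l -> Clim F (fun t => RtoC (f t)) (RtoC l).
Proof.
  intros Hf eps He. generalize (Hf eps He). apply filter_imp. intros t H.
  rewrite <- RtoC_minus, Cmod_R. exact H.
Qed.

Lemma Rlim_Re (f : T -> C) (l : C) :
  Clim F f l -> Rlim F (fun t => Re (f t)) (Re l).
Proof.
  intros Hf eps He. generalize (Hf eps He). apply filter_imp. intros t H.
  replace (Re (f t) - Re l) with (Re (f t - l)%C) by (unfold Re; simpl; ring).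
  eapply Rle_trans; [apply re_le_Cmod|exact H].
Qed.

Lemma Rlim_Im (f : T -> C) (l : C) :
  Clim F f l -> Rlim F (fun t => Im (f t)) (Im l).
Proof.
  intros Hf eps He. generalize (Hf eps He). apply filter_imp. intros t H.
  replace (Im (f t) - Im l) with (Im (f t - l)%C) by (unfold Im; simpl; ring).
  eapply Rle_trans; [apply im_le_Cmod|exact H].
Qed.

Lemma Rlim_Cmod (f : T -> C) (l : C) :
  Clim F f l -> Rlim F (fun t => Cmod (f t)) (Cmod l).
Proof.
  intros Hf eps He. generalize (Hf eps He). apply filter_imp. intros t H.
  eapply Rle_trans; [apply Cmod_triangle_rev|exact H].
Qed.

Lemma Rlim_comp_continuous (phi : R -> R) (f : T -> R) (l : R) :
  continuous phi l -> Rlim F f l -> Rlim F (fun t => phi (f t)) (phi l).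
Proof.
  intros Hc Hf eps He.
  destruct (Hc _ (locally_ball (phi l) (mkposreal eps He))) as [del Hd].
  assert (Hd2 : 0 < del / 2) by (pose proof (cond_pos del); lra).
  generalize (Hf _ Hd2). apply filter_imp. intros t H.
  left. apply (Hd (f t)). change (Rabs (f t - l) < del).
  pose proof (cond_pos del). lra.
Qed.

Lemma continuous_ln (x : R) : 0 < x -> continuous ln x.
Proof.
  intros Hx. apply (ex_derive_continuous ln). exists (/ x).
  apply is_derive_Reals, derivable_pt_lim_ln; exact Hx.
Qed.

Lemma Rlim_ln_Cmod (f : T -> C) (l : C) :
  Clim F f l -> l <> RtoC 0 -> Rlim F (fun t => ln (Cmod (f t))) (ln (Cmod l)).
Proof.
  intros Hf Hl. apply Rlim_comp_continuous; [|now apply Rlim_Cmod].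
  apply continuous_ln. now apply Cmod_gt_0.
Qed.

Lemma Rlim_mult_bounded (f g : T -> R) (M : R) :
  Rlim F f 0 -> F (fun t => Rabs (g t) <= M) -> Rlim F (fun t => f t * g t) 0.
Proof.
  intros Hf Hg eps He. pose proof (Rabs_pos M) as HM.
  assert (He1 : 0 < eps / (Rabs M + 1)) by (apply Rdiv_lt_0_compat; lra).
  generalize (filter_and _ _ (Hf _ He1) Hg). apply filter_imp. intros t [H1 H2].
  rewrite Rminus_0_r in *. rewrite Rabs_mult.
  replace eps with (eps / (Rabs M + 1) * (Rabs M + 1)) by (field; lra).
  pose proof (Rle_abs M).
  apply Rmult_le_compat; [apply Rabs_pos|apply Rabs_pos|exact H1|lra].
Qed.

Lemma Rlim_bounded (f : T -> R) (l : R) :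
  Rlim F f l -> F (fun t => Rabs (f t) <= Rabs l + 1).
Proof.
  intros Hf. generalize (Hf 1 Rlt_0_1). apply filter_imp. intros t H.
  pose proof (Rabs_triang (f t - l) l) as H1.
  replace (f t - l + l) with (f t) in H1 by ring. lra.
Qed.

Lemma Rlim_Carg (f : T -> C) (l : C) :
  Clim F f l -> 0 < Re l -> Rlim F (fun t => Carg (f t)) (Carg l).
Proof.
  intros Hf Hl eps He.
  assert (Hl0 : l <> RtoC 0) by (apply Re_neq_0; lra).
  pose proof (Rlim_Re _ _ Hf) as HRe.
  assert (Hre : F (fun t => 0 < Re (f t))).
  { assert (H2 : 0 < Re l / 2) by lra.
    generalize (HRe _ H2). apply filter_imp. intros t H.
    apply Rabs_le_between in H. lra. }
  assert (Hq : Rlim F (fun t => Im (f t) / Re (f t)) (Im l / Re l)).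
  { assert (HC : Clim F (fun t => RtoC (Im (f t)) / RtoC (Re (f t)))%C
                   (RtoC (Im l) / RtoC (Re l))%C).
    { apply Clim_div; [apply Clim_RtoC, Rlim_Im, Hf|apply Clim_RtoC, HRe|].
      intros E. apply RtoC_inj in E. lra. }
    apply Rlim_Re in HC. rewrite <- RtoC_div in HC by lra.
    intros e' He'. generalize (filter_and _ _ Hre (HC e' He')). apply filter_imp.
    intros t [Hp H]. rewrite <- RtoC_div in H by lra. exact H. }
  assert (Ha : continuous atan (Im l / Re l)).
  { apply (ex_derive_continuous atan). eexists.
    apply is_derive_Reals, derivable_pt_lim_atan. }
  generalize (filter_and _ _ Hre (Rlim_comp_continuous _ _ _ Ha Hq eps He)).
  apply filter_imp. intros t [Hp H].
  rewrite !Carg_right by assumption. exact H.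
Qed.

Lemma negl_plus (m f g : T -> R) :
  negl F m f -> negl F m g -> negl F m (fun t => f t + g t).
Proof.
  intros Hf Hg eps He. assert (He2 : 0 < eps / 2) by lra.
  generalize (filter_and _ _ (Hf _ He2) (Hg _ He2)). apply filter_imp.
  intros t [H1 H2]. eapply Rle_trans; [apply Rabs_triang|lra].
Qed.

Lemma negl_ext_loc (m f g : T -> R) :
  F (fun t => f t = g t) -> negl F m f -> negl F m g.
Proof.
  intros H Hf eps He. generalize (filter_and _ _ H (Hf eps He)).
  apply filter_imp. intros t [<- Ht]. exact Ht.
Qed.

Lemma negl_ext (m f g : T -> R) :
  (forall t, f t = g t) -> negl F m f -> negl F m g.
Proof. intros H. apply negl_ext_loc. apply filter_forall. exact H. Qed.

Lemma negl_scal (m f : T -> R) (c : R) :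
  negl F m f -> negl F m (fun t => c * f t).
Proof.
  intros Hf eps He. pose proof (Rabs_pos c) as Hc.
  assert (He1 : 0 < eps / (Rabs c + 1)) by (apply Rdiv_lt_0_compat; lra).
  generalize (Hf _ He1). apply filter_imp. intros t H.
  rewrite Rabs_mult.
  assert (Hm : 0 <= eps / (Rabs c + 1) * m t)
    by (eapply Rle_trans; [apply Rabs_pos|exact H]).
  replace (eps * m t) with ((Rabs c + 1) * (eps / (Rabs c + 1) * m t)) by (field; lra).
  apply Rmult_le_compat; [apply Rabs_pos|apply Rabs_pos|lra|exact H].
Qed.

Lemma negl_weaken (m m' f : T -> R) (M : R) :
  F (fun t => m t <= M * m' t) -> F (fun t => 0 <= m' t) -> negl F m f -> negl F m' f.
Proof.
  intros Hm Hm' Hf eps He.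
  assert (HM : 0 < Rabs M + 1) by (pose proof (Rabs_pos M); lra).
  assert (He1 : 0 < eps / (Rabs M + 1)) by (apply Rdiv_lt_0_compat; lra).
  generalize (filter_and _ _ (filter_and _ _ Hm Hm') (Hf _ He1)). apply filter_imp.
  intros t [[H1 H1'] H2]. eapply Rle_trans; [exact H2|].
  replace (eps * m' t) with (eps / (Rabs M + 1) * ((Rabs M + 1) * m' t)) by (field; lra).
  apply Rmult_le_compat_l; [lra|].
  pose proof (Rle_abs M). nra.
Qed.

Lemma negl_mult_Rlim (m f g : T -> R) (M : R) :
  F (fun t => Rabs (f t) <= M * m t) -> F (fun t => 0 <= m t) -> Rlim F g 0 ->
  negl F m (fun t => f t * g t).
Proof.
  intros Hf Hm Hg eps He.
  assert (HM : 0 < Rabs M + 1) by (pose proof (Rabs_pos M); lra).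
  assert (He1 : 0 < eps / (Rabs M + 1)) by (apply Rdiv_lt_0_compat; lra).
  generalize (filter_and _ _ (filter_and _ _ Hf Hm) (Hg _ He1)). apply filter_imp.
  intros t [[H1 H2] H3]. rewrite Rminus_0_r in H3. rewrite Rabs_mult.
  replace (eps * m t) with ((Rabs M + 1) * m t * (eps / (Rabs M + 1))) by (field; lra).
  apply Rmult_le_compat; [apply Rabs_pos|apply Rabs_pos| |exact H3].
  pose proof (Rle_abs M). nra.
Qed.

Lemma Clim_locally_comp (f : T -> C) (l : C) (Q : C -> Prop) :
  Clim F f l -> locally l Q -> F (fun t => Q (f t)).
Proof.
  intros Hf HQ. apply locally_Cmod in HQ. destruct HQ as [del [Hd HQ]].
  assert (Hd2 : 0 < del / 2) by lra.
  generalize (Hf _ Hd2). apply filter_imp. intros t H. apply HQ. lra.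
Qed.

End Filters.

Lemma Clim_id (z : C) : Clim (locally z) (fun z' => z') z.
Proof.
  intros eps He. apply locally_Cmod. exists eps. split; [exact He|].
  intros z' H. lra.
Qed.

(** * Symmetries of the dilogarithm *)

Lemma arg_quot_Cconj (z : C) (t : R) :
  Im z <> 0 -> arg_quot (Cconj z) t = - arg_quot z t.
Proof.
  intros Hb. unfold arg_quot. destruct (Req_EM_T t 0) as [_|Ht].
  - destruct z; simpl; ring.
  - replace (1 - RtoC t * Cconj z)%C with (Cconj (1 - RtoC t * z))
      by (destruct z; apply injective_projections; simpl; ring).
    rewrite Carg_Cconj; [unfold Rdiv; ring|].
    rewrite one_minus_scal. simpl. nra.
Qed.

Lemma D_Cconj_nonreal (z : C) : Im z <> 0 -> D (Cconj z) = - D z.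
Proof.
  intros Hb.
  assert (Hz : z <> RtoC 0) by (apply Im_neq_0; exact Hb).
  assert (Hb' : Im (Cconj z) <> 0) by (destruct z; simpl in *; lra).
  rewrite !D_arg_quot by (apply Im_neq_0; assumption).
  rewrite (RInt_ext _ (fun t => - arg_quot z t))
    by (intros t _; apply arg_quot_Cconj; exact Hb).
  rewrite (RInt_opp (V := R_CompleteNormedModule) (arg_quot z))
    by (apply ex_RInt_arg_quot; exact Hb).
  rewrite Cmod_conj.
  replace (1 - Cconj z)%C with (Cconj (1 - z))
    by (destruct z; apply injective_projections; simpl; ring).
  rewrite Carg_Cconj by (destruct z; simpl in *; lra).
  unfold opp; simpl. ring.
Qed.

Lemma arg_quot_real (a t : R) :
  t <> 0 -> arg_quot (RtoC a) t = Carg (RtoC (1 - t * a)) / t.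
Proof.
  intros Ht. unfold arg_quot. destruct (Req_EM_T t 0) as [|_]; [lra|].
  rewrite <- RtoC_mult, <- RtoC_minus. reflexivity.
Qed.

(** The substantial case is [a > 1]: the argument of [1 - t a] is [0] up to [t = 1 / a] and [PI]
    beyond, so the integral is [PI * ln a], which the term [Carg (1 - a) * ln a] compensates. *)
Lemma D_real (a : R) : a <> 0 -> D (RtoC a) = 0.
Proof.
  intros Ha.
  rewrite D_arg_quot by (intros E; apply Ha; exact (RtoC_inj _ _ E)).
  rewrite <- RtoC_minus, Cmod_R.
  assert (Hz : forall b, 0 <= b -> b <= 1 -> b * a <= 1 ->
    is_RInt (arg_quot (RtoC a)) 0 b 0).
  { intros b Hb0 Hb1 Hba.
    apply (is_RInt_ext (V := R_NormedModule) (fun _ => 0)).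
    - intros t. rewrite Rmin_left, Rmax_right by lra. intros Ht.
      rewrite arg_quot_real by lra. rewrite Carg_pos_real;
        [unfold Rdiv; now rewrite Rmult_0_l|].
      destruct (Rle_dec a 0); [nra|].
      assert (t * a < b * a) by (apply Rmult_lt_compat_r; lra). lra.
    - evar_last; [apply (is_RInt_const (V := R_NormedModule))|].
      unfold scal; simpl; unfold mult; simpl. ring. }
  destruct (Rle_dec a 1) as [H1|H1].
  - rewrite (is_RInt_unique _ _ _ _ (Hz 1 Rle_0_1 (Rle_refl 1) ltac:(lra))).
    destruct (Req_dec a 1) as [->|Hn].
    + rewrite Rabs_R1, ln_1. ring.
    + rewrite Carg_pos_real by lra. ring.
  - rewrite (Carg_neg_real (1 - a)), Rabs_pos_eq by lra.
    assert (Hi : 0 < / a < 1).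
    { split; [apply Rinv_0_lt_compat; lra|].
      rewrite <- Rinv_1. apply Rinv_lt_contravar; lra. }
    assert (Hia : / a * a = 1) by (field; lra).
    assert (H : is_RInt (arg_quot (RtoC a)) (/ a) 1 (PI * ln a)).
    { apply (is_RInt_ext (V := R_NormedModule) (fun t => PI / t)).
      - intros t. rewrite Rmin_left, Rmax_right by lra. intros Ht.
        rewrite arg_quot_real by lra. rewrite Carg_neg_real; [reflexivity|].
        assert (/ a * a < t * a) by (apply Rmult_lt_compat_r; lra). lra.
      - evar_last.
        + apply (is_RInt_derive (V := R_CompleteNormedModule) (fun t => PI * ln t)).
          * intros t. rewrite Rmin_left, Rmax_right by lra. intros Ht.
            auto_derive; [lra|]. field; lra.
          * intros t. rewrite Rmin_left, Rmax_right by lra. intros Ht.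
            apply (ex_derive_continuous (fun t => PI / t)). auto_derive. lra.
        + unfold minus, plus, opp; simpl. rewrite ln_1, ln_Rinv by lra. ring. }
    rewrite (is_RInt_unique _ _ _ _
      (is_RInt_Chasles _ _ _ _ _ _ (Hz (/ a) ltac:(lra) ltac:(lra) ltac:(lra)) H)).
    unfold plus; simpl. ring.
Qed.

Lemma real_of_Im_0 (z : C) : Im z = 0 -> z = RtoC (Re z).
Proof. destruct z as [a b]. simpl. intros ->. reflexivity. Qed.

Lemma D_Im_0 (z : C) : z <> RtoC 0 -> Im z = 0 -> D z = 0.
Proof.
  intros Hz H. rewrite (real_of_Im_0 z H). apply D_real. intros E. apply Hz.
  rewrite (real_of_Im_0 z H), E. reflexivity.
Qed.

Lemma D_Cconj (z : C) : z <> RtoC 0 -> D (Cconj z) = - D z.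
Proof.
  intros Hz. destruct (Req_dec (Im z) 0) as [H|H]; [|now apply D_Cconj_nonreal].
  assert (E : Cconj z = z).
  { apply injective_projections; simpl; [reflexivity|].
    unfold Im in H. rewrite H. ring. }
  rewrite E, D_Im_0 by assumption. ring.
Qed.

(** Multiplied by [z], the second summand of [dilog_coef] becomes real and drops out. *)
Lemma Im_dilog_coef_radial (z : C) :
  Im z <> 0 ->
  Im (dilog_coef z * z)%C
  = - ln (Cmod z) * Im z / ((1 - Re z) * (1 - Re z) + Im z * Im z).
Proof.
  intros Hb. unfold dilog_coef.
  generalize (ln (Cmod z)) (ln (Cmod (1 - z)%C)). intros l0 l1.
  destruct z as [a b]. simpl in *.
  pose proof (sum_sqr_pos a b 1 Hb) as H. rewrite !Rmult_1_l in H.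
  assert (0 < a * a + b * b) by nra.
  field. split; nra.
Qed.

Lemma is_derive_zero_const (f : R -> R) (a b : R) :
  (forall x, is_derive f x 0) -> f a = f b.
Proof.
  intros H. destruct (MVT_gen f a b (fun _ => 0)) as [c [_ Hc]].
  - intros x _. apply H.
  - intros x _. apply continuity_pt_filterlim.
    apply (ex_derive_continuous f). eexists. apply H.
  - lra.
Qed.

(* On a ray, the logarithmic radial derivatives of [D z] and of
   [D (z / |z|^2)] agree, and the two points coincide on the unit circle. *)
Lemma D_inversion_upper (u : C) (r : R) :
  0 < Im u -> Cmod u = 1 -> 0 < r -> D (RtoC r * u) = D (RtoC (/ r) * u).
Proof.
  intros Hu Hm Hr.
  assert (Hd : forall x, 0 < x ->
    is_derive (fun x => D (RtoC x * u)%C) x (Im (dilog_coef (RtoC x * u) * u)%C)).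
  { intros x Hx.
    apply is_derive_ext with (fun x => D (0 + RtoC x * u)%C).
    - intros t. rewrite Cplus_0_l. reflexivity.
    - rewrite <- (Cplus_0_l (RtoC x * u)%C) at 1. apply is_derive_D_line.
      rewrite Cplus_0_l, im_scal_l. nra. }
  assert (Hrad : forall x, 0 < x ->
    x * Im (dilog_coef (RtoC x * u) * u)%C
    = - ln x * Im u * x / (1 - 2 * x * Re u + x * x)).
  { intros x Hx. pose proof (Cmod_sqr u) as Hs. rewrite Hm in Hs.
    assert (Hn : Im (RtoC x * u) <> 0) by (rewrite im_scal_l; nra).
    rewrite <- im_scal_l.
    replace (RtoC x * (dilog_coef (RtoC x * u) * u))%C
      with (dilog_coef (RtoC x * u) * (RtoC x * u))%C by ring.
    rewrite Im_dilog_coef_radial by exact Hn.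
    rewrite Cmod_mult, Hm, Rmult_1_r, Cmod_R, Rabs_pos_eq by lra.
    rewrite im_scal_l, re_scal_l.
    f_equal; [ring|].
    replace (x * x) with (x * x * (Re u * Re u + Im u * Im u))
      by (rewrite <- Hs; ring). ring. }
  (* The coordinate [s = ln x] turns inversion into [s -> - s]. In [Hrad] the quotient
     [x / (1 - 2 x Re u + x^2)] is invariant under [x -> 1 / x] and [ln x] changes sign, so the two
     contributions to the derivative of [g] cancel. *)
  pose (g := fun s => D (RtoC (exp s) * u)%C - D (RtoC (exp (- s)) * u)%C).
  assert (Hg : forall s, is_derive g s 0).
  { intros s. evar_last.
    - apply (is_derive_minus (fun s => D (RtoC (exp s) * u)%C)
               (fun s => D (RtoC (exp (- s)) * u)%C)).
      + apply (is_derive_comp (fun x => D (RtoC x * u)%C) exp).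
        * apply Hd, exp_pos.
        * apply is_derive_exp.
      + apply (is_derive_comp (fun x => D (RtoC x * u)%C) (fun s => exp (- s))).
        * apply Hd, exp_pos.
        * auto_derive; [exact I|reflexivity].
    - unfold minus, plus, opp, scal; simpl; unfold mult; simpl.
      match goal with |- ?A * ?X + - ((-(1) * ?B) * ?Y) = 0 =>
        replace (A * X + - ((-(1) * B) * Y)) with (A * X + B * Y) by ring end.
      rewrite !Hrad by apply exp_pos. rewrite !ln_exp, exp_Ropp.
      pose proof (exp_pos s) as He. set (x := exp s) in *.
      pose proof (Cmod_sqr u) as Hs. rewrite Hm in Hs.
      assert (Hq : 0 < 1 - 2 * x * Re u + x * x).
      { replace (1 - 2 * x * Re u + x * x)
          with ((x - Re u) * (x - Re u) + Im u * Im u)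
          by (rewrite <- (Rmult_1_l 1), Hs; ring).
        pose proof (Rle_0_sqr (x - Re u)) as Hsq. unfold Rsqr in Hsq. nra. }
      field. repeat split; nra. }
  pose proof (is_derive_zero_const g (ln r) 0 Hg) as E. unfold g in E.
  rewrite Ropp_0, exp_Ropp, exp_ln in E by exact Hr. lra.
Qed.

(** [1 / z] is the conjugate of [z / |z|^2]; inversion in the unit circle preserves [D] on the upper
    half plane and conjugation changes its sign. *)
Lemma D_inv (z : C) : z <> RtoC 0 -> D (/ z) = - D z.
Proof.
  assert (Hup : forall z, 0 < Im z -> D (/ z) = - D z).
  { clear z. intros z Hb.
    assert (Hz : z <> RtoC 0) by (apply Im_neq_0; lra).
    pose proof (proj1 (Cmod_gt_0 z) Hz) as Hm.
    assert (HmC : RtoC (Cmod z) <> RtoC 0)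
      by (intros E; apply RtoC_inj in E; lra).
    set (u := (z / RtoC (Cmod z))%C).
    assert (Hu : 0 < Im u).
    { unfold u. unfold Cdiv. rewrite <- RtoC_inv, im_scal_r by lra.
      apply Rmult_lt_0_compat; [exact Hb|now apply Rinv_0_lt_compat]. }
    assert (Hu1 : Cmod u = 1).
    { unfold u. rewrite Cmod_div, Cmod_R, Rabs_pos_eq by (assumption || lra).
      field; lra. }
    assert (E1 : z = (RtoC (Cmod z) * u)%C) by (unfold u; field; exact HmC).
    assert (E2 : (/ z)%C = Cconj (RtoC (/ Cmod z) * u)).
    { rewrite Cmult_conj. replace (Cconj (RtoC (/ Cmod z))) with (RtoC (/ Cmod z))
        by (apply injective_projections; simpl; ring).
      assert (Hc : (u * Cconj u)%C = RtoC 1).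
      { rewrite <- Cmod2_conj, Hu1. now rewrite pow1. }
      assert (Hu0 : u <> RtoC 0) by (apply Im_neq_0; lra).
      rewrite E1 at 1. rewrite RtoC_inv by lra.
      replace (Cconj u) with (/ u)%C; [field; split; assumption|].
      replace (/ u)%C with (/ u * 1)%C by ring. rewrite <- Hc. field. exact Hu0. }
    rewrite E2, D_Cconj.
    - rewrite <- D_inversion_upper by assumption. now rewrite <- E1.
    - apply Im_neq_0. rewrite im_scal_l. apply Rgt_not_eq.
      apply Rmult_lt_0_compat; [now apply Rinv_0_lt_compat|exact Hu]. }
  intros Hz. destruct (Rtotal_order (Im z) 0) as [H|[H|H]].
  - assert (Hc : Cconj z <> RtoC 0) by (apply Im_neq_0; destruct z; simpl in *; lra).
    rewrite <- (Cconj_conj z) at 1. rewrite <- Cinv_conj by exact Hc.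
    rewrite D_Cconj, Hup, D_Cconj; [ring|exact Hz| |].
    + destruct z; simpl in *; lra.
    + apply Cmod_gt_0. rewrite Cmod_inv by exact Hc.
      apply Rinv_0_lt_compat, Cmod_gt_0, Hc.
  - rewrite (D_Im_0 z) by assumption. rewrite (real_of_Im_0 z H) in *.
    assert (Hr : Re z <> 0) by (intros E; apply Hz; now rewrite E).
    rewrite <- RtoC_inv by exact Hr. rewrite D_real; [ring|].
    apply Rinv_neq_0_compat, Hr.
  - apply Hup. lra.
Qed.

(** * Continuity at the real points *)

Lemma mean_value_01 (g dg : R -> R) :
  (forall s, 0 < s < 1 -> is_derive g s (dg s)) ->
  (forall s, 0 <= s <= 1 -> continuous g s) ->
  exists s, 0 < s < 1 /\ g 1 - g 0 = dg s.
Proof.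
  intros Hd Hc.
  assert (pr1 : forall c, 0 < c < 1 -> derivable_pt g c).
  { intros c Hcc. exists (dg c). apply is_derive_Reals, Hd, Hcc. }
  assert (pr2 : forall c, 0 < c < 1 -> derivable_pt id c).
  { intros c _. apply derivable_pt_id. }
  destruct (MVT g id 0 1 pr1 pr2 Rlt_0_1) as [c [P E]].
  - intros c Hcc. apply continuity_pt_filterlim, Hc, Hcc.
  - intros c _. apply derivable_continuous_pt, derivable_pt_id.
  - exists c. split; [exact P|].
    rewrite !Derive_Reals, (is_derive_unique _ _ _ (Hd c P)) in E.
    replace (Derive id c) with 1 in E by (symmetry; apply Derive_id).
    unfold id in E. lra.
Qed.

Lemma atan_le_id (x : R) : 0 <= x -> atan x <= x.
Proof.
  intros Hx.
  destruct (MVT_gen atan 0 x (fun t => / (1 + t ^ 2))) as [c [Hc E]].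
  - intros t _. apply is_derive_Reals, derivable_pt_lim_atan.
  - intros t _. apply derivable_continuous_pt, derivable_pt_atan.
  - rewrite atan_0 in E. pose proof (pow2_ge_0 c) as Hs.
    assert (/ (1 + c ^ 2) <= 1) by (rewrite <- Rinv_1; apply Rinv_le_contravar; lra).
    nra.
Qed.

Lemma Rabs_atan_le (x : R) : Rabs (atan x) <= Rabs x.
Proof.
  destruct (Rle_dec 0 x) as [H|H].
  - rewrite !Rabs_pos_eq; [now apply atan_le_id|exact H|].
    destruct H as [H| <-]; [|rewrite atan_0; lra].
    rewrite <- atan_0. left. now apply atan_increasing.
  - rewrite <- (Rabs_Ropp (atan x)), <- (Rabs_Ropp x), <- atan_opp.
    assert (H' : 0 < - x) by lra.
    rewrite !Rabs_pos_eq; [apply atan_le_id; lra|lra|].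
    rewrite <- atan_0. left. now apply atan_increasing.
Qed.

Lemma Rabs_arg_quot_le (z : C) (t : R) :
  0 <= t -> 0 < 1 - t * Re z ->
  Rabs (arg_quot z t) <= Rabs (Im z) / (1 - t * Re z).
Proof.
  intros Ht Hp. unfold arg_quot. destruct (Req_EM_T t 0) as [->|Hn].
  - rewrite Rabs_Ropp, Rmult_0_l, Rminus_0_r. right. field.
  - rewrite one_minus_scal, Carg_right by exact Hp. simpl.
    rewrite Rabs_div by exact Hn. rewrite (Rabs_pos_eq t) by lra.
    apply Rle_div_l; [lra|]. eapply Rle_trans; [apply Rabs_atan_le|].
    rewrite Rabs_div, Rabs_Ropp, Rabs_mult by lra.
    rewrite (Rabs_pos_eq t), (Rabs_pos_eq (1 - t * Re z)) by lra.
    right. field. lra.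
Qed.

(** The interval is cut at [1 - eps]. Before it, [1 - t * Re z >= eps / 2] bounds the integrand by
    [2 * Im z / eps]; after it, the argument is at most [PI], [t >= 1 / 2], and the piece has length
    [eps]. One fixes [eps] and then lets [Im z] tend to [0]. *)
Lemma RInt_arg_quot_bound (z : C) (eps : R) :
  0 < Im z -> 0 < eps <= 1 / 2 -> Re z <= 1 + eps / 2 ->
  Rabs (RInt (arg_quot z) 0 1) <= 2 * Im z / eps + 2 * PI * eps.
Proof.
  intros Hb He Ha. pose proof PI_RGT_0 as Hpi.
  assert (Hex : forall a b, ex_RInt (arg_quot z) a b)
    by (intros; apply ex_RInt_arg_quot; lra).
  rewrite <- (RInt_Chasles (V := R_CompleteNormedModule) (arg_quot z) 0 (1 - eps) 1)
    by apply Hex.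
  eapply Rle_trans; [apply Rabs_triang|]. apply Rplus_le_compat.
  - eapply Rle_trans.
    + apply abs_RInt_le_const with (M := 2 * Im z / eps); [lra|apply Hex|].
      intros t Ht.
      assert (Hlow : eps / 2 <= 1 - t * Re z).
      { destruct (Rle_dec (Re z) 0); [nra|].
        assert (t * Re z <= (1 - eps) * (1 + eps / 2))
          by (apply Rmult_le_compat; lra). nra. }
      eapply Rle_trans; [apply Rabs_arg_quot_le; lra|].
      rewrite Rabs_pos_eq by lra. apply Rle_div_l; [lra|].
      replace (Im z) with (2 * Im z / eps * (eps / 2)) at 1 by (field; lra).
      apply Rmult_le_compat_l; [|exact Hlow].
      apply Rlt_le, Rdiv_lt_0_compat; lra.
    + assert (0 < 2 * Im z / eps) by (apply Rdiv_lt_0_compat; lra). nra.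
  - eapply Rle_trans.
    + apply abs_RInt_le_const with (M := 2 * PI); [lra|apply Hex|].
      intros t Ht. unfold arg_quot. destruct (Req_EM_T t 0) as [|Hn]; [lra|].
      rewrite Rabs_div by exact Hn. rewrite (Rabs_pos_eq t) by lra.
      apply Rle_div_l; [lra|]. eapply Rle_trans; [apply Carg_bound|]. nra.
    + right. ring.
Qed.

Lemma Clim_Cconj {T : Type} (F : (T -> Prop) -> Prop) {FF : Filter F}
  (f : T -> C) (l : C) : Clim F f l -> Clim F (fun t => Cconj (f t)) (Cconj l).
Proof.
  intros Hf eps He. generalize (Hf eps He). apply filter_imp. intros t H.
  rewrite <- Cminus_conj, Cmod_conj. exact H.
Qed.

(** In the product of argument and logarithm one factor tends to [0] and the other stays bounded: at
    [a = 1] the logarithm is the small one, for [a < 1] the argument. The integral is estimated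
    above the axis only, and conjugation supplies the other side. *)
Lemma Rlim_D_le_1 (a : R) :
  a <> 0 -> a <= 1 -> Rlim (locally (RtoC a)) D 0.
Proof.
  intros Ha0 Ha1. pose proof PI_RGT_0 as Hpi.
  assert (Ha : RtoC a <> RtoC 0) by (intros E; apply Ha0, RtoC_inj, E).
  assert (Hterm : Rlim (locally (RtoC a)) (fun z => Carg (1 - z)%C * ln (Cmod z)) 0).
  { destruct (Req_dec a 1) as [->|Hn].
    - assert (H : Rlim (locally (RtoC 1))
        (fun z => ln (Cmod z) * Carg (1 - z)%C) 0).
      { apply Rlim_mult_bounded with (M := PI); [apply locally_filter| |].
        - pose proof (Rlim_ln_Cmod _ _ _ (Clim_id (RtoC 1)) Ha) as Hl.
          rewrite Cmod_1, ln_1 in Hl. exact Hl.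
        - apply filter_forall. intros z. apply Carg_bound. }
      intros e He. generalize (H e He). apply filter_imp. intros z.
      now rewrite Rmult_comm.
    - apply Rlim_mult_bounded with (M := Rabs (ln (Cmod (RtoC a))) + 1);
        [apply locally_filter| |].
      + rewrite <- (Carg_pos_real (1 - a)) by lra. rewrite RtoC_minus.
        apply (Rlim_Carg (locally (RtoC a))).
        * apply (Clim_minus (locally (RtoC a)));
            [apply (Clim_const (locally (RtoC a)))|apply Clim_id].
        * rewrite <- RtoC_minus. simpl. lra.
      + apply (Rlim_bounded (locally (RtoC a))), (Rlim_ln_Cmod (locally (RtoC a)));
          [apply Clim_id|exact Ha]. }
  assert (Hup : forall eps, 0 < eps ->
    locally (RtoC a) (fun z => 0 < Im z -> Rabs (D z) <= eps)).
  { intros eta Heta.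
    (* Here [eta] is a tolerance, not the 1-form. The two terms of [RInt_arg_quot_bound] receive
       [eta / 4] each and the product of argument and logarithm receives [eta / 2]. *)
    set (eps := Rmin (1 / 2) (eta / (8 * PI))).
    assert (He : 0 < eps) by (apply Rmin_pos; [lra|apply Rdiv_lt_0_compat; lra]).
    assert (He1 : eps <= 1 / 2) by apply Rmin_l.
    assert (He2 : 2 * PI * eps <= eta / 4).
    { replace (eta / 4) with (2 * PI * (eta / (8 * PI))) by (field; lra).
      apply Rmult_le_compat_l; [lra|apply Rmin_r]. }
    assert (H2 : 0 < eta / 2) by lra.
    assert (H3 : 0 < eps / 2) by lra.
    assert (H4 : 0 < eps * eta / 8) by nra.
    generalize (filter_and _ _ (Hterm _ H2)
      (filter_and _ _ (Rlim_Re _ _ _ (Clim_id (RtoC a)) _ H3)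
        (Rlim_Im _ _ _ (Clim_id (RtoC a)) _ H4))).
    apply filter_imp. intros z [T1 [T2 T3]] Hz.
    simpl in T2, T3. apply Rabs_le_between in T2. apply Rabs_le_between in T3.
    rewrite Rminus_0_r in T1.
    rewrite D_arg_quot by (apply Im_neq_0; lra).
    eapply Rle_trans; [apply Rabs_triang|]. rewrite Rabs_Ropp.
    pose proof (RInt_arg_quot_bound z eps Hz (conj He He1) ltac:(lra)) as HB.
    assert (2 * Im z / eps <= eta / 4).
    { apply Rle_div_l; [lra|]. lra. }
    lra. }
  intros eps He. specialize (Hup eps He).
  assert (Hc : Clim (locally (RtoC a)) (fun z => Cconj z) (RtoC a)).
  { replace (RtoC a) with (Cconj (RtoC a)) at 2
      by (apply injective_projections; simpl; ring).
    apply Clim_Cconj; [apply locally_filter|apply Clim_id]. }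
  generalize (filter_and _ _ (filter_and _ _ Hup (Clim_locally_comp _ _ _ _ Hc Hup))
    (Clim_neq_0 _ _ _ (Clim_id (RtoC a)) Ha)).
  apply filter_imp. intros z [[U L] Hz]. rewrite Rminus_0_r.
  destruct (Rtotal_order (Im z) 0) as [H|[H|H]].
  - rewrite D_Cconj, Rabs_Ropp in L by exact Hz. apply L. destruct z; simpl in *; lra.
  - rewrite D_Im_0 by assumption. rewrite Rabs_R0. lra.
  - apply U. lra.
Qed.

(** For [a > 1] the integral does not tend to [0], so the previous estimate does not apply;
    inversion moves the point to [1 / a]. *)
Lemma Rlim_D_real (a : R) : a <> 0 -> Rlim (locally (RtoC a)) D 0.
Proof.
  intros Ha. destruct (Rle_dec a 1) as [H|H]; [now apply Rlim_D_le_1|].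
  assert (HaC : RtoC a <> RtoC 0) by (intros E; apply Ha, RtoC_inj, E).
  assert (Hi : / a <> 0) by (now apply Rinv_neq_0_compat).
  assert (Hi1 : / a <= 1) by (rewrite <- Rinv_1; apply Rinv_le_contravar; lra).
  pose proof (Clim_inv _ _ _ (Clim_id (RtoC a)) HaC) as Hc.
  rewrite <- RtoC_inv in Hc by exact Ha.
  intros eps He.
  generalize (filter_and _ _
    (Clim_locally_comp _ _ _ _ Hc (Rlim_D_le_1 (/ a) Hi Hi1 eps He))
    (Clim_neq_0 _ _ _ (Clim_id (RtoC a)) HaC)).
  apply filter_imp. intros z [H1 Hz].
  rewrite D_inv in H1 by exact Hz. rewrite Rminus_0_r, Rabs_Ropp in *. exact H1.
Qed.

Lemma continuous_of_Rlim (f : R -> R) (x : R) :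
  Rlim (locally x) f (f x) -> continuous f x.
Proof.
  intros H Q [eps HQ].
  assert (He : 0 < eps / 2) by (pose proof (cond_pos eps); lra).
  change (locally x (fun t => Q (f t))).
  generalize (H _ He). apply filter_imp. intros t Ht. apply HQ.
  change (Rabs (f t - f x) < eps). pose proof (cond_pos eps). lra.
Qed.

Lemma Clim_line (z w : C) (s : R) :
  Clim (locally s) (fun t => z + RtoC t * w)%C (z + RtoC s * w)%C.
Proof.
  apply Clim_plus; [apply locally_filter|apply Clim_const, locally_filter|].
  apply Clim_mult; [apply locally_filter| |apply Clim_const, locally_filter].
  apply Clim_RtoC; [apply locally_filter|].
  intros eps He. exists (mkposreal eps He). intros t Ht. left. exact Ht.
Qed.

Lemma continuous_D_line (z w : C) (s : R) :
  (z + RtoC s * w)%C <> RtoC 0 -> continuous (fun t => D (z + RtoC t * w)%C) s.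
Proof.
  intros Hz. destruct (Req_dec (Im (z + RtoC s * w)%C) 0) as [H|H].
  - apply continuous_of_Rlim. rewrite (D_Im_0 _ Hz H).
    pose proof (real_of_Im_0 _ H) as E.
    assert (Hr : Re (z + RtoC s * w) <> 0)
      by (intros E0; apply Hz; rewrite E, E0; reflexivity).
    intros eps He.
    apply (Clim_locally_comp _ _ _ (fun z => Rabs (D z - 0) <= eps) (Clim_line z w s)).
    rewrite E. now apply Rlim_D_real.
  - apply (ex_derive_continuous (fun t => D (z + RtoC t * w)%C)).
    eexists. apply is_derive_D_line. exact H.
Qed.

(** The starting point may be real, even on the branch cut: only continuity is required there, while
    the rest of the segment lies in the open half plane. *)
Lemma D_mean_value (z z' : C) :
  z <> RtoC 0 -> 0 <= Im z -> 0 < Im z' ->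
  exists s, 0 < s < 1 /\
    D z' - D z = Im (dilog_coef (z + RtoC s * (z' - z)) * (z' - z))%C.
Proof.
  intros Hz Hi Hi'.
  assert (Hpos : forall s, 0 < s -> s <= 1 -> 0 < Im (z + RtoC s * (z' - z))%C).
  { intros s H0 H1. destruct z as [a b], z' as [a' b']. simpl in *. nra. }
  destruct (mean_value_01 (fun s => D (z + RtoC s * (z' - z))%C)
    (fun s => Im (dilog_coef (z + RtoC s * (z' - z)) * (z' - z))%C)) as [s [Hs E]].
  - intros s Hs. apply is_derive_D_line. apply Rgt_not_eq, Hpos; lra.
  - intros s Hs. apply continuous_D_line. destruct (Req_dec s 0) as [->|Hn].
    + replace (z + RtoC 0 * (z' - z))%C with z by ring. exact Hz.
    + apply Im_neq_0, Rgt_not_eq, Hpos; lra.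
  - exists s. split; [exact Hs|]. rewrite <- E. f_equal; [|f_equal]; f_equal; ring.
Qed.

(** * Differential of the dilogarithm *)

(** Real differentiability, with the differential encoded by one complex number: every real linear
    form on the plane is [w -> Im (c w)] for a unique [c]. Composition with a holomorphic map then
    multiplies [c] by a complex derivative. *)
Definition Im_differential (f : C -> R) (z c : C) : Prop :=
  negl (locally z) (fun z' => Cmod (z' - z)%C)
    (fun z' => f z' - f z - Im (c * (z' - z))%C).

Lemma Clim_dilog_coef (z : C) :
  z <> RtoC 0 -> z <> RtoC 1 -> Clim (locally z) dilog_coef (dilog_coef z).
Proof.
  intros H0 H1.
  assert (Hi : Clim (locally z) (fun t => 1 - t)%C (1 - z)%C)
    by (apply (Clim_minus (locally z)); [apply (Clim_const (locally z))|apply Clim_id]).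
  assert (Hn : (1 - z)%C <> RtoC 0) by (apply Cminus_eq_contra; congruence).
  unfold dilog_coef.
  apply (Clim_minus (locally z) (fun t => - (RtoC (ln (Cmod t)) / (1 - t)))%C
           (fun t => RtoC (ln (Cmod (1 - t))) / t)%C).
  - apply (Clim_opp (locally z)), (Clim_div (locally z)); [|exact Hi|exact Hn].
    apply (Clim_RtoC (locally z)), (Rlim_ln_Cmod (locally z)); [apply Clim_id|exact H0].
  - apply (Clim_div (locally z)); [|apply Clim_id|exact H0].
    apply (Clim_RtoC (locally z)), (Rlim_ln_Cmod (locally z)); [exact Hi|exact Hn].
Qed.

Lemma dilog_coef_Cconj (z : C) :
  z <> RtoC 0 -> z <> RtoC 1 -> dilog_coef (Cconj z) = Cconj (dilog_coef z).
Proof.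
  intros H0 H1.
  assert (Hn : (1 - z)%C <> RtoC 0) by (apply Cminus_eq_contra; congruence).
  assert (HR : forall r, Cconj (RtoC r) = RtoC r)
    by (intros r; apply injective_projections; simpl; ring).
  unfold dilog_coef.
  rewrite Cminus_conj, Copp_conj, !Cdiv_conj, Cminus_conj, !HR by assumption.
  replace (Cmod (1 - Cconj z)%C) with (Cmod (1 - z)%C)
    by (rewrite <- (HR 1) at 2; rewrite <- Cminus_conj, Cmod_conj; reflexivity).
  rewrite Cmod_conj. reflexivity.
Qed.

Lemma Cmod_segment (z z' : C) (s : R) :
  0 <= s <= 1 -> Cmod (z + RtoC s * (z' - z) - z)%C <= Cmod (z' - z)%C.
Proof.
  intros Hs. replace (z + RtoC s * (z' - z) - z)%C with (RtoC s * (z' - z))%C by ring.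
  rewrite Cmod_mult, Cmod_R, Rabs_pos_eq by lra. pose proof (Cmod_ge_0 (z' - z)). nra.
Qed.

(** The mean value theorem and the continuity of [dilog_coef] turn derivatives along lines into a
    total differential. At a real [z] this is a one-sided statement. *)
Lemma D_increment_upper (z : C) :
  z <> RtoC 0 -> z <> RtoC 1 -> 0 <= Im z -> forall eps, 0 < eps ->
  locally z (fun z' => 0 < Im z' ->
    Rabs (D z' - D z - Im (dilog_coef z * (z' - z))%C) <= eps * Cmod (z' - z)%C).
Proof.
  intros H0 H1 Hi eps He.
  pose proof (Clim_dilog_coef z H0 H1 eps He) as Hc.
  apply locally_Cmod in Hc. destruct Hc as [del [Hd Hc]].
  apply locally_Cmod. exists del. split; [exact Hd|]. intros z' Hz' Hi'.
  destruct (D_mean_value z z' H0 Hi Hi') as [s [Hs ->]].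
  match goal with |- Rabs (Im ?A - Im ?B) <= _ =>
    replace (Im A - Im B) with (Im (A - B)%C) by (unfold Im; simpl; ring) end.
  eapply Rle_trans; [apply im_le_Cmod|].
  match goal with |- Cmod (?A * ?w - ?B * ?w) <= _ =>
    replace (A * w - B * w)%C with ((A - B) * w)%C by ring end.
  rewrite Cmod_mult. apply Rmult_le_compat_r; [apply Cmod_ge_0|].
  apply Hc. eapply Rle_lt_trans; [apply Cmod_segment; lra|exact Hz'].
Qed.

Lemma D_increment_lower (z : C) :
  z <> RtoC 0 -> z <> RtoC 1 -> Im z <= 0 -> forall eps, 0 < eps ->
  locally z (fun z' => Im z' < 0 ->
    Rabs (D z' - D z - Im (dilog_coef z * (z' - z))%C) <= eps * Cmod (z' - z)%C).
Proof.
  intros H0 H1 Hi eps He.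
  assert (H0' : Cconj z <> RtoC 0)
    by (apply Cmod_gt_0; rewrite Cmod_conj; now apply Cmod_gt_0).
  assert (H1' : Cconj z <> RtoC 1).
  { intros E. apply H1. rewrite <- (Cconj_conj z), E.
    apply injective_projections; simpl; ring. }
  assert (Hi' : 0 <= Im (Cconj z)) by (destruct z; simpl in *; lra).
  assert (Hc : Clim (locally z) (fun z => Cconj z) (Cconj z))
    by (apply (Clim_Cconj (locally z)), Clim_id).
  generalize (filter_and _ _
    (Clim_locally_comp _ _ _ _ Hc (D_increment_upper _ H0' H1' Hi' eps He))
    (Clim_neq_0 _ _ _ (Clim_id z) H0)).
  apply filter_imp. intros z' [H Hz'] Hneg.
  rewrite !D_Cconj, dilog_coef_Cconj in H by assumption.
  rewrite <- Cminus_conj, <- Cmult_conj, Cmod_conj in H.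
  replace (- D z' - - D z - Im (Cconj (dilog_coef z * (z' - z))))
    with (- (D z' - D z - Im (dilog_coef z * (z' - z))%C)) in H
    by (unfold Im; simpl; ring).
  rewrite Rabs_Ropp in H. apply H. destruct z'; simpl in *; lra.
Qed.

(** At a real point the increments upwards and downwards have the same coefficient [dilog_coef z],
    and along the axis both [D] and the linear term vanish. *)
Lemma D_differential (z : C) :
  z <> RtoC 0 -> z <> RtoC 1 -> Im_differential D z (dilog_coef z).
Proof.
  intros H0 H1 eps He.
  pose proof (Rlim_Im _ _ _ (Clim_id z)) as Hlim.
  destruct (Rtotal_order (Im z) 0) as [H|[H|H]].
  - assert (Hp : 0 < - Im z / 2) by lra.
    assert (Hle : Im z <= 0) by lra.
    generalize (filter_and _ _ (D_increment_lower z H0 H1 Hle eps He) (Hlim _ Hp)).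
    apply filter_imp. intros z' [A B]. apply A. apply Rabs_le_between in B. lra.
  - assert (Hle : Im z <= 0) by lra. assert (Hge : 0 <= Im z) by lra.
    generalize (filter_and _ _ (Clim_neq_0 _ _ _ (Clim_id z) H0)
      (filter_and _ _ (D_increment_lower z H0 H1 Hle eps He)
        (D_increment_upper z H0 H1 Hge eps He))).
    apply filter_imp. intros z' [A [B C]].
    destruct (Rtotal_order (Im z') 0) as [H'|[H'|H']].
    + exact (B H').
    + rewrite !D_Im_0 by assumption.
      (* The coefficient at a real point is fixed by conjugation, hence real, so the linear term is
         [0] on real increments. *)
      assert (Hcoef : Im (dilog_coef z) = 0).
      { assert (Ez : Cconj z = z).
        { apply injective_projections; simpl; [reflexivity|].
          unfold Im in H. rewrite H. ring. }
        pose proof (dilog_coef_Cconj z H0 H1) as E. rewrite Ez in E.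
        revert E. generalize (dilog_coef z). intros c E.
        apply (f_equal snd) in E. unfold Im. simpl in E. lra. }
      revert Hcoef. generalize (dilog_coef z). intros c Hcoef.
      replace (Im (c * (z' - z))%C) with 0.
      * replace (0 - 0 - 0) with 0 by ring. rewrite Rabs_R0.
        pose proof (Cmod_ge_0 (z' - z)%C). nra.
      * unfold Im in *. simpl. rewrite Hcoef, H, H'. ring.
    + exact (C H').
  - assert (Hp : 0 < Im z / 2) by lra.
    assert (Hle : 0 <= Im z) by lra.
    generalize (filter_and _ _ (D_increment_upper z H0 H1 Hle eps He) (Hlim _ Hp)).
    apply filter_imp. intros z' [A B]. apply A. apply Rabs_le_between in B. lra.
Qed.

(** * The logarithmic singularity of the dilogarithm at 1 *)

(** The inequality [ln y <= y] at [y = 1 / sqrt x] gives [- ln x <= 2 / sqrt x]. For [x <= 0] the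
    default value [ln x = 0] makes the left side vanish, so the bound also gives two-sided
    continuity at [0]. *)
Lemma Rabs_xlnx_le (x : R) : x <= 1 -> Rabs (x * ln x) <= 2 * sqrt x.
Proof.
  intros Hx. destruct (Rlt_dec 0 x) as [H|H].
  - pose proof (sqrt_lt_R0 x H) as Hs.
    assert (Hln : ln x <= 0).
    { rewrite <- ln_1. destruct Hx as [Hx| ->]; [|lra]. left. now apply ln_increasing. }
    rewrite Rabs_left1 by nra.
    assert (Hl : - ln x <= 2 * / sqrt x).
    { rewrite <- (sqrt_sqrt x) at 1 by lra. rewrite ln_mult by assumption.
      assert (Hk : ln (/ sqrt x) <= / sqrt x).
      { pose proof (exp_ineq1_le (ln (/ sqrt x))) as Hk.
        rewrite exp_ln in Hk by (now apply Rinv_0_lt_compat). lra. }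
      rewrite ln_Rinv in Hk by exact Hs. lra. }
    replace (- (x * ln x)) with (x * - ln x) by ring.
    replace (2 * sqrt x) with (x * (2 * / sqrt x)).
    + apply Rmult_le_compat_l; lra.
    + rewrite <- (sqrt_sqrt x) at 1 by lra. field. lra.
  - replace (ln x) with 0.
    + rewrite Rmult_0_r, Rabs_R0. pose proof (sqrt_pos x). lra.
    + unfold ln. destruct (Rlt_dec 0 x); [contradiction|reflexivity].
Qed.

Lemma continuous_xlnx (x : R) : 0 <= x -> continuous (fun x => x * ln x) x.
Proof.
  intros [Hx| <-].
  - apply (ex_derive_continuous (fun x => x * ln x)). auto_derive. exact Hx.
  - apply continuous_of_Rlim. intros eps He.
    assert (Hd : 0 < Rmin 1 ((eps / 2) * (eps / 2))) by (apply Rmin_pos; nra).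
    exists (mkposreal _ Hd). intros t Ht.
    change (Rabs (t - 0) < Rmin 1 ((eps / 2) * (eps / 2))) in Ht.
    rewrite Rminus_0_r in Ht. rewrite Rmult_0_l, Rminus_0_r.
    pose proof (Rle_abs t).
    pose proof (Rmin_l 1 ((eps / 2) * (eps / 2))).
    pose proof (Rmin_r 1 ((eps / 2) * (eps / 2))).
    eapply Rle_trans; [apply Rabs_xlnx_le; lra|].
    assert (sqrt t <= sqrt ((eps / 2) * (eps / 2))) by (apply sqrt_le_1_alt; lra).
    rewrite sqrt_square in * by lra. lra.
Qed.

(* The first summand of [dilog_coef] is a real multiple of [/ e] at [1 + s e],
   so it does not contribute to the radial derivative at [1]. *)
Lemma D_near_1_upper (e : C) :
  0 < Im e -> Cmod e <= 1 / 2 ->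
  Rabs (D (1 + e) - Im e + Im e * ln (Cmod e)) <= 4 * sqrt (Cmod e) * Cmod e.
Proof.
  intros Hi Hm. set (m := Cmod e) in *.
  assert (He : e <> RtoC 0) by (apply Im_neq_0; lra).
  assert (Hm0 : 0 < m) by (now apply Cmod_gt_0).
  (* The added term is a primitive in [s] of [Im e * ln (s * m)], continuous at [s = 0]. It removes
     the singular part of the derivative, and [g 1 - g 0] is exactly the quantity to bound. *)
  set (g := fun s => D (1 + RtoC s * e)%C + (Im e / m * ((s * m) * ln (s * m)) - s * Im e)).
  destruct (mean_value_01 g
    (fun s => Im (dilog_coef (1 + RtoC s * e) * e)%C + Im e * ln (s * m))) as [s [Hs E]].
  - intros s Hs. apply (is_derive_plus (fun s => D (1 + RtoC s * e)%C)
      (fun s => Im e / m * ((s * m) * ln (s * m)) - s * Im e)).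
    + apply is_derive_D_line. destruct e as [a b]. simpl in *. nra.
    + auto_derive; [nra|]. field. nra.
  - intros s Hs. apply (continuous_plus (fun s => D (1 + RtoC s * e)%C)
      (fun s => Im e / m * ((s * m) * ln (s * m)) - s * Im e)).
    + apply continuous_D_line. destruct (Req_dec s 0) as [->|Hn].
      * replace (1 + RtoC 0 * e)%C with (RtoC 1) by ring. apply C1_nz.
      * apply Im_neq_0. destruct e as [a b]. simpl in *. nra.
    + apply (continuous_minus (fun s => Im e / m * ((s * m) * ln (s * m)))
        (fun s => s * Im e)).
      * apply (continuous_scal_r (Im e / m) (fun s => (s * m) * ln (s * m))).
        apply (continuous_comp (fun s => s * m) (fun x => x * ln x)).
        -- apply (ex_derive_continuous (fun s => s * m)). auto_derive. exact I.
        -- apply continuous_xlnx. nra.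
      * apply (ex_derive_continuous (fun s => s * Im e)). auto_derive. exact I.
  - unfold g in E.
    replace (1 + RtoC 0 * e)%C with (RtoC 1) in E by ring.
    replace (1 + RtoC 1 * e)%C with (1 + e)%C in E by ring.
    rewrite (D_real 1) in E by lra. rewrite !Rmult_1_l, !Rmult_0_l in E.
    replace (D (1 + e) - Im e + Im e * ln m)
      with (Im (dilog_coef (1 + RtoC s * e) * e)%C + Im e * ln (s * m)).
    2:{ rewrite <- E. field. lra. }
    set (h := (RtoC s * e)%C).
    assert (Hh : Cmod h = s * m)
      by (unfold h; rewrite Cmod_mult, Cmod_R, Rabs_pos_eq by lra; reflexivity).
    assert (Hsm : 0 < s * m <= m) by (split; nra).
    assert (Hlow : 1 / 2 <= Cmod (1 + h)%C).
    { pose proof (Cmod_triangle_rev 1 (- h)%C) as Ht.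
      replace (1 - - h)%C with (1 + h)%C in Ht by ring.
      rewrite Cmod_opp, Cmod_1 in Ht. apply Rabs_le_between in Ht. lra. }
    assert (Hn : (1 + h)%C <> RtoC 0) by (apply Cmod_gt_0; lra).
    assert (HsC : RtoC s <> RtoC 0) by (intros E0; apply RtoC_inj in E0; lra).
    (* After the real summand is dropped, the logarithms combine to [ln |h| e (1 - 1 / (1 + h)) = ln
       |h| h e / (1 + h)]. The bounds [|x ln x| <= 2 sqrt x] and [|1 + h| >= 1 / 2] produce the
       constant 4. *)
    replace (Im (dilog_coef (1 + h) * e)%C + Im e * ln (s * m))
      with (Im (RtoC (ln (s * m)) * h / (1 + h) * e)%C).
    + eapply Rle_trans; [apply im_le_Cmod|]. rewrite Cmod_mult.
      apply Rmult_le_compat_r; [lra|].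
      rewrite Cmod_div, Cmod_mult, Hh, Cmod_R by exact Hn.
      apply Rle_div_l; [lra|].
      replace (Rabs (ln (s * m)) * (s * m)) with (Rabs (s * m * ln (s * m))).
      2:{ rewrite Rabs_mult, (Rabs_pos_eq (s * m)) by lra. ring. }
      assert (H1 : Rabs (s * m * ln (s * m)) <= 2 * sqrt (s * m))
        by (apply Rabs_xlnx_le; lra).
      assert (H2 : sqrt (s * m) <= sqrt m) by (apply sqrt_le_1_alt; lra).
      pose proof (sqrt_pos m). nra.
    + replace (Im (RtoC (ln (s * m)) * h / (1 + h) * e)%C) with
        (Im (RtoC (ln (Cmod (1 + h)) / s)%R
             - RtoC (ln (s * m)) / (1 + h) * e + RtoC (ln (s * m)) * e)%C).
      * unfold dilog_coef. replace (1 - (1 + h))%C with (- h)%C by ring.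
        rewrite Cmod_opp, Hh.
        replace ((- (RtoC (ln (Cmod (1 + h))) / - h) - RtoC (ln (s * m)) / (1 + h)) * e)%C
          with (RtoC (ln (Cmod (1 + h)) / s)%R - RtoC (ln (s * m)) / (1 + h) * e)%C.
        -- generalize (RtoC (ln (Cmod (1 + h)) / s)%R - RtoC (ln (s * m)) / (1 + h) * e)%C.
           intros c. replace (Im e * ln (s * m)) with (Im (RtoC (ln (s * m)) * e)%C)
             by (rewrite im_scal_l; ring). unfold Im; simpl; ring.
        -- rewrite RtoC_div by lra. unfold h in *. field. repeat split; assumption.
      * match goal with |- Im (RtoC ?r - ?A + ?B)%C = _ =>
          replace (Im (RtoC r - A + B)%C) with (Im (B - A)%C)
            by (unfold Im; simpl; ring) end.
        f_equal. field. exact Hn.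
Qed.

Lemma D_near_1 :
  negl (locally (RtoC 1)) (fun z => Cmod (z - 1)%C)
    (fun z => D z - Im (z - 1)%C + Im (z - 1)%C * ln (Cmod (z - 1)%C)).
Proof.
  intros eps He. apply locally_Cmod.
  (* The second radius makes [4 * sqrt (Cmod e) <= eps]; the first is the range of
     [D_near_1_upper]. *)
  exists (Rmin (1 / 2) ((eps / 4) * (eps / 4))).
  split; [apply Rmin_pos; nra|]. intros z Hz.
  pose proof (Rmin_l (1 / 2) ((eps / 4) * (eps / 4))).
  pose proof (Rmin_r (1 / 2) ((eps / 4) * (eps / 4))).
  assert (Hsq : 4 * sqrt (Cmod (z - 1)%C) <= eps).
  { assert (Hs : sqrt (Cmod (z - 1)%C) <= sqrt ((eps / 4) * (eps / 4)))
      by (apply sqrt_le_1_alt; lra).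
    rewrite sqrt_square in Hs by lra. lra. }
  pose proof (Cmod_ge_0 (z - 1)%C) as Hm.
  set (e := (z - 1)%C) in *. assert (Ez : z = (1 + e)%C) by (unfold e; ring).
  assert (Hz0 : z <> RtoC 0).
  { intros E. assert (He1 : e = (- (1))%C) by (unfold e; rewrite E; ring).
    rewrite He1, Cmod_m1 in *. lra. }
  apply Rle_trans with (4 * sqrt (Cmod e) * Cmod e); [|nra].
  destruct (Rtotal_order (Im e) 0) as [Hi|[Hi|Hi]].
  - pose proof (D_near_1_upper (Cconj e)) as HU. rewrite Cmod_conj in HU.
    replace (1 + Cconj e)%C with (Cconj z) in HU
      by (rewrite Ez; apply injective_projections; simpl; ring).
    rewrite D_Cconj in HU by exact Hz0.
    replace (- D z - Im (Cconj e) + Im (Cconj e) * ln (Cmod e))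
      with (- (D z - Im e + Im e * ln (Cmod e))) in HU
      by (unfold Im; simpl; ring).
    rewrite Rabs_Ropp in HU. apply HU; [change (0 < - Im e); lra|lra].
  - assert (Hiz : Im z = Im e) by (unfold e, Im; simpl; ring).
    rewrite Hi in *. rewrite D_Im_0 by assumption.
    replace (0 - 0 + _) with 0 by ring. rewrite Rabs_R0.
    pose proof (sqrt_pos (Cmod e)). nra.
  - rewrite Ez at 1. apply D_near_1_upper; [exact Hi|lra].
Qed.

(** * Complex differentials *)

(** Unlike the value [C_derive], which is defined for every function, this form asserts that the
    derivative exists. [C_differential_C_derive] links it to the [C_derive] of [dP]. *)
Definition C_differential (g : C -> C) (z l : C) : Prop :=
  forall eps, 0 < eps -> locally z (fun z' =>
    Cmod (g z' - g z - l * (z' - z))%C <= eps * Cmod (z' - z)%C).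

Lemma C_differential_C_derive (g : C -> C) (z l : C) :
  C_differential g z l -> C_derive g z = l.
Proof.
  intros H. apply is_C_lim_unique. intros Q HQ.
  apply locally_Cmod in HQ. destruct HQ as [e [He HQ]].
  assert (He2 : 0 < e / 2) by lra.
  specialize (H _ He2).
  change (locally z (fun z' => z' <> z -> Q ((g z' - g z) / (z' - z))%C)).
  revert H. apply filter_imp. intros z' H Hn. apply HQ.
  assert (Hw : (z' - z)%C <> RtoC 0) by (now apply Cminus_eq_contra).
  pose proof (proj1 (Cmod_gt_0 _) Hw) as Hm.
  replace ((g z' - g z) / (z' - z) - l)%C
    with ((g z' - g z - l * (z' - z)) / (z' - z))%C by (field; exact Hw).
  rewrite Cmod_div by exact Hw. apply Rlt_div_l; [exact Hm|]. nra.
Qed.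

Lemma C_differential_bound (g : C -> C) (z l : C) :
  C_differential g z l ->
  locally z (fun z' => Cmod (g z' - g z)%C <= (Cmod l + 1) * Cmod (z' - z)%C).
Proof.
  intros H. generalize (H 1 Rlt_0_1). apply filter_imp. intros z' Hz.
  replace (g z' - g z)%C with ((g z' - g z - l * (z' - z)) + l * (z' - z))%C by ring.
  eapply Rle_trans; [apply Cmod_triangle|]. rewrite Cmod_mult. lra.
Qed.

Lemma C_differential_Clim (g : C -> C) (z l : C) :
  C_differential g z l -> Clim (locally z) g (g z).
Proof.
  intros H eps He. pose proof (Cmod_ge_0 l) as Hl.
  assert (He1 : 0 < eps / (Cmod l + 1)) by (apply Rdiv_lt_0_compat; lra).
  generalize (filter_and _ _ (C_differential_bound g z l H) (Clim_id z _ He1)).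
  apply filter_imp. intros z' [H1 H2]. eapply Rle_trans; [exact H1|].
  replace eps with ((Cmod l + 1) * (eps / (Cmod l + 1))) by (field; lra).
  apply Rmult_le_compat_l; lra.
Qed.

Lemma C_differential_const (c z : C) : C_differential (fun _ => c) z 0.
Proof.
  intros eps He. apply filter_forall. intros z'.
  replace (c - c - 0 * (z' - z))%C with (RtoC 0) by ring. rewrite Cmod_0.
  pose proof (Cmod_ge_0 (z' - z)%C). nra.
Qed.

Lemma C_differential_id (z : C) : C_differential (fun z => z) z 1.
Proof.
  intros eps He. apply filter_forall. intros z'.
  replace (z' - z - 1 * (z' - z))%C with (RtoC 0) by ring. rewrite Cmod_0.
  pose proof (Cmod_ge_0 (z' - z)%C). nra.
Qed.

Lemma C_differential_plus (f g : C -> C) (z a b : C) :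
  C_differential f z a -> C_differential g z b ->
  C_differential (fun z => f z + g z)%C z (a + b)%C.
Proof.
  intros Hf Hg eps He. assert (He2 : 0 < eps / 2) by lra.
  generalize (filter_and _ _ (Hf _ He2) (Hg _ He2)). apply filter_imp.
  intros z' [H1 H2].
  replace (f z' + g z' - (f z + g z) - (a + b) * (z' - z))%C
    with ((f z' - f z - a * (z' - z)) + (g z' - g z - b * (z' - z)))%C by ring.
  eapply Rle_trans; [apply Cmod_triangle|lra].
Qed.

Lemma C_differential_mult (f g : C -> C) (z a b : C) :
  C_differential f z a -> C_differential g z b ->
  C_differential (fun z => f z * g z)%C z (a * g z + f z * b)%C.
Proof.
  intros Hf Hg eps He.
  pose proof (Cmod_ge_0 (g z)) as Pg. pose proof (Cmod_ge_0 (f z)) as Pf.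
  pose proof (Cmod_ge_0 a) as Pa.
  set (e1 := eps / 3 / (Cmod (g z) + 1)).
  set (e2 := eps / 3 / (Cmod (f z) + 1)).
  set (e3 := eps / 3 / (Cmod a + 1)).
  assert (He1 : 0 < e1) by (apply Rdiv_lt_0_compat; lra).
  assert (He2 : 0 < e2) by (apply Rdiv_lt_0_compat; lra).
  assert (He3 : 0 < e3) by (apply Rdiv_lt_0_compat; lra).
  pose proof (C_differential_Clim _ _ _ Hg) as Cg.
  generalize (filter_and _ _ (filter_and _ _ (Hf _ He1) (Hg _ He2))
    (filter_and _ _ (Cg _ He3) (Clim_bounded _ _ _ Cg))).
  apply filter_imp. intros z' [[H1 H2] [H3 H4]].
  set (m := Cmod (z' - z)%C) in *. assert (Pm : 0 <= m) by apply Cmod_ge_0.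
  replace (f z' * g z' - f z * g z - (a * g z + f z * b) * (z' - z))%C
    with ((f z' - f z - a * (z' - z)) * g z' +
          (f z * (g z' - g z - b * (z' - z)) + a * (z' - z) * (g z' - g z)))%C by ring.
  eapply Rle_trans; [apply Cmod_triangle|].
  eapply Rle_trans; [apply Rplus_le_compat_l, Cmod_triangle|].
  rewrite !Cmod_mult. fold m.
  assert (E1 : e1 * m * (Cmod (g z) + 1) = eps / 3 * m) by (unfold e1; field; lra).
  assert (E2 : (Cmod (f z) + 1) * (e2 * m) = eps / 3 * m) by (unfold e2; field; lra).
  assert (E3 : (Cmod a + 1) * m * e3 = eps / 3 * m) by (unfold e3; field; lra).
  assert (B1 : Cmod (f z' - f z - a * (z' - z))%C * Cmod (g z')
               <= e1 * m * (Cmod (g z) + 1))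
    by (apply Rmult_le_compat; (apply Cmod_ge_0 || lra)).
  assert (B2 : Cmod (f z) * Cmod (g z' - g z - b * (z' - z))%C
               <= (Cmod (f z) + 1) * (e2 * m))
    by (apply Rmult_le_compat; (apply Cmod_ge_0 || lra)).
  assert (B3 : Cmod a * m * Cmod (g z' - g z)%C <= (Cmod a + 1) * m * e3)
    by (apply Rmult_le_compat; (apply Cmod_ge_0 || nra)).
  lra.
Qed.

Lemma C_differential_ext (f g : C -> C) (z l : C) :
  (forall z, f z = g z) -> C_differential f z l -> C_differential g z l.
Proof.
  intros E H eps He. generalize (H eps He). apply filter_imp.
  intros z'. now rewrite !E.
Qed.

Lemma C_differential_unique (f : C -> C) (z a b : C) :
  C_differential f z a -> C_differential f z b -> a = b.
Proof.
  intros Ha Hb. rewrite <- (C_differential_C_derive f z a Ha).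
  now apply C_differential_C_derive.
Qed.

Lemma C_differential_pow (n : nat) (z : C) :
  C_differential (fun z => z ^ n)%C z (RtoC (INR n) * z ^ pred n)%C.
Proof.
  induction n as [|n IH].
  - replace (RtoC (INR 0) * z ^ pred 0)%C with (RtoC 0) by (simpl; ring).
    apply (C_differential_const 1).
  - replace (RtoC (INR (S n)) * z ^ pred (S n))%C
      with (1 * z ^ n + z * (RtoC (INR n) * z ^ pred n))%C.
    + exact (C_differential_mult (fun z => z) (fun z => z ^ n)%C z _ _
               (C_differential_id z) IH).
    + rewrite S_INR, RtoC_plus. destruct n as [|n]; simpl pred; [simpl; ring|].
      change (z ^ S n)%C with (z * z ^ n)%C. ring.
Qed.

(** A remainder [o(|z' - z|)] would not be enough: in [D_pow_near_root] it is multiplied by a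
    logarithm tending to infinity, which a quadratic remainder absorbs. *)
Lemma pow_second_order (n : nat) (z : C) :
  exists M, 0 <= M /\ locally z (fun z' =>
    Cmod (z' ^ n - z ^ n - RtoC (INR n) * z ^ pred n * (z' - z))%C
    <= M * (Cmod (z' - z)%C * Cmod (z' - z)%C)).
Proof.
  induction n as [|n [M [HM IH]]].
  - exists 0. split; [lra|]. apply filter_forall. intros z'.
    replace (z' ^ 0 - z ^ 0 - RtoC (INR 0) * z ^ pred 0 * (z' - z))%C
      with (RtoC 0) by (simpl; ring).
    rewrite Cmod_0. lra.
  - set (c := (RtoC (INR n) * z ^ pred n)%C) in *.
    exists (Cmod c + (Cmod z + 1) * M). pose proof (Cmod_ge_0 c). pose proof (Cmod_ge_0 z).
    split; [nra|].
    generalize (filter_and _ _ IH (Clim_bounded _ _ _ (Clim_id z))).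
    apply filter_imp. intros z' [H1 H2].
    set (w := (z' - z)%C) in *.
    replace (z' ^ S n - z ^ S n - RtoC (INR (S n)) * z ^ pred (S n) * w)%C
      with (c * (w * w) + z' * (z' ^ n - z ^ n - c * w))%C.
    + eapply Rle_trans; [apply Cmod_triangle|]. rewrite !Cmod_mult.
      assert (Cmod z' * Cmod (z' ^ n - z ^ n - c * w)%C
              <= (Cmod z + 1) * (M * (Cmod w * Cmod w)))
        by (apply Rmult_le_compat; (apply Cmod_ge_0 || assumption)).
      lra.
    + assert (Hc : (z * c)%C = (RtoC (INR n) * z ^ n)%C).
      { unfold c. destruct n as [|n]; [simpl; ring|].
        simpl pred. change (z ^ S n)%C with (z * z ^ n)%C. ring. }
      rewrite S_INR, RtoC_plus. simpl pred.
      change (z' ^ S n)%C with (z' * z' ^ n)%C. change (z ^ S n)%C with (z * z ^ n)%C.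
      replace ((RtoC (INR n) + 1) * z ^ n * w)%C with (z * c * w + z ^ n * w)%C
        by (rewrite Hc; ring).
      replace z' with (z + w)%C by (unfold w; ring). ring.
Qed.

(* The polynomial [q] of the introduction; [G] is [dilog_pow d] below. *)
Fixpoint geom (d : nat) (z : C) : C :=
  match d with O => RtoC 1 | S n => (geom n z + z ^ S n)%C end.

Lemma geom_mult (d : nat) (z : C) : ((z - 1) * geom d z)%C = (z ^ S d - 1)%C.
Proof.
  induction d as [|d IH]; [simpl; ring|].
  change (geom (S d) z) with (geom d z + z ^ S d)%C.
  transitivity ((z - 1) * geom d z + (z - 1) * z ^ S d)%C; [ring|].
  rewrite IH. change (z ^ S (S d))%C with (z * z ^ S d)%C. ring.
Qed.

(** The derivative stays an anonymous [l]; later arguments use only the linear relations obtained by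
    differentiating polynomial identities. *)
Lemma ex_C_differential_geom (d : nat) (z : C) :
  exists l, C_differential (geom d) z l.
Proof.
  induction d as [|d [l IH]].
  - exists 0. apply (C_differential_const 1).
  - eexists. exact (C_differential_plus _ _ _ _ _ IH (C_differential_pow (S d) z)).
Qed.

(** [(z - 1) q(z) = z^(d+1) - 1] is differentiated in two ways and the results are compared. *)
Lemma C_differential_geom_eq (d : nat) (z l : C) :
  C_differential (geom d) z l ->
  (geom d z + (z - 1) * l = RtoC (INR (S d)) * z ^ d)%C.
Proof.
  intros Hl.
  assert (H1 : C_differential (fun z => (z + - (1)) * geom d z)%C z
                 ((1 + 0) * geom d z + (z + - (1)) * l)%C).
  { apply (C_differential_mult (fun z => z + - (1))%C); [|exact Hl].
    apply C_differential_plus; [apply C_differential_id|apply C_differential_const]. }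
  assert (H2 : C_differential (fun z => (z + - (1)) * geom d z)%C z
                 (RtoC (INR (S d)) * z ^ d + 0)%C).
  { apply C_differential_ext with (fun z => z ^ S d + - (1))%C.
    - intros t. symmetry. exact (geom_mult d t).
    - apply C_differential_plus;
        [exact (C_differential_pow (S d) z)|apply C_differential_const]. }
  pose proof (C_differential_unique _ _ _ _ H1 H2) as E.
  replace (RtoC (INR (S d)) * z ^ d)%C with (RtoC (INR (S d)) * z ^ d + 0)%C by ring.
  rewrite <- E. ring.
Qed.

(** * The function [G] *)

Lemma negl_dom {T : Type} (F : (T -> Prop) -> Prop) {FF : Filter F} (m f g : T -> R) :
  F (fun t => Rabs (f t) <= Rabs (g t)) -> negl F m g -> negl F m f.
Proof.
  intros H Hg eps He. generalize (filter_and _ _ H (Hg eps He)). apply filter_imp.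
  intros t [H1 H2]. lra.
Qed.

(** An estimate [o(|z' - z|)] in the plane is pulled back along [phi], whose distance to [z] is
    [O(m)]. This is how expansions in one variable reach the curve. *)
Lemma negl_comp {T : Type} (F : (T -> Prop) -> Prop) {FF : Filter F}
  (m : T -> R) (phi : T -> C) (z : C) (k : C -> R) (M : R) :
  Clim F phi z -> F (fun t => Cmod (phi t - z)%C <= M * m t) -> F (fun t => 0 <= m t) ->
  negl (locally z) (fun z' => Cmod (z' - z)%C) k -> negl F m (fun t => k (phi t)).
Proof.
  intros Hphi HM Hm Hk.
  apply (negl_weaken F (fun t => Cmod (phi t - z)%C) m _ M HM Hm).
  intros eps He. exact (Clim_locally_comp F _ _ _ Hphi (Hk eps He)).
Qed.

Lemma Rlim_Cmod_ln {T : Type} (F : (T -> Prop) -> Prop) {FF : Filter F} (e : T -> C) :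
  Clim F e 0 -> Rlim F (fun t => Cmod (e t) * (1 + Rabs (ln (Cmod (e t))))) 0.
Proof.
  intros He eps Hp. assert (Hp2 : 0 < eps / 2) by lra.
  pose proof (Rlim_Cmod F _ _ He) as Hm. rewrite Cmod_0 in Hm.
  pose proof (Rlim_comp_continuous F (fun x => x * ln x) _ _
    (continuous_xlnx 0 (Rle_refl 0)) Hm) as Hx.
  generalize (filter_and _ _ (Hm _ Hp2) (Hx _ Hp2)). apply filter_imp.
  intros t [H1 H2]. rewrite Rmult_0_l in H2. rewrite Rminus_0_r in *.
  pose proof (Cmod_ge_0 (e t)) as Hc. rewrite Rabs_mult in H2.
  rewrite (Rabs_pos_eq (Cmod (e t))) in * by exact Hc.
  rewrite Rabs_pos_eq.
  - lra.
  - pose proof (Rabs_pos (ln (Cmod (e t)))). nra.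
Qed.

Lemma negl_Im_C_differential (g : C -> C) (z l c : C) :
  C_differential g z l ->
  negl (locally z) (fun z' => Cmod (z' - z)%C)
    (fun z' => Im (c * (g z' - g z - l * (z' - z)))%C).
Proof.
  intros Hg eps He. pose proof (Cmod_ge_0 c) as Hc.
  assert (He1 : 0 < eps / (Cmod c + 1)) by (apply Rdiv_lt_0_compat; lra).
  generalize (Hg _ He1). apply filter_imp. intros z' H.
  eapply Rle_trans; [apply im_le_Cmod|]. rewrite Cmod_mult.
  replace (eps * Cmod (z' - z)%C)
    with ((Cmod c + 1) * (eps / (Cmod c + 1) * Cmod (z' - z)%C)) by (field; lra).
  apply Rmult_le_compat; [exact Hc|apply Cmod_ge_0|lra|exact H].
Qed.

Lemma Im_differential_comp (f : C -> R) (g : C -> C) (z c l : C) :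
  Im_differential f (g z) c -> C_differential g z l ->
  Im_differential (fun z => f (g z)) z (c * l)%C.
Proof.
  intros Hf Hg.
  apply (negl_ext (locally z) _ (fun z' => (f (g z') - f (g z) - Im (c * (g z' - g z))%C)
    + Im (c * (g z' - g z - l * (z' - z)))%C)).
  { intros z'. unfold Im; simpl; ring. }
  apply (negl_plus (locally z)); [|now apply negl_Im_C_differential].
  apply (negl_comp (locally z) _ g (g z)
    (fun y => f y - f (g z) - Im (c * (y - g z))%C) (Cmod l + 1)).
  - now apply C_differential_Clim with l.
  - now apply C_differential_bound.
  - apply filter_forall. intros z'. apply Cmod_ge_0.
  - exact Hf.
Qed.

Lemma Im_differential_minus_scal (f g : C -> R) (z a b : C) (r : R) :
  Im_differential f z a -> Im_differential g z b ->
  Im_differential (fun z => f z - r * g z) z (a - RtoC r * b)%C.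
Proof.
  intros Hf Hg.
  apply (negl_ext (locally z) _ (fun z' => (f z' - f z - Im (a * (z' - z))%C)
    + (- r) * (g z' - g z - Im (b * (z' - z))%C))).
  { intros z'. unfold Im; simpl; ring. }
  apply (negl_plus (locally z)); [exact Hf|now apply (negl_scal (locally z))].
Qed.

(** * Expansions near roots of unity *)

Lemma Cmod_root_of_unity (d : nat) (z : C) : (z ^ S d)%C = RtoC 1 -> Cmod z = 1.
Proof.
  intros H. apply (f_equal Cmod) in H. rewrite Cmod_pow, Cmod_1 in H.
  destruct (pow_R1 _ _ H) as [E|E]; [|discriminate].
  now rewrite Rabs_pos_eq in E by apply Cmod_ge_0.
Qed.

(** The root is simple: the derivative of [z^(d+1)] has modulus [d + 1 >= 1] there, and an error of
    [1 / 2] leaves a slope of at least [1 / 2]. In particular there is no other root nearby, and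
    [|z' - z|] can be traded for [|z'^(d+1) - 1|]. *)
Lemma root_of_unity_lower_bound (d : nat) (z : C) :
  (z ^ S d)%C = RtoC 1 ->
  locally z (fun z' => Cmod (z' - z)%C <= 2 * Cmod (z' ^ S d - 1)%C).
Proof.
  intros Hz. pose proof (Cmod_root_of_unity d z Hz) as H1.
  assert (Hh : 0 < 1 / 2) by lra.
  generalize (C_differential_pow (S d) z _ Hh). apply filter_imp. intros z' H.
  change (pred (S d)) with d in H. rewrite Hz in H.
  pose proof (Cmod_triangle (z' ^ S d - 1)%C
    (- (z' ^ S d - 1 - RtoC (INR (S d)) * z ^ d * (z' - z)))%C) as Ht.
  rewrite Cmod_opp in Ht.
  replace (z' ^ S d - 1 + - (z' ^ S d - 1 - RtoC (INR (S d)) * z ^ d * (z' - z)))%C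
    with (RtoC (INR (S d)) * z ^ d * (z' - z))%C in Ht by ring.
  rewrite !Cmod_mult, Cmod_pow, H1, pow1, Rmult_1_r, Cmod_R in Ht.
  rewrite Rabs_pos_eq in Ht by apply pos_INR.
  pose proof (Cmod_ge_0 (z' - z)%C). rewrite S_INR in H, Ht. pose proof (pos_INR d).
  assert (0 <= INR d * Cmod (z' - z)%C) by nra. lra.
Qed.

Lemma Clim_pow_minus_root (d : nat) (z : C) :
  (z ^ S d)%C = RtoC 1 -> Clim (locally z) (fun z' => z' ^ S d - 1)%C 0.
Proof.
  intros Hz. replace (RtoC 0) with (z ^ S d - 1)%C by (rewrite Hz; ring).
  apply (Clim_minus (locally z) (fun z' => z' ^ S d)%C (fun _ => RtoC 1));
    [apply (Clim_pow (locally z)), Clim_id|apply (Clim_const (locally z))].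
Qed.

(** [D_near_1] is applied at [e = z'^(d+1) - 1]. Since [z^d = 1 / z], the linear part of [e] is
    [(d + 1) (z' - z) / z], and [rho] is the quadratic remainder. *)
Lemma D_pow_near_root (d : nat) (z : C) :
  (z ^ S d)%C = RtoC 1 ->
  negl (locally z) (fun z' => Cmod (z' - z)%C)
    (fun z' => / INR (S d) * D (z' ^ S d)%C - Im ((z' - z) / z)%C
               + Im ((z' - z) / z)%C * ln (Cmod (z' ^ S d - 1)%C)).
Proof.
  intros Hz. pose proof (Cmod_root_of_unity d z Hz) as H1.
  assert (Hz0 : z <> RtoC 0) by (apply Cmod_gt_0; lra).
  assert (HN : INR (S d) <> 0) by (apply not_0_INR; discriminate).
  assert (Hpos : locally z (fun z' => 0 <= Cmod (z' - z)%C))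
    by (apply filter_forall; intros; apply Cmod_ge_0).
  set (rho := fun z' => (z' ^ S d - 1 - RtoC (INR (S d)) * ((z' - z) / z))%C).
  apply (negl_ext (locally z) _ (fun z' =>
    / INR (S d) * (D (z' ^ S d)%C - Im (z' ^ S d - 1)%C
                   + Im (z' ^ S d - 1)%C * ln (Cmod (z' ^ S d - 1)%C))
    + / INR (S d) * (Im (rho z') * (1 - ln (Cmod (z' ^ S d - 1)%C))))).
  { intros z'. unfold rho.
    replace (Im (z' ^ S d - 1 - RtoC (INR (S d)) * ((z' - z) / z))%C)
      with (Im (z' ^ S d - 1)%C - INR (S d) * Im ((z' - z) / z)%C)
      by (rewrite <- im_scal_l; unfold Im; simpl; ring).
    field. exact HN. }
  apply (negl_plus (locally z)); apply (negl_scal (locally z)).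
  - apply (negl_comp (locally z) _ (fun z' => z' ^ S d)%C (RtoC 1)
      (fun y => D y - Im (y - 1)%C + Im (y - 1)%C * ln (Cmod (y - 1)%C))
      (Cmod (RtoC (INR (S d)) * z ^ d)%C + 1)).
    + rewrite <- Hz. apply (Clim_pow (locally z)), Clim_id.
    + rewrite <- Hz. exact (C_differential_bound _ _ _ (C_differential_pow (S d) z)).
    + exact Hpos.
    + exact D_near_1.
  - destruct (pow_second_order (S d) z) as [M [HM Hsec]].
    set (e := fun z' => (z' ^ S d - 1)%C).
    (* One of the two factors [|z' - z|] in the bound of [rho] is replaced by [2 |e|], so that the
       logarithm appears only in [|e| (1 + |ln |e||)], which tends to [0]. *)
    apply (negl_dom (locally z) _ _ (fun z' => Cmod (z' - z)%C *
      (Cmod (e z') * (1 + Rabs (ln (Cmod (e z')))) * (2 * M)))).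
    + generalize (filter_and _ _ Hsec (root_of_unity_lower_bound d z Hz)).
      apply filter_imp. intros z' [A B]. fold (e z') in *.
      change (pred (S d)) with d in A. rewrite Hz in A.
      replace (z ^ d)%C with (/ z)%C in A.
      2:{ replace (/ z)%C with (/ z * 1)%C by ring. rewrite <- Hz.
          change (z ^ S d)%C with (z * z ^ d)%C. field. exact Hz0. }
      replace (z' ^ S d - 1 - RtoC (INR (S d)) * / z * (z' - z))%C
        with (rho z') in A by (unfold rho; field; exact Hz0).
      pose proof (Cmod_ge_0 (z' - z)%C) as P1. pose proof (Cmod_ge_0 (e z')) as P2.
      pose proof (Rabs_pos (ln (Cmod (e z')))) as P3.
      set (w := Cmod (z' - z)%C) in *. set (E := Cmod (e z')) in *.
      rewrite Rabs_mult. rewrite (Rabs_pos_eq (w * _)).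
      2:{ apply Rmult_le_pos; [exact P1|]. apply Rmult_le_pos; [nra|lra]. }
      assert (Q1 : Rabs (Im (rho z')) <= M * (w * w))
        by (eapply Rle_trans; [apply im_le_Cmod|exact A]).
      assert (Q2 : Rabs (1 - ln E) <= 1 + Rabs (ln E)).
      { eapply Rle_trans; [apply Rabs_triang|]. rewrite Rabs_R1, Rabs_Ropp. lra. }
      eapply Rle_trans.
      * apply Rmult_le_compat; [apply Rabs_pos|apply Rabs_pos|exact Q1|exact Q2].
      * replace (w * (E * (1 + Rabs (ln E)) * (2 * M)))
          with (M * (w * (2 * E)) * (1 + Rabs (ln E))) by ring.
        apply Rmult_le_compat_r; [lra|]. apply Rmult_le_compat_l; [exact HM|].
        apply Rmult_le_compat_l; [exact P1|exact B].
    + apply (negl_mult_Rlim (locally z) _ (fun z' => Cmod (z' - z)%C) _ 1).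
      * apply filter_forall. intros z'. rewrite Rabs_pos_eq by apply Cmod_ge_0. lra.
      * exact Hpos.
      * apply (Rlim_mult_bounded (locally z) _ _ (Rabs (2 * M)));
          [|apply filter_forall; intros; lra].
        apply (Rlim_Cmod_ln (locally z)). now apply Clim_pow_minus_root.
Qed.

Definition dilog_pow (d : nat) (z : C) : R := D z - / INR (S d) * D (z ^ S d)%C.

Lemma dilog_pow_differential (d : nat) (z l : C) :
  z <> RtoC 0 -> geom d z <> RtoC 0 -> C_differential (geom d) z l ->
  Im_differential (dilog_pow d) z
    (RtoC (ln (Cmod (geom d z))) / z - RtoC (ln (Cmod z)) * l / geom d z)%C.
Proof.
  intros Hz Hq Hl.
  assert (HN : INR (S d) <> 0) by (apply not_0_INR; discriminate).
  assert (HNC : RtoC (INR (S d)) <> RtoC 0) by (intros E; apply HN, RtoC_inj, E).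
  destruct (Ceq_dec z 1) as [->|Hz1].
  - rewrite Cmod_1, ln_1.
    replace (RtoC (ln (Cmod (geom d 1))) / 1 - RtoC 0 * l / geom d 1)%C
      with (RtoC (ln (Cmod (geom d 1)))) by (field; exact Hq).
    pose proof (Cpow_1_l (S d)) as H1.
    pose proof (C_differential_Clim _ _ _ Hl) as Hlim.
    (* As [ln |z'^(d+1) - 1| = ln |z' - 1| + ln |q(z')|], the singular logarithms of the two
       expansions at [1] cancel, and [Im (z' - 1) ln |q(z')|] remains. *)
    apply (negl_ext_loc (locally (RtoC 1)) _ (fun z' =>
      (D z' - Im (z' - 1)%C + Im (z' - 1)%C * ln (Cmod (z' - 1)%C)) +
      ((-1) * (/ INR (S d) * D (z' ^ S d)%C - Im ((z' - 1) / 1)%C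
               + Im ((z' - 1) / 1)%C * ln (Cmod (z' ^ S d - 1)%C)) +
      Im (z' - 1)%C * (ln (Cmod (geom d z')) - ln (Cmod (geom d 1)))))).
    { generalize (Clim_neq_0 _ _ _ Hlim Hq). apply filter_imp. intros z' Hq'.
      unfold dilog_pow. rewrite H1, (D_real 1) by lra.
      replace ((z' - 1) / 1)%C with (z' - 1)%C by (field; apply C1_nz).
      rewrite im_scal_l, <- geom_mult, Cmod_mult.
      destruct (Ceq_dec z' 1) as [->|Hn].
      - replace (Im (1 - 1)%C) with 0 by (unfold Im; simpl; ring). ring.
      - rewrite ln_mult; [ring| |now apply Cmod_gt_0].
        apply Cmod_gt_0. now apply Cminus_eq_contra. }
    apply (negl_plus (locally (RtoC 1))); [exact D_near_1|].
    apply (negl_plus (locally (RtoC 1))).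
    + apply (negl_scal (locally (RtoC 1))). now apply D_pow_near_root.
    + apply (negl_mult_Rlim (locally (RtoC 1)) _ _ _ 1).
      * apply filter_forall. intros z'. rewrite Rmult_1_l. apply im_le_Cmod.
      * apply filter_forall. intros z'. apply Cmod_ge_0.
      * intros eps He. generalize (Rlim_ln_Cmod _ _ _ Hlim Hq eps He).
        apply filter_imp. intros z' H. now rewrite Rminus_0_r.
  - assert (Hw : (z - 1)%C <> RtoC 0) by (now apply Cminus_eq_contra).
    pose proof (geom_mult d z) as Hg.
    assert (HZ1 : (z ^ S d)%C <> RtoC 1).
    { intros E. apply (Cmult_neq_0 _ _ Hw Hq). rewrite Hg, E. ring. }
    assert (HZ0 : (z ^ S d)%C <> RtoC 0) by (now apply Cpow_nz).
    pose proof (C_differential_geom_eq d z l Hl) as Hd.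
    assert (E : (RtoC (ln (Cmod (geom d z))) / z - RtoC (ln (Cmod z)) * l / geom d z)%C
      = (dilog_coef z - RtoC (/ INR (S d)) *
          (dilog_coef (z ^ S d) * (RtoC (INR (S d)) * z ^ pred (S d))))%C).
    { unfold dilog_coef. change (pred (S d)) with d.
      assert (L1 : ln (Cmod (1 - z ^ S d)%C)
                   = ln (Cmod (1 - z)%C) + ln (Cmod (geom d z))).
      { rewrite (Cmod_minus_sym 1), (Cmod_minus_sym 1 z), <- Hg, Cmod_mult.
        apply ln_mult; now apply Cmod_gt_0. }
      assert (L2 : ln (Cmod (z ^ S d)%C) = INR (S d) * ln (Cmod z)).
      { rewrite Cmod_pow. apply ln_pow. now apply Cmod_gt_0. }
      rewrite L1, L2, RtoC_plus, RtoC_mult, RtoC_inv by exact HN.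
      replace (1 - z ^ S d)%C with (- ((z - 1) * geom d z))%C by (rewrite Hg; ring).
      change (z ^ S d)%C with (z * z ^ d)%C.
      assert (Hzd : (z ^ d)%C <> RtoC 0) by (now apply Cpow_nz).
      assert (Hw' : (1 - z)%C <> RtoC 0) by (apply Cminus_eq_contra; congruence).
      (* For [z <> 1] the differentiated relation determines [l]; the claim becomes a rational
         identity in which [q(z)], [z^d] and the logarithms are independent atoms. *)
      replace l with ((RtoC (INR (S d)) * z ^ d - geom d z) / (z - 1))%C
        by (rewrite <- Hd; field; exact Hw).
      generalize dependent (geom d z). intros q. intros.
      field. repeat split; assumption. }
    rewrite E. apply Im_differential_minus_scal with (g := fun z => D (z ^ S d)%C).
    + now apply D_differential.
    + apply (Im_differential_comp D (fun z => z ^ S d)%C).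
      * now apply D_differential.
      * apply C_differential_pow.
Qed.

Lemma geom_root (d : nat) (z : C) : geom d z = RtoC 0 -> (z ^ S d)%C = RtoC 1.
Proof.
  intros H. pose proof (geom_mult d z) as E. rewrite H, Cmult_0_r in E.
  apply Ceq_minus. now rewrite <- E.
Qed.

Lemma geom_root_neq_1 (d : nat) (z : C) : geom d z = RtoC 0 -> z <> RtoC 1.
Proof.
  intros H ->.
  assert (E : forall n, geom n 1 = RtoC (INR (S n))).
  { induction n as [|n IH]; [reflexivity|].
    change (geom (S n) 1) with (geom n 1 + 1 ^ S n)%C.
    rewrite IH, Cpow_1_l, (S_INR (S n)), RtoC_plus. reflexivity. }
  rewrite E in H. apply RtoC_inj in H. revert H. apply not_0_INR. discriminate.
Qed.

(** Such a root is not [1], so [D] is differentiable there, with coefficient [- ln |1 - z| / z]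
    because [|z| = 1]. The singular behaviour comes from [D(z^(d+1))] alone, and splitting off
    [ln |z' - 1|] leaves [ln |q(z')|]. *)
Lemma dilog_pow_near_root (d : nat) (z : C) :
  geom d z = RtoC 0 ->
  negl (locally z) (fun z' => Cmod (z' - z)%C)
    (fun z' => dilog_pow d z' - dilog_pow d z
       - (Im ((z' - z) / z)%C * ln (Cmod (geom d z')) - Im ((z' - z) / z)%C)).
Proof.
  intros Hq.
  pose proof (geom_root d z Hq) as Hz. pose proof (geom_root_neq_1 d z Hq) as Hz1.
  pose proof (Cmod_root_of_unity d z Hz) as H1.
  assert (Hz0 : z <> RtoC 0) by (apply Cmod_gt_0; lra).
  assert (Hw : (1 - z)%C <> RtoC 0) by (apply Cminus_eq_contra; congruence).
  assert (Hlim : Clim (locally z) (fun z' => 1 - z')%C (1 - z)%C)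
    by (apply (Clim_minus (locally z)); [apply (Clim_const (locally z))|apply Clim_id]).
  assert (HN : INR (S d) <> 0) by (apply not_0_INR; discriminate).
  apply (negl_ext_loc (locally z) _ (fun z' =>
    (D z' - D z - Im (dilog_coef z * (z' - z))%C) +
    ((-1) * (/ INR (S d) * D (z' ^ S d)%C - Im ((z' - z) / z)%C
               + Im ((z' - z) / z)%C * ln (Cmod (z' ^ S d - 1)%C)) +
     Im ((z' - z) / z)%C * (ln (Cmod (1 - z')%C) - ln (Cmod (1 - z)%C))))).
  { generalize (filter_and _ _ (root_of_unity_lower_bound d z Hz)
      (Clim_neq_0 _ _ _ Hlim Hw)).
    apply filter_imp. intros z' [Hlow Hw'].
    unfold dilog_pow. rewrite Hz, (D_real 1) by lra.
    replace (Im (dilog_coef z * (z' - z))%C)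
      with (- ln (Cmod (1 - z)%C) * Im ((z' - z) / z)%C).
    2:{ rewrite <- im_scal_l. unfold dilog_coef. rewrite H1, ln_1, RtoC_opp.
        f_equal. field. split; assumption. }
    (* If [q(z') = 0] the logarithm cannot be split, but then the lower bound forces [z' = z] and
       every term vanishes. *)
    destruct (Ceq_dec (geom d z') 0) as [Hg|Hg].
    - rewrite (geom_root d z' Hg) in *.
      replace (1 - 1)%C with (RtoC 0) in Hlow by ring. rewrite Cmod_0 in Hlow.
      pose proof (Cmod_ge_0 (z' - z)%C) as P.
      assert (E : (z' - z)%C = RtoC 0) by (apply Cmod_eq_0; lra).
      rewrite E. replace (Im (0 / z)%C) with 0; [ring|].
      replace (0 / z)%C with (RtoC 0) by (field; exact Hz0). reflexivity.
    - rewrite <- geom_mult, Cmod_mult, (Cmod_minus_sym z' 1).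
      rewrite ln_mult by (now apply Cmod_gt_0). ring. }
  apply (negl_plus (locally z)); [now apply D_differential|].
  apply (negl_plus (locally z)).
  - apply (negl_scal (locally z)). now apply D_pow_near_root.
  - apply (negl_mult_Rlim (locally z) _ _ _ 1).
    + apply filter_forall. intros z'. eapply Rle_trans; [apply im_le_Cmod|].
      rewrite Cmod_div, H1 by exact Hz0. right. field.
    + apply filter_forall. intros z'. apply Cmod_ge_0.
    + intros eps He. generalize (Rlim_ln_Cmod _ _ _ Hlim Hw eps He).
      apply filter_imp. intros z' H. now rewrite Rminus_0_r.
Qed.

(** * Identities for [P_d] *)

(** The homogeneous part of degree [d] of [P_d], that is [(x^(d+1) - y^(d+1)) / (x - y)], in a
    recursive form that remains meaningful at [x = y]. *)
Fixpoint hom (d : nat) (x y : C) : C :=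
  match d with O => RtoC 1 | S n => (y * hom n x y + x ^ S n)%C end.

Lemma hom_mult (d : nat) (x y : C) : ((x - y) * hom d x y)%C = (x ^ S d - y ^ S d)%C.
Proof.
  induction d as [|d IH]; [simpl; ring|].
  change (hom (S d) x y) with (y * hom d x y + x ^ S d)%C.
  transitivity (y * ((x - y) * hom d x y) + (x - y) * x ^ S d)%C; [ring|].
  rewrite IH. change (x ^ S (S d))%C with (x * x ^ S d)%C.
  change (y ^ S (S d))%C with (y * y ^ S d)%C. ring.
Qed.

Lemma hom_geom (d : nat) (x y : C) :
  y <> RtoC 0 -> hom d x y = (y ^ d * geom d (x / y))%C.
Proof.
  intros Hy. induction d as [|d IH]; [simpl; ring|].
  change (hom (S d) x y) with (y * hom d x y + x ^ S d)%C.
  change (geom (S d) (x / y)) with (geom d (x / y) + (x / y) ^ S d)%C.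
  rewrite IH. replace (x ^ S d)%C with (y ^ S d * (x / y) ^ S d)%C.
  - change (y ^ S d)%C with (y * y ^ d)%C. ring.
  - rewrite <- Cpow_mult_l. f_equal. field. exact Hy.
Qed.

Lemma hom_sum (d : nat) (x y : C) :
  hom d x y = sum_n (fun i => (x ^ i * y ^ (d - i))%C) d.
Proof.
  induction d as [|d IH].
  - rewrite sum_O. simpl. ring.
  - change (hom (S d) x y) with (y * hom d x y + x ^ S d)%C.
    rewrite sum_Sn, IH, Nat.sub_diag.
    apply (f_equal2 Cplus); [|simpl; ring].
    rewrite <- (sum_n_mult_l (K := C_Ring) y). apply sum_n_ext_loc. intros i Hi.
    rewrite Nat.sub_succ_l by exact Hi.
    change (mult ?a ?b) with (Cmult a b).
    change (y ^ S (d - i))%C with (y * y ^ (d - i))%C.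
    change (@eq C (y * (x ^ i * y ^ (d - i))) (x ^ i * (y * y ^ (d - i))))%C. ring.
Qed.

Lemma P_S (d : nat) (x y : C) : P_ (S d) (x, y) = (P_ d (x, y) + hom (S d) x y)%C.
Proof.
  rewrite hom_sum. unfold P_. simpl fst. simpl snd.
  rewrite (sum_Sn _ d), (sum_Sn _ d). change (plus ?a ?b) with (Cplus a b).
  rewrite Nat.sub_diag, sum_O, Cplus_assoc. f_equal.
  rewrite <- (sum_n_plus (G := C_AbelianMonoid)). apply sum_n_ext_loc. intros i Hi.
  rewrite Nat.sub_succ_l by exact Hi. rewrite sum_Sn. reflexivity.
Qed.

Lemma P_mult_diff (d : nat) (x y : C) :
  ((x - y) * P_ d (x, y))%C = (x * geom d x - y * geom d y)%C.
Proof.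
  induction d as [|d IH].
  - unfold P_. rewrite !sum_O. simpl. ring.
  - rewrite P_S. transitivity ((x - y) * P_ d (x, y) + (x - y) * hom (S d) x y)%C; [ring|].
    rewrite IH, hom_mult.
    change (geom (S d) x) with (geom d x + x ^ S d)%C.
    change (geom (S d) y) with (geom d y + y ^ S d)%C.
    change (x ^ S (S d))%C with (x * x ^ S d)%C.
    change (y ^ S (S d))%C with (y * y ^ S d)%C. ring.
Qed.

(** A telescoping sum over degrees: [y * hom n = hom (S n) - x^(n+1)]. With [hom_geom] the right
    side becomes [y^(d+1) q(x/y) - q(x)]. *)
Lemma P_mult_pred (d : nat) (x y : C) :
  ((y - 1) * P_ d (x, y))%C = (y * hom d x y - geom d x)%C.
Proof.
  induction d as [|d IH].
  - unfold P_. rewrite !sum_O. simpl. ring.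
  - rewrite P_S. transitivity ((y - 1) * P_ d (x, y) + (y - 1) * hom (S d) x y)%C; [ring|].
    rewrite IH. change (hom (S d) x y) with (y * hom d x y + x ^ S d)%C.
    change (geom (S d) x) with (geom d x + x ^ S d)%C. ring.
Qed.

Lemma P_0_geom (d : nat) (x y : C) :
  P_ d (x, y) = RtoC 0 -> (x * geom d x)%C = (y * geom d y)%C.
Proof.
  intros H. apply Ceq_minus. rewrite <- P_mult_diff, H. ring.
Qed.

Lemma P_0_geom_quot (d : nat) (x y : C) :
  y <> RtoC 0 -> P_ d (x, y) = RtoC 0 -> (y ^ S d * geom d (x / y))%C = geom d x.
Proof.
  intros Hy H. apply Ceq_minus. pose proof (P_mult_pred d x y) as E.
  rewrite H, (hom_geom d x y Hy) in E.
  change (y ^ S d)%C with (y * y ^ d)%C.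
  rewrite <- Cmult_assoc, <- E. ring.
Qed.

Lemma ex_C_differential_P (d : nat) (x y : C) :
  (exists a, C_differential (fun t => P_ d (t, y)) x a) /\
  (exists b, C_differential (fun t => P_ d (x, t)) y b).
Proof.
  assert (Hhx : forall d, exists a, C_differential (fun t => hom d t y) x a).
  { clear d. induction d as [|d [a IH]].
    - exists 0. apply (C_differential_const 1).
    - eexists. apply (C_differential_plus (fun t => y * hom d t y)%C (fun t => t ^ S d)%C).
      + apply (C_differential_mult (fun _ => y)); [apply C_differential_const|exact IH].
      + apply C_differential_pow. }
  assert (Hhy : forall d, exists a, C_differential (fun t => hom d x t) y a).
  { clear d Hhx. induction d as [|d [a IH]].
    - exists 0. apply (C_differential_const 1).
    - eexists. apply (C_differential_plus (fun t => t * hom d x t)%C (fun _ => x ^ S d)%C).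
      + apply (C_differential_mult (fun t => t)); [apply C_differential_id|exact IH].
      + apply C_differential_const. }
  assert (H0 : forall t s, P_ 0 (t, s) = RtoC 1).
  { intros t s. unfold P_. rewrite !sum_O. simpl. ring. }
  induction d as [|d [[a IHa] [b IHb]]].
  - split; exists 0.
    + apply C_differential_ext with (fun _ => RtoC 1); [intros t; now rewrite H0|].
      apply C_differential_const.
    + apply C_differential_ext with (fun _ => RtoC 1); [intros t; now rewrite H0|].
      apply C_differential_const.
  - destruct (Hhx (S d)) as [a' Ha']. destruct (Hhy (S d)) as [b' Hb']. split.
    + exists (a + a')%C.
      apply C_differential_ext with (fun t => P_ d (t, y) + hom (S d) t y)%C;
        [intros t; now rewrite P_S|now apply C_differential_plus].
    + exists (b + b')%C.
      apply C_differential_ext with (fun t => P_ d (x, t) + hom (S d) x t)%C;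
        [intros t; now rewrite P_S|now apply C_differential_plus].
Qed.

Lemma C_differential_inv (f : C -> C) (z l : C) :
  C_differential f z l -> f z <> RtoC 0 ->
  C_differential (fun t => / f t)%C z (- l / (f z * f z))%C.
Proof.
  intros Hf Hz eps He.
  pose proof (C_differential_Clim _ _ _ Hf) as Lf.
  pose proof (proj1 (Cmod_gt_0 _) Hz) as Hp. pose proof (Cmod_ge_0 l) as Hl.
  pose proof (Clim_inv _ _ _ Lf Hz) as Li.
  set (k := Cmod (f z)) in *.
  set (e1 := eps * k * k / 4). set (e2 := eps * k / (2 * (Cmod l + 1))).
  assert (He1 : 0 < e1) by (unfold e1; assert (0 < eps * k) by nra; nra).
  assert (He2 : 0 < e2) by (apply Rdiv_lt_0_compat; nra).
  generalize (filter_and _ _ (filter_and _ _ (Hf _ He1) (Li _ He2))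
    (Clim_away_0 _ _ _ Lf Hz)).
  apply filter_imp. intros z' [[H1 H2] H3]. fold k in H3.
  assert (Hn : f z' <> RtoC 0) by (apply Cmod_gt_0; lra).
  set (m := Cmod (z' - z)%C) in *. assert (Hm : 0 <= m) by apply Cmod_ge_0.
  replace (/ f z' - / f z - - l / (f z * f z) * (z' - z))%C
    with (- ((f z' - f z - l * (z' - z)) / (f z' * f z))
          + - (l * (z' - z) * (/ f z' - / f z) / f z))%C
    by (field; split; assumption).
  eapply Rle_trans; [apply Cmod_triangle|].
  rewrite !Cmod_opp, !Cmod_div, !Cmod_mult by (try apply Cmult_neq_0; assumption).
  fold k m.
  assert (B1 : Cmod (f z' - f z - l * (z' - z))%C / (Cmod (f z') * k) <= eps / 2 * m).
  { apply Rle_div_l; [nra|]. eapply Rle_trans; [exact H1|].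
    unfold e1. replace (eps * k * k / 4 * m) with (eps / 2 * m * (k / 2 * k)) by field.
    apply Rmult_le_compat_l; [nra|]. apply Rmult_le_compat_r; lra. }
  assert (B2 : Cmod l * m * Cmod (/ f z' - / f z)%C / k <= eps / 2 * m).
  { apply Rle_div_l; [lra|].
    apply Rle_trans with ((Cmod l + 1) * m * e2).
    - apply Rmult_le_compat; [nra|apply Cmod_ge_0|nra|exact H2].
    - right. unfold e2. field. lra. }
  lra.
Qed.

Lemma C_differential_comp (f g : C -> C) (z a b : C) :
  C_differential f (g z) a -> C_differential g z b ->
  C_differential (fun t => f (g t)) z (a * b)%C.
Proof.
  intros Hf Hg eps He. pose proof (Cmod_ge_0 a) as Ha. pose proof (Cmod_ge_0 b) as Hb.
  assert (He1 : 0 < eps / 2 / (Cmod b + 1)) by (apply Rdiv_lt_0_compat; lra).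
  assert (He2 : 0 < eps / 2 / (Cmod a + 1)) by (apply Rdiv_lt_0_compat; lra).
  generalize (filter_and _ _
    (Clim_locally_comp _ _ _ _ (C_differential_Clim _ _ _ Hg) (Hf _ He1))
    (filter_and _ _ (Hg _ He2) (C_differential_bound _ _ _ Hg))).
  apply filter_imp. intros z' [H1 [H2 H3]].
  set (m := Cmod (z' - z)%C) in *. assert (Hm : 0 <= m) by apply Cmod_ge_0.
  replace (f (g z') - f (g z) - a * b * (z' - z))%C
    with ((f (g z') - f (g z) - a * (g z' - g z)) + a * (g z' - g z - b * (z' - z)))%C
    by ring.
  eapply Rle_trans; [apply Cmod_triangle|]. rewrite (Cmod_mult a).
  assert (B1 : Cmod (f (g z') - f (g z) - a * (g z' - g z))%C <= eps / 2 * m).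
  { eapply Rle_trans; [exact H1|].
    replace (eps / 2 * m) with (eps / 2 / (Cmod b + 1) * ((Cmod b + 1) * m)) by (field; lra).
    apply Rmult_le_compat_l; lra. }
  assert (B2 : Cmod a * Cmod (g z' - g z - b * (z' - z))%C <= eps / 2 * m).
  { replace (eps / 2 * m) with ((Cmod a + 1) * (eps / 2 / (Cmod a + 1) * m)) by (field; lra).
    apply Rmult_le_compat; [lra|apply Cmod_ge_0|lra|exact H2]. }
  lra.
Qed.

(* Tangent vectors satisfy the logarithmic derivatives of the two identities
   [x * geom d x = y * geom d y] and [y ^ S d * geom d (x / y) = geom d x]. *)
Lemma tangent_geom (d : nat) (x y u v lx ly lr : C) :
  x <> RtoC 0 -> y <> RtoC 0 -> P_ d (x, y) = RtoC 0 -> tangent (P_ d) (x, y) (u, v) ->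
  C_differential (geom d) x lx -> C_differential (geom d) y ly ->
  C_differential (geom d) (x / y)%C lr ->
  ((geom d x + x * lx) * u = (geom d y + y * ly) * v)%C /\
  (y ^ S d * lr * ((u - x / y * v) / y)
   + RtoC (INR (S d)) * y ^ d * geom d (x / y) * v = lx * u)%C.
Proof.
  intros Hx Hy HP HT Hlx Hly Hlr.
  destruct (ex_C_differential_P d x y) as [[a Ha] [b Hb]].
  unfold tangent, dP in HT. simpl fst in HT. simpl snd in HT.
  rewrite (C_differential_C_derive _ _ _ Ha), (C_differential_C_derive _ _ _ Hb) in HT.
  (* Each side of an identity is differentiated in one variable; [P_d = 0] kills the term in which
     the linear factor is differentiated. Only multiples by [x - y] or [y - 1] are compared, so the
     points with [x = y] or [y = 1] are not exceptional. *)
  assert (Ex : ((x - y) * a)%C = (geom d x + x * lx)%C).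
  { apply C_differential_unique with (f := fun t => ((t + - y) * P_ d (t, y))%C) (z := x).
    - replace ((x - y) * a)%C with ((1 + 0) * P_ d (x, y) + (x + - y) * a)%C
        by (rewrite HP; ring).
      apply (C_differential_mult (fun t => t + - y)%C); [|exact Ha].
      apply C_differential_plus; [apply C_differential_id|apply C_differential_const].
    - apply C_differential_ext with (fun t => t * geom d t + - (y * geom d y))%C.
      + intros t. symmetry. exact (P_mult_diff d t y).
      + replace (geom d x + x * lx)%C with ((1 * geom d x + x * lx) + 0)%C by ring.
        apply C_differential_plus; [|apply C_differential_const].
        apply (C_differential_mult (fun t => t)); [apply C_differential_id|exact Hlx]. }
  assert (Ey : ((y - x) * b)%C = (geom d y + y * ly)%C).
  { apply C_differential_unique with (f := fun t => ((t + - x) * P_ d (x, t))%C) (z := y).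
    - replace ((y - x) * b)%C with ((1 + 0) * P_ d (x, y) + (y + - x) * b)%C
        by (rewrite HP; ring).
      apply (C_differential_mult (fun t => t + - x)%C); [|exact Hb].
      apply C_differential_plus; [apply C_differential_id|apply C_differential_const].
    - apply C_differential_ext with (fun t => t * geom d t + - (x * geom d x))%C.
      + intros t. pose proof (P_mult_diff d x t) as E.
        transitivity (- (x * geom d x - t * geom d t))%C; [ring|]. rewrite <- E. ring.
      + replace (geom d y + y * ly)%C with ((1 * geom d y + y * ly) + 0)%C by ring.
        apply C_differential_plus; [|apply C_differential_const].
        apply (C_differential_mult (fun t => t)); [apply C_differential_id|exact Hly]. }
  split.
  { rewrite <- Ex, <- Ey.
    transitivity ((x - y) * (a * u + b * v) + (y - x) * b * v)%C; [ring|].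
    rewrite HT. ring. }
  (* This two-variable [q] equals [(s - 1) P_d(t, s)] only for [s <> 0]. For the derivative in [s]
     the equality is therefore used on a neighbourhood of [y] rather than everywhere. *)
  set (q := fun t s => (s ^ S d * geom d (t / s) + - geom d t)%C).
  assert (Eq : forall t s, s <> RtoC 0 -> q t s = ((s - 1) * P_ d (t, s))%C).
  { intros t s Hs. rewrite P_mult_pred, hom_geom by exact Hs. unfold q.
    change (s ^ S d)%C with (s * s ^ d)%C. ring. }
  assert (Fx : ((y - 1) * a)%C = (y ^ S d * lr / y - lx)%C).
  { apply C_differential_unique with (f := fun t => q t y) (z := x).
    - apply C_differential_ext with (fun t => (y + - (1)) * P_ d (t, y))%C.
      + intros t. now rewrite Eq.
      + replace ((y - 1) * a)%C with (0 * P_ d (x, y) + (y + - (1)) * a)%C by ring.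
        apply (C_differential_mult (fun _ => y + - (1))%C);
          [apply C_differential_const|exact Ha].
    - unfold q.
      replace (y ^ S d * lr / y - lx)%C
        with ((0 * geom d (x / y) + y ^ S d * (lr * (1 * / y + x * 0)))
              + (0 * geom d x + - (1) * lx))%C by (field; exact Hy).
      apply C_differential_ext with
        (fun t => y ^ S d * geom d (t * / y) + - (1) * geom d t)%C.
      { intros t. unfold Cdiv. ring. }
      apply C_differential_plus.
      + apply (C_differential_mult (fun _ => y ^ S d)%C (fun t => geom d (t * / y))%C);
          [apply C_differential_const|].
        apply (C_differential_comp (geom d) (fun t => t * / y)%C); [exact Hlr|].
        apply (C_differential_mult (fun t => t) (fun _ => / y)%C);
          [apply C_differential_id|apply C_differential_const].
      + apply (C_differential_mult (fun _ => - (1))%C); [apply C_differential_const|exact Hlx]. }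
  assert (Fy : ((y - 1) * b)%C =
    (RtoC (INR (S d)) * y ^ d * geom d (x / y) - y ^ S d * lr * (x / (y * y)))%C).
  { assert (H1 : C_differential (fun s => (s + - (1)) * P_ d (x, s))%C y ((y - 1) * b)%C).
    { replace ((y - 1) * b)%C with ((1 + 0) * P_ d (x, y) + (y + - (1)) * b)%C
        by (rewrite HP; ring).
      apply (C_differential_mult (fun s => s + - (1))%C); [|exact Hb].
      apply C_differential_plus; [apply C_differential_id|apply C_differential_const]. }
    assert (H2 : C_differential (q x) y
      (RtoC (INR (S d)) * y ^ d * geom d (x / y) - y ^ S d * lr * (x / (y * y)))%C).
    { unfold q.
      replace (RtoC (INR (S d)) * y ^ d * geom d (x / y) - y ^ S d * lr * (x / (y * y)))%C
        with ((RtoC (INR (S d)) * y ^ pred (S d) * geom d (x / y)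
               + y ^ S d * (lr * (0 * / y + x * (- (1) / (y * y))))) + 0)%C
        by (change (pred (S d)) with d; field; exact Hy).
      apply C_differential_plus; [|apply C_differential_const].
      apply (C_differential_mult (fun s => s ^ S d)%C (fun s => geom d (x * / s))%C);
        [apply C_differential_pow|].
      apply (C_differential_comp (geom d) (fun s => x * / s)%C); [exact Hlr|].
      apply (C_differential_mult (fun _ => x) (fun s => / s)%C);
        [apply C_differential_const|].
      apply (C_differential_inv (fun s => s)); [apply C_differential_id|exact Hy]. }
    apply C_differential_unique with (f := fun s => ((s + - (1)) * P_ d (x, s))%C) (z := y);
      [exact H1|].
    intros eps He. generalize (filter_and _ _ (H2 eps He) (Clim_neq_0 _ _ _ (Clim_id y) Hy)).
    apply filter_imp. intros s [H Hs]. rewrite !Eq in H by assumption. exact H. }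
  assert (E0 : ((y - 1) * a * u + (y - 1) * b * v)%C = RtoC 0).
  { transitivity ((y - 1) * (a * u + b * v))%C; [ring|]. rewrite HT. ring. }
  rewrite Fx, Fy in E0.
  transitivity (lx * u + ((y ^ S d * lr / y - lx) * u +
    (RtoC (INR (S d)) * y ^ d * geom d (x / y) - y ^ S d * lr * (x / (y * y))) * v))%C.
  - field. exact Hy.
  - rewrite E0. ring.
Qed.

(** * Differentials along the curve *)

Definition C2_module := prod_NormedModule R_AbsRing C_R_NormedModule C_R_NormedModule.

Lemma norm_C_R (z : C) : norm (z : C_R_NormedModule) = Cmod z.
Proof.
  change (sqrt (Rabs (fst z) ^ 2 + Rabs (snd z) ^ 2) = Cmod z).
  rewrite !pow2_abs. reflexivity.
Qed.

Lemma Cmod_le_norm (w : C * C) :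
  Cmod (fst w) <= norm (w : C2_module) /\ Cmod (snd w) <= norm (w : C2_module).
Proof.
  rewrite <- !norm_C_R.
  pose proof (sqrt_plus_sqr (norm (fst w : C_R_NormedModule))
    (norm (snd w : C_R_NormedModule))) as [H _].
  rewrite !Rabs_pos_eq in H by apply norm_ge_0.
  change (sqrt _) with (norm (w : C2_module)) in H.
  split; (eapply Rle_trans; [|exact H]); [apply Rmax_l|apply Rmax_r].
Qed.

Definition curve_filter (P : C * C -> C) (p : C * C) : (C * C -> Prop) -> Prop :=
  within (curve P) (locally (T := C2_module) p).

Global Instance curve_filter_filter (P : C * C -> C) (p : C * C) :
  Filter (curve_filter P p).
Proof. apply within_filter, locally_filter. Qed.

(** The sum of the coordinate distances is easier to estimate than the product norm;
    [C2_dist_le_norm] converts back. *)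
Definition C2_dist (p p' : C * C) : R :=
  Cmod (fst p' - fst p)%C + Cmod (snd p' - snd p)%C.

Section AlongCurve.

Context (P : C * C -> C) (p : C * C).

Lemma curve_filter_curve : curve_filter P p (curve P).
Proof.
  unfold curve_filter, within. apply filter_forall. intros p' H. exact H.
Qed.

Lemma curve_filter_locally (Q : C * C -> Prop) :
  locally (T := C2_module) p Q -> curve_filter P p Q.
Proof. unfold curve_filter, within. apply filter_imp. intros p' H _. exact H. Qed.

Lemma Clim_fst : Clim (curve_filter P p) fst (fst p).
Proof.
  intros eps He. apply curve_filter_locally.
  destruct (Clim_id (fst p) eps He) as [del H].
  exists del. intros p' [H1 _]. apply H. exact H1.
Qed.

Lemma Clim_snd : Clim (curve_filter P p) snd (snd p).
Proof.
  intros eps He. apply curve_filter_locally.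
  destruct (Clim_id (snd p) eps He) as [del H].
  exists del. intros p' [_ H2]. apply H. exact H2.
Qed.

Lemma C2_dist_pos : curve_filter P p (fun p' => 0 <= C2_dist p p').
Proof.
  apply filter_forall. intros p'. unfold C2_dist.
  pose proof (Cmod_ge_0 (fst p' - fst p)%C). pose proof (Cmod_ge_0 (snd p' - snd p)%C). lra.
Qed.

Lemma fst_le_dist : curve_filter P p (fun p' => Cmod (fst p' - fst p)%C <= 1 * C2_dist p p').
Proof.
  apply filter_forall. intros p'. unfold C2_dist.
  pose proof (Cmod_ge_0 (snd p' - snd p)%C). lra.
Qed.

Lemma snd_le_dist : curve_filter P p (fun p' => Cmod (snd p' - snd p)%C <= 1 * C2_dist p p').
Proof.
  apply filter_forall. intros p'. unfold C2_dist.
  pose proof (Cmod_ge_0 (fst p' - fst p)%C). lra.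
Qed.

Lemma Clim_quot :
  snd p <> RtoC 0 -> Clim (curve_filter P p) (fun p' => fst p' / snd p')%C (fst p / snd p)%C.
Proof.
  intros Hy. apply Clim_div; [typeclasses eauto|apply Clim_fst|apply Clim_snd|exact Hy].
Qed.

Lemma quot_increment (p' : C * C) :
  snd p <> RtoC 0 -> snd p' <> RtoC 0 ->
  (fst p' / snd p' - fst p / snd p)%C
  = (((fst p' - fst p) - fst p / snd p * (snd p' - snd p)) * / snd p')%C.
Proof. intros H H'. field. split; assumption. Qed.

Lemma Cmod_linear_le (r : C) (p' : C * C) :
  Cmod ((fst p' - fst p) - r * (snd p' - snd p))%C <= (1 + Cmod r) * C2_dist p p'.
Proof.
  eapply Rle_trans; [apply Cmod_triangle|]. rewrite Cmod_opp, Cmod_mult. unfold C2_dist.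
  pose proof (Cmod_ge_0 (fst p' - fst p)%C). pose proof (Cmod_ge_0 (snd p' - snd p)%C).
  pose proof (Cmod_ge_0 r). nra.
Qed.

Lemma quot_le_dist :
  snd p <> RtoC 0 ->
  curve_filter P p (fun p' => Cmod (fst p' / snd p' - fst p / snd p)%C
    <= ((1 + Cmod (fst p / snd p)%C) * (Cmod (/ snd p)%C + 1)) * C2_dist p p').
Proof.
  intros Hy.
  pose proof (Clim_inv _ _ _ Clim_snd Hy) as Hi.
  generalize (filter_and _ _ (Clim_bounded _ _ _ Hi) (Clim_neq_0 _ _ _ Clim_snd Hy)).
  apply filter_imp. intros p' [H1 H2].
  rewrite quot_increment by assumption. rewrite Cmod_mult.
  pose proof (Cmod_linear_le (fst p / snd p)%C p') as H3.
  rewrite Rmult_assoc, (Rmult_comm _ (C2_dist p p')), <- Rmult_assoc.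
  apply Rmult_le_compat; [apply Cmod_ge_0|apply Cmod_ge_0|exact H3|exact H1].
Qed.

(** The exact increment of [x / y] has the factor [1 / y'] where its linear part has [1 / y]. The
    difference is an [O(m)] term times [1 / y' - 1 / y], which tends to [0]. *)
Lemma negl_quot_linear (c : C) :
  snd p <> RtoC 0 ->
  negl (curve_filter P p) (C2_dist p) (fun p' =>
    Im (c * (fst p' / snd p' - fst p / snd p))%C -
    Im (c * (((fst p' - fst p) - fst p / snd p * (snd p' - snd p)) / snd p))%C).
Proof.
  intros Hy.
  pose proof (Clim_inv _ _ _ Clim_snd Hy) as Hi.
  apply (negl_dom _ _ _ (fun p' =>
    Cmod ((fst p' - fst p) - fst p / snd p * (snd p' - snd p))%C *
    (Cmod (/ snd p' - / snd p)%C * Cmod c))).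
  - generalize (Clim_neq_0 _ _ _ Clim_snd Hy). apply filter_imp. intros p' H.
    rewrite quot_increment by assumption.
    set (B := ((fst p' - fst p) - fst p / snd p * (snd p' - snd p))%C).
    replace (Im (c * (B * / snd p'))%C - Im (c * (B / snd p))%C)
      with (Im (B * ((/ snd p' - / snd p) * c))%C)
      by (unfold Cdiv, Im; simpl; ring).
    rewrite <- !Cmod_mult. rewrite (Rabs_pos_eq (Cmod _)) by apply Cmod_ge_0.
    apply im_le_Cmod.
  - apply (negl_mult_Rlim _ _ _ _ (1 + Cmod (fst p / snd p)%C)).
    + apply filter_forall. intros p'. rewrite Rabs_pos_eq by apply Cmod_ge_0.
      apply Cmod_linear_le.
    + apply C2_dist_pos.
    + apply (Rlim_mult_bounded _ _ _ (Cmod c)).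
      * intros eps He. generalize (Hi eps He). apply filter_imp. intros p' H.
        rewrite Rminus_0_r, Rabs_pos_eq by apply Cmod_ge_0. exact H.
      * apply filter_forall. intros p'. rewrite Rabs_pos_eq by apply Cmod_ge_0. lra.
Qed.

Lemma C2_dist_le_norm (p' : C * C) :
  C2_dist p p' <= 2 * norm (minus (p' : C2_module) (p : C2_module)).
Proof.
  destruct (Cmod_le_norm (minus (p' : C2_module) (p : C2_module))) as [H1 H2].
  change (fst (minus (p' : C2_module) (p : C2_module))) with (fst p' - fst p)%C in H1.
  change (snd (minus (p' : C2_module) (p : C2_module))) with (snd p' - snd p)%C in H2.
  unfold C2_dist. lra.
Qed.

Lemma is_linear_Im (a b : C) :
  is_linear (U := C2_module) (V := R_NormedModule)
    (fun w : C * C => Im (a * fst w + b * snd w)%C).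
Proof.
  split.
  - intros w w'.
    change (Im (a * (fst w + fst w') + b * (snd w + snd w'))%C
      = Im (a * fst w + b * snd w)%C + Im (a * fst w' + b * snd w')%C).
    unfold Im; simpl; ring.
  - intros k w.
    change (Im (a * (scal k (fst w) : C_R_NormedModule)
                + b * (scal k (snd w) : C_R_NormedModule))%C
      = k * Im (a * fst w + b * snd w)%C).
    rewrite !scal_R_Cmult. unfold Im; simpl; ring.
  - exists (Cmod a + Cmod b + 1).
    pose proof (Cmod_ge_0 a). pose proof (Cmod_ge_0 b).
    split; [lra|]. intros w.
    change (Rabs (Im (a * fst w + b * snd w)%C)
      <= (Cmod a + Cmod b + 1) * norm (w : C2_module)).
    destruct (Cmod_le_norm w) as [H1 H2].
    pose proof (Cmod_ge_0 (fst w)). pose proof (Cmod_ge_0 (snd w)).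
    eapply Rle_trans; [apply im_le_Cmod|].
    eapply Rle_trans; [apply Cmod_triangle|]. rewrite !Cmod_mult.
    assert (Hn : 0 <= norm (w : C2_module)) by apply norm_ge_0.
    apply Rle_trans with (Cmod a * norm (w : C2_module) + Cmod b * norm (w : C2_module)).
    + apply Rplus_le_compat; (apply Rmult_le_compat_l; [apply Cmod_ge_0|assumption]).
    + rewrite <- Rmult_plus_distr_r. apply Rmult_le_compat_r; [exact Hn|lra].
Qed.

Lemma filterdiff_curve (V : C * C -> R) (a b : C) :
  curve P p ->
  negl (curve_filter P p) (C2_dist p)
    (fun p' => V p' - V p - Im (a * (fst p' - fst p) + b * (snd p' - snd p))%C) ->
  filterdiff (U := C2_module) (V := R_NormedModule) V (curve_filter P p)
    (fun w : C * C => Im (a * fst w + b * snd w)%C).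
Proof.
  intros Hp HV. split; [apply is_linear_Im|].
  intros x Hx.
  (* [filterdiff] speaks of every limit [x] of the filter. As [p] itself lies on the curve, it
     belongs to each ball around [x], so [x = p]. *)
  assert (E : x = p).
  { apply (eq_close (V := C2_module)). intros eps.
    pose proof (Hx _ (locally_ball x eps)) as Hb.
    exact (locally_singleton _ _ Hb Hp). }
  rewrite E. intros eps.
  assert (He2 : 0 < eps / 2) by (pose proof (cond_pos eps); lra).
  generalize (HV _ He2). apply filter_imp. intros p' H.
  change (Rabs (V p' - V p - Im (a * (fst p' - fst p) + b * (snd p' - snd p))%C)
    <= eps * norm (minus (p' : C2_module) (p : C2_module))).
  eapply Rle_trans; [exact H|].
  pose proof (C2_dist_le_norm p').
  pose proof (cond_pos eps). nra.
Qed.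

End AlongCurve.

(** * The volume function at regular and singular points *)

Lemma V_dilog_pow (d : nat) (x y : C) :
  x <> RtoC 0 -> y <> RtoC 0 ->
  V_ d (x, y) = / (INR d + 2) * (dilog_pow d x - dilog_pow d y - dilog_pow d (x / y)%C).
Proof.
  intros Hx Hy. unfold V_, dilog_pow. rewrite Nat.add_1_r.
  assert (Hr : (x / y)%C <> RtoC 0).
  { apply Cmod_gt_0. rewrite Cmod_div by exact Hy.
    apply Rdiv_lt_0_compat; now apply Cmod_gt_0. }
  replace (y / x)%C with (/ (x / y))%C by (field; split; assumption).
  rewrite Cpow_inv, D_inv by (try apply Cpow_nz; exact Hr).
  rewrite S_INR. pose proof (pos_INR d). field. lra.
Qed.

Lemma Im_coef_mult (q l z w : C) :
  z <> RtoC 0 -> q <> RtoC 0 ->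
  Im ((RtoC (ln (Cmod q)) / z - RtoC (ln (Cmod z)) * l / q) * w)%C
  = ln (Cmod q) * Im (w / z)%C - ln (Cmod z) * Im (l * w / q)%C.
Proof.
  intros Hz Hq. rewrite <- !im_scal_l.
  replace ((RtoC (ln (Cmod q)) / z - RtoC (ln (Cmod z)) * l / q) * w)%C
    with (RtoC (ln (Cmod q)) * (w / z) - RtoC (ln (Cmod z)) * (l * w / q))%C
    by (field; split; assumption).
  unfold Im; simpl; ring.
Qed.

Lemma ln_Cmod_mult (x y : C) :
  x <> RtoC 0 -> y <> RtoC 0 -> ln (Cmod (x * y)%C) = ln (Cmod x) + ln (Cmod y).
Proof. intros Hx Hy. rewrite Cmod_mult. apply ln_mult; now apply Cmod_gt_0. Qed.

Lemma ln_Cmod_pow (x : C) (n : nat) :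
  x <> RtoC 0 -> ln (Cmod (x ^ n)%C) = INR n * ln (Cmod x).
Proof. intros Hx. rewrite Cmod_pow. apply ln_pow. now apply Cmod_gt_0. Qed.

(** On the curve [q] vanishes at [x], [y] and [x / y] simultaneously, whence the split into regular
    and singular points. The logarithmic relations are the moduli of the two identities. *)
Lemma ln_geom_curve (d : nat) (x y : C) :
  x <> RtoC 0 -> y <> RtoC 0 -> P_ d (x, y) = RtoC 0 -> geom d x <> RtoC 0 ->
  geom d y <> RtoC 0 /\ geom d (x / y)%C <> RtoC 0 /\
  ln (Cmod (geom d y)) = ln (Cmod (geom d x)) + ln (Cmod x) - ln (Cmod y) /\
  ln (Cmod (geom d (x / y)%C)) = ln (Cmod (geom d x)) - INR (S d) * ln (Cmod y).
Proof.
  intros Hx Hy HP Hq.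
  pose proof (P_0_geom d x y HP) as E1. pose proof (P_0_geom_quot d x y Hy HP) as E2.
  assert (Hqy : geom d y <> RtoC 0).
  { intros E. rewrite E, Cmult_0_r in E1. now apply (Cmult_neq_0 x (geom d x)). }
  assert (Hqr : geom d (x / y)%C <> RtoC 0).
  { intros E. rewrite E, Cmult_0_r in E2. congruence. }
  assert (Hyn : (y ^ S d)%C <> RtoC 0) by (now apply Cpow_nz).
  repeat split; [exact Hqy|exact Hqr| |].
  - apply (f_equal (fun z => ln (Cmod z))) in E1.
    rewrite !ln_Cmod_mult in E1 by assumption. lra.
  - apply (f_equal (fun z => ln (Cmod z))) in E2.
    rewrite ln_Cmod_mult, ln_Cmod_pow in E2 by assumption. lra.
Qed.

Lemma volume_function_regular (d : nat) (x y : C) :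
  curve (P_ d) (x, y) -> geom d x <> RtoC 0 ->
  exists l : C * C -> R,
    filterdiff (U := C2_module) (V := R_NormedModule) (V_ d)
      (curve_filter (P_ d) (x, y)) l /\
    forall w : C * C, tangent (P_ d) (x, y) w -> l w = eta (x, y) w.
Proof.
  intros Hc Hq. pose proof Hc as [Hx [Hy [HP _]]]. simpl in Hx, Hy.
  destruct (ln_geom_curve d x y Hx Hy HP Hq) as [Hqy [Hqr [Ly Lr]]].
  set (r := (x / y)%C) in *.
  assert (Hr : r <> RtoC 0).
  { apply Cmod_gt_0. unfold r. rewrite Cmod_div by exact Hy.
    apply Rdiv_lt_0_compat; now apply Cmod_gt_0. }
  destruct (ex_C_differential_geom d x) as [lx Hlx].
  destruct (ex_C_differential_geom d y) as [ly Hly].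
  destruct (ex_C_differential_geom d r) as [lr Hlr].
  set (cx := (RtoC (ln (Cmod (geom d x))) / x - RtoC (ln (Cmod x)) * lx / geom d x)%C).
  set (cy := (RtoC (ln (Cmod (geom d y))) / y - RtoC (ln (Cmod y)) * ly / geom d y)%C).
  set (cr := (RtoC (ln (Cmod (geom d r))) / r - RtoC (ln (Cmod r)) * lr / geom d r)%C).
  pose proof (dilog_pow_differential d x lx Hx Hq Hlx) as Dx. fold cx in Dx.
  pose proof (dilog_pow_differential d y ly Hy Hqy Hly) as Dy. fold cy in Dy.
  pose proof (dilog_pow_differential d r lr Hr Hqr Hlr) as Dr. fold cr in Dr.
  set (k := / (INR d + 2)).
  assert (Hk : (INR d + 2) * k = 1) by (unfold k; pose proof (pos_INR d); field; lra).
  set (F := curve_filter (P_ d) (x, y)).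
  (* Since [d(x / y) = (dx - r dy) / y], the coefficient [cr] contributes [- cr / y] to [dx] and
     [cr r / y] to [dy]. *)
  exists (fun w => Im (RtoC k * (cx - cr / y) * fst w
                       + RtoC k * (cr * r / y - cy) * snd w)%C).
  split.
  - apply filterdiff_curve; [exact Hc|].
    apply (negl_ext_loc _ _ (fun p' => k * (
      (dilog_pow d (fst p') - dilog_pow d x - Im (cx * (fst p' - x))%C) +
      ((-1) * (dilog_pow d (snd p') - dilog_pow d y - Im (cy * (snd p' - y))%C) +
      ((-1) * (dilog_pow d (fst p' / snd p')%C - dilog_pow d r
               - Im (cr * (fst p' / snd p' - r))%C) +
      (-1) * (Im (cr * (fst p' / snd p' - r))%C
        - Im (cr * (((fst p' - x) - r * (snd p' - y)) / y))%C)))))).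
    { generalize (curve_filter_curve (P_ d) (x, y)). apply filter_imp.
      intros [x' y'] [Hx' [Hy' _]]. simpl in Hx', Hy'.
      rewrite !V_dilog_pow by assumption. fold r k. simpl fst. simpl snd.
      replace (RtoC k * (cx - cr / y) * (x' - x) + RtoC k * (cr * r / y - cy) * (y' - y))%C
        with (RtoC k * (cx * (x' - x) - cy * (y' - y)
              - cr * (((x' - x) - r * (y' - y)) / y)))%C by (field; exact Hy).
      rewrite im_scal_l.
      replace (Im (cx * (x' - x) - cy * (y' - y)
                   - cr * (((x' - x) - r * (y' - y)) / y))%C)
        with (Im (cx * (x' - x))%C - Im (cy * (y' - y))%C
              - Im (cr * (((x' - x) - r * (y' - y)) / y))%C)
        by (generalize (cr * (((x' - x) - r * (y' - y)) / y))%C; intros;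
            unfold Im; simpl; ring).
      ring. }
    apply (negl_scal F). apply (negl_plus F).
    { apply (negl_comp F (C2_dist (x, y)) fst x
        (fun z => dilog_pow d z - dilog_pow d x - Im (cx * (z - x))%C) 1);
        [apply Clim_fst|apply fst_le_dist|apply C2_dist_pos|exact Dx]. }
    apply (negl_plus F).
    { apply (negl_scal F).
      apply (negl_comp F (C2_dist (x, y)) snd y
        (fun z => dilog_pow d z - dilog_pow d y - Im (cy * (z - y))%C) 1);
        [apply Clim_snd|apply snd_le_dist|apply C2_dist_pos|exact Dy]. }
    apply (negl_plus F).
    { apply (negl_scal F).
      apply (negl_comp F (C2_dist (x, y)) (fun p' => fst p' / snd p')%C r
        (fun z => dilog_pow d z - dilog_pow d r - Im (cr * (z - r))%C)
        ((1 + Cmod r) * (Cmod (/ y)%C + 1)));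
        [exact (Clim_quot (P_ d) (x, y) Hy)|exact (quot_le_dist (P_ d) (x, y) Hy)
        |apply C2_dist_pos|exact Dr]. }
    apply (negl_scal F). exact (negl_quot_linear (P_ d) (x, y) cr Hy).
  - intros [u v] HT. unfold eta. simpl fst. simpl snd.
    destruct (tangent_geom d x y u v lx ly lr Hx Hy HP HT Hlx Hly Hlr) as [T1 T2].
    fold r in T2.
    pose proof (P_0_geom d x y HP) as E1.
    pose proof (P_0_geom_quot d x y Hy HP) as E2. fold r in E2.
    set (s := ((u - r * v) / y)%C) in *.
    replace (RtoC k * (cx - cr / y) * u + RtoC k * (cr * r / y - cy) * v)%C
      with (RtoC k * (cx * u - cy * v - cr * s))%C by (unfold s; field; exact Hy).
    rewrite im_scal_l.
    replace (Im (cx * u - cy * v - cr * s)%C)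
      with (Im (cx * u)%C - Im (cy * v)%C - Im (cr * s)%C)
      by (unfold Im; simpl; ring).
    unfold cx, cy, cr. rewrite !Im_coef_mult by assumption.
    assert (Lq : ln (Cmod r) = ln (Cmod x) - ln (Cmod y)).
    { unfold r. rewrite Cmod_div by exact Hy. apply ln_div; now apply Cmod_gt_0. }
    (* [A1] and [A2] express [dq/q] at [y] and at [x / y] through [dq/q] at [x], in parallel with
       [Ly] and [Lr] for the logarithms of the moduli. *)
    assert (A1 : (ly * v / geom d y)%C = (lx * u / geom d x + u / x - v / y)%C).
    { assert (Hm : (y * geom d y)%C <> RtoC 0) by (now apply Cmult_neq_0).
      transitivity ((geom d y + y * ly) * v / (y * geom d y) - v / y)%C;
        [field; split; assumption|].
      rewrite <- T1, <- E1. field. repeat split; assumption. }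
    assert (A2 : (lr * s / geom d r)%C
                 = (lx * u / geom d x - RtoC (INR (S d)) * (v / y))%C).
    { rewrite <- T2, <- E2. change (y ^ S d)%C with (y * y ^ d)%C.
      assert (Hyd : (y ^ d)%C <> RtoC 0) by (now apply Cpow_nz).
      unfold s. field. repeat split; assumption. }
    assert (A3 : (s / r)%C = (u / x - v / y)%C)
      by (unfold s, r; field; repeat split; assumption).
    rewrite A1, A2, A3, Ly, Lr, Lq.
    replace (Im (lx * u / geom d x + u / x - v / y)%C)
      with (Im (lx * u / geom d x)%C + Im (u / x)%C - Im (v / y)%C)
      by (generalize (lx * u / geom d x)%C (u / x)%C (v / y)%C; intros;
          unfold Im; simpl; ring).
    replace (Im (lx * u / geom d x - RtoC (INR (S d)) * (v / y))%C)
      with (Im (lx * u / geom d x)%C - INR (S d) * Im (v / y)%C)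
      by (rewrite <- im_scal_l; generalize (lx * u / geom d x)%C
            (RtoC (INR (S d)) * (v / y))%C; intros; unfold Im; simpl; ring).
    replace (Im (u / x - v / y)%C) with (Im (u / x)%C - Im (v / y)%C)
      by (generalize (u / x)%C (v / y)%C; intros; unfold Im; simpl; ring).
    rewrite S_INR.
    (* All terms in [ln |q(x)|] and in [Im (dq/q)] at [x] cancel, leaving [(d + 2) (Y al - X be)],
       which the factor [k] normalizes. *)
    generalize (ln (Cmod (geom d x))) (ln (Cmod x)) (ln (Cmod y))
      (Im (lx * u / geom d x)%C) (Im (u / x)%C) (Im (v / y)%C).
    intros a X Y L al be.
    transitivity ((INR d + 2) * k * (Y * al - X * be)); [ring|]. rewrite Hk. ring.
Qed.

Lemma Rlim_ln_Cmod_unit {T : Type} (F : (T -> Prop) -> Prop) {FF : Filter F}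
  (f : T -> C) (l : C) : Clim F f l -> Cmod l = 1 -> Rlim F (fun t => ln (Cmod (f t))) 0.
Proof.
  intros Hf Hl. rewrite <- ln_1, <- Hl. apply Rlim_ln_Cmod; [exact FF|exact Hf|].
  apply Cmod_gt_0. lra.
Qed.

(** Here [|x| = |y| = 1], so [eta] is zero at the point and the differential to establish is [0].
    The work is to show that [V_] varies by [o(m)] along the curve although each [dilog_pow] does
    not. *)
Lemma volume_function_singular (d : nat) (x y : C) :
  curve (P_ d) (x, y) -> geom d x = RtoC 0 ->
  exists l : C * C -> R,
    filterdiff (U := C2_module) (V := R_NormedModule) (V_ d)
      (curve_filter (P_ d) (x, y)) l /\
    forall w : C * C, tangent (P_ d) (x, y) w -> l w = eta (x, y) w.
Proof.
  intros Hc Hq. pose proof Hc as [Hx [Hy [HP _]]]. simpl in Hx, Hy.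
  set (r := (x / y)%C).
  assert (Hqy : geom d y = RtoC 0).
  { pose proof (P_0_geom d x y HP) as E. rewrite Hq, Cmult_0_r in E.
    destruct (Ceq_dec (geom d y) 0) as [|Hn]; [assumption|].
    exfalso. apply (Cmult_neq_0 _ _ Hy Hn). now symmetry. }
  assert (Hqr : geom d r = RtoC 0).
  { pose proof (P_0_geom_quot d x y Hy HP) as E. fold r in E. rewrite Hq in E.
    destruct (Ceq_dec (geom d r) 0) as [|Hn]; [assumption|].
    exfalso. exact (Cmult_neq_0 _ _ (Cpow_nz y (S d) Hy) Hn E). }
  pose proof (geom_root d y Hqy) as Ry. pose proof (geom_root d r Hqr) as Rr.
  pose proof (Cmod_root_of_unity d x (geom_root d x Hq)) as Mx.
  pose proof (Cmod_root_of_unity d y Ry) as My.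
  pose proof (Cmod_root_of_unity d r Rr) as Mr.
  assert (Hr : r <> RtoC 0) by (apply Cmod_gt_0; lra).
  set (F := curve_filter (P_ d) (x, y)). set (m := C2_dist (x, y)).
  pose proof (Clim_fst (P_ d) (x, y)) as Lx. fold F in Lx. simpl in Lx.
  pose proof (Clim_snd (P_ d) (x, y)) as Ly. fold F in Ly. simpl in Ly.
  pose proof (Clim_quot (P_ d) (x, y) Hy) as Lr. fold F in Lr. simpl in Lr. fold r in Lr.
  pose proof (snd_le_dist (P_ d) (x, y)) as By. fold F m in By. simpl in By.
  pose proof (quot_le_dist (P_ d) (x, y) Hy) as Br. fold F m in Br. simpl in Br. fold r in Br.
  set (Mq := (1 + Cmod r) * (Cmod (/ y)%C + 1)) in Br.
  assert (Hm : F (fun p' => 0 <= m p')) by apply C2_dist_pos.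
  (* [k], [g] and [h = (x' - x) / x] are relative increments of [y], [x / y] and [x], so
     [1 + h = (1 + g)(1 + k)]; the first-order relation [h = g + k] drives the cancellation. *)
  set (k := fun p' : C * C => ((snd p' - y) / y)%C).
  set (g := fun p' : C * C => ((fst p' / snd p' - r) / r)%C).
  assert (Rk : forall p', Cmod (k p') = Cmod (snd p' - y)%C)
    by (intros p'; unfold k; rewrite Cmod_div, My by exact Hy; field).
  assert (Rg : forall p', Cmod (g p') = Cmod (fst p' / snd p' - r)%C)
    by (intros p'; unfold g; rewrite Cmod_div, Mr by exact Hr; field).
  set (c := fun p' : C * C => ln (Cmod (geom d (fst p' / snd p')%C))).
  set (X := fun p' : C * C => ln (Cmod (fst p'))).
  set (Y := fun p' : C * C => ln (Cmod (snd p'))).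
  assert (LX : Rlim F X 0) by (apply (Rlim_ln_Cmod_unit F _ _ Lx Mx)).
  assert (LY : Rlim F Y 0) by (apply (Rlim_ln_Cmod_unit F _ _ Ly My)).
  assert (Bk : F (fun p' => Rabs (Im (k p')) <= 1 * m p')).
  { generalize By. apply filter_imp. intros p' H.
    eapply Rle_trans; [apply im_le_Cmod|]. rewrite Rk. exact H. }
  assert (Bg : F (fun p' => Rabs (Im (g p')) <= Mq * m p')).
  { generalize Br. apply filter_imp. intros p' H.
    eapply Rle_trans; [apply im_le_Cmod|]. rewrite Rg. exact H. }
  exists (fun w => Im (0 * fst w + 0 * snd w)%C). split.
  2:{ intros [u v] _. unfold eta. simpl fst. simpl snd.
      rewrite Mx, My, ln_1. unfold Im; simpl; ring. }
  apply filterdiff_curve; [exact Hc|]. fold F m.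
  (* On the curve [ln |q(x')| = c + (d + 1) Y] and [ln |q(y')| = c + (d + 1) Y + X - Y]. In [Im h ln
     |q(x')| - Im k ln |q(y')| - Im g c] the unbounded [c] keeps only the second-order factor
     [Im (g k)]; every other term carries [X], [Y] or [g k]. *)
  apply (negl_ext_loc F _ (fun p' => / (INR d + 2) * (
    (dilog_pow d (fst p') - dilog_pow d x
       - (Im ((fst p' - x) / x)%C * ln (Cmod (geom d (fst p'))) - Im ((fst p' - x) / x)%C)) +
    ((-1) * (dilog_pow d (snd p') - dilog_pow d y
       - (Im ((snd p' - y) / y)%C * ln (Cmod (geom d (snd p'))) - Im ((snd p' - y) / y)%C)) +
    ((-1) * (dilog_pow d (fst p' / snd p')%C - dilog_pow d r
       - (Im ((fst p' / snd p' - r) / r)%C * ln (Cmod (geom d (fst p' / snd p')%C))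
          - Im ((fst p' / snd p' - r) / r)%C)) +
    (Im (g p' * k p')%C * c p' + (Im (g p' * k p')%C * (INR (S d) * Y p' - 1) +
     ((-1) * (Im (k p') * X p') + (Im (k p') * Y p'
      + INR (S d) * (Im (g p') * Y p')))))))))).
  { generalize (filter_and _ _ (curve_filter_curve (P_ d) (x, y))
      (filter_and _ _ (Clim_locally_comp F _ _ _ Ly (root_of_unity_lower_bound d y Ry))
         (Clim_locally_comp F _ _ _ Lr (root_of_unity_lower_bound d r Rr)))).
    apply filter_imp. intros [x' y'] [[Hx' [Hy' [HP' _]]] [Lowy Lowr]].
    simpl in Hx', Hy'.
    change (Cmod (y' - y)%C <= 2 * Cmod (y' ^ S d - 1)%C) in Lowy.
    change (Cmod (x' / y' - r)%C <= 2 * Cmod ((x' / y') ^ S d - 1)%C) in Lowr.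
    rewrite !V_dilog_pow by assumption. unfold c, X, Y, k, g in *. fold r.
    simpl fst. simpl snd.
    assert (Hh : ((x' - x) / x)%C
      = ((y' - y) / y + (x' / y' - r) / r + (x' / y' - r) / r * ((y' - y) / y))%C)
      by (unfold r; field; repeat split; assumption).
    replace (Im (0 * (x' - x) + 0 * (y' - y))%C) with 0 by (unfold Im; simpl; ring).
    rewrite Hh.
    set (K := ((y' - y) / y)%C) in *. set (G := ((x' / y' - r) / r)%C) in *.
    replace (Im (K + G + G * K)%C) with (Im K + Im G + Im (G * K)%C)
      by (unfold Im; simpl; ring).
    destruct (Ceq_dec (geom d x') 0) as [Hg|Hg].
    - assert (Hgy : geom d y' = RtoC 0).
      { pose proof (P_0_geom d x' y' HP') as E. rewrite Hg, Cmult_0_r in E.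
        destruct (Ceq_dec (geom d y') 0) as [|Hn]; [assumption|].
        exfalso. apply (Cmult_neq_0 _ _ Hy' Hn). now symmetry. }
      assert (Hgr : geom d (x' / y')%C = RtoC 0).
      { pose proof (P_0_geom_quot d x' y' Hy' HP') as E. rewrite Hg in E.
        destruct (Ceq_dec (geom d (x' / y')%C) 0) as [|Hn]; [assumption|].
        exfalso. exact (Cmult_neq_0 _ _ (Cpow_nz y' (S d) Hy') Hn E). }
      assert (HK : K = RtoC 0).
      { apply Cmod_eq_0. pose proof (Cmod_ge_0 K).
        rewrite (geom_root d y' Hgy) in Lowy.
        replace (1 - 1)%C with (RtoC 0) in Lowy by ring. rewrite Cmod_0 in Lowy.
        pose proof (Rk (x', y')) as E. simpl in E. fold K in E. lra. }
      assert (HG : G = RtoC 0).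
      { apply Cmod_eq_0. pose proof (Cmod_ge_0 G).
        rewrite (geom_root d _ Hgr) in Lowr.
        replace (1 - 1)%C with (RtoC 0) in Lowr by ring. rewrite Cmod_0 in Lowr.
        pose proof (Rg (x', y')) as E. simpl in E. fold G in E. lra. }
      rewrite HK, HG. replace (Im (0 * 0)%C) with 0 by (unfold Im; simpl; ring).
      replace (Im 0) with 0 by reflexivity. ring.
    - destruct (ln_geom_curve d x' y' Hx' Hy' HP' Hg) as [_ [_ [E1 E2]]].
      rewrite E1, E2. ring. }
  apply (negl_scal F). apply (negl_plus F).
  { apply (negl_comp F m fst x (fun z => dilog_pow d z - dilog_pow d x
      - (Im ((z - x) / x)%C * ln (Cmod (geom d z)) - Im ((z - x) / x)%C)) 1);
      [exact Lx|apply fst_le_dist|exact Hm|now apply dilog_pow_near_root]. }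
  apply (negl_plus F).
  { apply (negl_scal F).
    apply (negl_comp F m snd y (fun z => dilog_pow d z - dilog_pow d y
      - (Im ((z - y) / y)%C * ln (Cmod (geom d z)) - Im ((z - y) / y)%C)) 1);
      [exact Ly|exact By|exact Hm|now apply dilog_pow_near_root]. }
  apply (negl_plus F).
  { apply (negl_scal F).
    apply (negl_comp F m (fun p' => fst p' / snd p')%C r (fun z => dilog_pow d z - dilog_pow d r
      - (Im ((z - r) / r)%C * ln (Cmod (geom d z)) - Im ((z - r) / r)%C)) Mq);
      [exact Lr|exact Br|exact Hm|now apply dilog_pow_near_root]. }
  apply (negl_plus F).
  (* The lower bound gives [|g| <= 2 |r' - 1| |q(r')|] for [r' = x' / y'], so [g c] is at most a
     bounded factor times [|q(r')| (1 + |ln |q(r')||)], which tends to [0]; the remaining factor [k]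
     is [O(m)]. *)
  { destruct (ex_C_differential_geom d r) as [lr Hlr].
    assert (Le : Clim F (fun p' => geom d (fst p' / snd p')%C) 0).
    { intros eps He. apply (Clim_locally_comp F _ _ (fun z => Cmod (geom d z - 0)%C <= eps) Lr).
      pose proof (C_differential_Clim _ _ _ Hlr) as L. rewrite Hqr in L. exact (L eps He). }
    assert (L1 : Clim F (fun p' => fst p' / snd p' - 1)%C (r - 1)%C)
      by (apply (Clim_minus F); [exact Lr|apply (Clim_const F)]).
    apply (negl_dom F _ _ (fun p' => Cmod (snd p' - y)%C *
      ((Cmod (geom d (fst p' / snd p')%C) * (1 + Rabs (c p')))
       * (2 * Cmod (fst p' / snd p' - 1)%C)))).
    - generalize (Clim_locally_comp F _ _ _ Lr (root_of_unity_lower_bound d r Rr)).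
      apply filter_imp. intros p' H. rewrite <- geom_mult, Cmod_mult in H.
      rewrite <- (Rg p') in H.
      pose proof (Rabs_pos (c p')) as Pc. pose proof (Cmod_ge_0 (k p')) as Pk.
      pose proof (Cmod_ge_0 (g p')) as Pg.
      pose proof (Cmod_ge_0 (geom d (fst p' / snd p')%C)) as P1.
      pose proof (Cmod_ge_0 (fst p' / snd p' - 1)%C) as P2.
      rewrite <- (Rk p').
      rewrite (Rabs_pos_eq (Cmod (k p') * _)).
      2:{ apply Rmult_le_pos; [exact Pk|]. apply Rmult_le_pos; [nra|lra]. }
      rewrite Rabs_mult.
      apply Rle_trans with (Cmod (g p' * k p')%C * (1 + Rabs (c p'))).
      + apply Rmult_le_compat; [apply Rabs_pos|exact Pc|apply im_le_Cmod|lra].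
      + rewrite Cmod_mult.
        replace (Cmod (k p') * (Cmod (geom d (fst p' / snd p')%C) * (1 + Rabs (c p'))
                 * (2 * Cmod (fst p' / snd p' - 1)%C)))
          with (2 * (Cmod (fst p' / snd p' - 1)%C * Cmod (geom d (fst p' / snd p')%C))
                * Cmod (k p') * (1 + Rabs (c p'))) by ring.
        apply Rmult_le_compat_r; [lra|]. apply Rmult_le_compat_r; [exact Pk|exact H].
    - apply (negl_mult_Rlim F _ _ _ 1); [|exact Hm|].
      + generalize By. apply filter_imp. intros p' H.
        rewrite Rabs_pos_eq by apply Cmod_ge_0. exact H.
      + apply (Rlim_mult_bounded F _ _ (2 * (Cmod (r - 1)%C + 1))).
        * exact (Rlim_Cmod_ln F _ Le).
        * generalize (Clim_bounded F _ _ L1). apply filter_imp. intros p' H.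
          rewrite Rabs_pos_eq; [lra|]. pose proof (Cmod_ge_0 (fst p' / snd p' - 1)%C). lra. }
  apply (negl_plus F).
  { apply (negl_dom F _ _ (fun p' => Cmod (snd p' - y)%C *
      (Cmod (fst p' / snd p' - r)%C * (INR (S d) * Y p' - 1)))).
    - apply filter_forall. intros p'. rewrite <- (Rk p'), <- (Rg p').
      rewrite !Rabs_mult, !(Rabs_pos_eq (Cmod _)) by apply Cmod_ge_0.
      rewrite <- Rmult_assoc. apply Rmult_le_compat_r; [apply Rabs_pos|].
      rewrite Rmult_comm, <- Cmod_mult. apply im_le_Cmod.
    - apply (negl_mult_Rlim F _ _ _ 1); [|exact Hm|].
      + generalize By. apply filter_imp. intros p' H.
        rewrite Rabs_pos_eq by apply Cmod_ge_0. exact H.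
      + apply (Rlim_mult_bounded F _ _ (INR (S d) + 1)).
        * intros eps He. generalize (Lr eps He). apply filter_imp. intros p' H.
          rewrite Rminus_0_r, Rabs_pos_eq by apply Cmod_ge_0. exact H.
        * generalize (LY 1 Rlt_0_1). apply filter_imp. intros p' H.
          rewrite Rminus_0_r in H. apply Rabs_le_between in H.
          pose proof (pos_INR (S d)). apply Rabs_le. nra. }
  apply (negl_plus F).
  { apply (negl_scal F). exact (negl_mult_Rlim F _ _ _ 1 Bk Hm LX). }
  apply (negl_plus F).
  { exact (negl_mult_Rlim F _ _ _ 1 Bk Hm LY). }
  apply (negl_scal F). exact (negl_mult_Rlim F _ _ _ Mq Bg Hm LY).
Qed.

Lemma volume_function_V (d : nat) : volume_function (P_ d) (V_ d).
Proof.
  intros [x y] Hc. destruct (Ceq_dec (geom d x) 0) as [H|H].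
  - exact (volume_function_singular d x y Hc H).
  - exact (volume_function_regular d x y Hc H).
Qed.

Theorem theorem2p2 :
  (forall d : nat, (1 <= d)%nat -> exact_polynomial (P_ d)) /\
  (forall d : nat, (2 <= d)%nat -> volume_function (P_ d) (V_ d)).
Proof.
  split.
  - intros d _. exists (V_ d). apply volume_function_V.
  - intros d _. apply volume_function_V.
Qed.
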